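(* For every integer $n\ge 3$ there exists a (non-compact) irreducible homogeneous Kähler manifold $(M,g,J)$ of complex dimension $n$ whose Ricci tensor has two distinct constant eigenvalues, both negative.
   Context: A Kähler manifold $(M,g,J)$ is homogeneous if the group of all its holomorphic isometries acts transitively on $M$. Manifolds are connected. Irreducible means irreducible as a Riemannian manifold (the restricted holonomy group acts irreducibly on tangent spaces, i.e. $(M,g)$ is not even locally a non-trivial Riemannian product). The eigenvalues of the Ricci tensor are those of the symmetric endomorphism of $TM$ corresponding to it via $g$; ''two distinct constant eigenvalues'' means that at every point the set of eigenvalues is $\{\lambda,\mu\}$ for fixed real constants $\lambda\neq\mu$. *)

(* Defs.v *)
From HB Require Import structures.
From mathcomp Require Import all_boot all_order all_algebra.
From mathcomp Require Import all_classical all_reals all_analysis.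

Set Implicit Arguments.
Unset Strict Implicit.
Unset Printing Implicit Defensive.
Import Order.TTheory GRing.Theory Num.Theory.
Import numFieldNormedType.Exports.
Local Open Scope classical_set_scope.
Local Open Scope ring_scope.

(* Tangent vectors in a chart are row vectors and linear maps act on the right,
   as for 'J f x in the library: the differential of f at x is v |-> v *m 'J f x,
   and a bilinear form b is the matrix B with b(v, w) = v *m B *m w^T. *)

(* C^oo on an open set U (only used between finite-dimensional spaces): all
   iterated directional derivatives exist and are continuous on U. *)
Definition smooth_on (R : realType) (V W : normedModType R)
    (U : set V) (f : V -> W) : Prop :=
  forall (s : seq V) (x : V), U x ->
    let Df := foldr (fun v h => 'D_v h) f s in
    {for x, continuous Df} /\ forall v, derivable Df x v.

Record smoothManifold (R : realType) (m : nat) := SmoothManifold {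
  mfd_carrier :> topologicalType;
  mfd_index : Type;
  (* chart i restricts to a homeomorphism from chart_dom i onto an open subset
     of R^m, with inverse chart_inv i; values elsewhere are irrelevant *)
  chart_dom : mfd_index -> set mfd_carrier;
  chart : mfd_index -> mfd_carrier -> 'rV[R]_m;
  chart_inv : mfd_index -> 'rV[R]_m -> mfd_carrier;
  mfd_hausdorff : hausdorff_space mfd_carrier;
  mfd_second_countable : @second_countable mfd_carrier;
  mfd_nonempty : [set: mfd_carrier] !=set0;
  mfd_connected : connected [set: mfd_carrier];
  chart_cover : forall p, exists i, chart_dom i p;
  chart_dom_open : forall i, open (chart_dom i);
  chart_ran_open : forall i, open (chart i @` chart_dom i);
  chartK : forall i p, chart_dom i p -> chart_inv i (chart i p) = p;
  chart_continuous :
    forall i p, chart_dom i p -> {for p, continuous (chart i)};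
  chart_inv_continuous : forall i x, (chart i @` chart_dom i) x ->
    {for x, continuous (chart_inv i)};
  chart_smooth : forall i j,
    smooth_on [set x | (chart i @` chart_dom i) x /\ chart_dom j (chart_inv i x)]
      (chart j \o chart_inv i)
}.

Definition chart_ran (R : realType) (m : nat) (M : smoothManifold R m)
    (i : mfd_index M) : set 'rV[R]_m :=
  chart i @` chart_dom i.

(* f : M -> M read in the charts i (source) and j (target); for f = id this is
   the transition map from i to j *)
Definition rep_dom (R : realType) (m : nat) (M : smoothManifold R m)
    (f : M -> M) (i j : mfd_index M) : set 'rV[R]_m :=
  [set x | chart_ran i x /\ chart_dom j (f (chart_inv i x))].

Definition rep (R : realType) (m : nat) (M : smoothManifold R m)
    (f : M -> M) (i j : mfd_index M) : 'rV[R]_m -> 'rV[R]_m :=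
  fun x => chart j (f (chart_inv i x)).

Definition smooth_map (R : realType) (m : nat) (M : smoothManifold R m)
    (f : M -> M) : Prop :=
  continuous f /\ forall i j, smooth_on (rep_dom f i j) (rep f i j).

(* metric i x is the Gram matrix of the coordinate frame of chart i at the
   point of coordinates x *)
Record riemannianMetric (R : realType) (m : nat) (M : smoothManifold R m) :=
  RiemannianMetric {
  metric :> mfd_index M -> 'rV[R]_m -> 'M[R]_m;
  metric_smooth : forall i, smooth_on (chart_ran i) (metric i);
  metric_sym : forall i x, chart_ran i x -> (metric i x)^T = metric i x;
  metric_pos : forall i x, chart_ran i x ->
    forall v : 'rV[R]_m, v != 0 -> 0 < (v *m metric i x *m v^T) 0 0;
  metric_compat : forall i j x, rep_dom id i j x ->
    metric i x = 'J (rep id i j) x *m metric j (rep id i j x)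
                   *m ('J (rep id i j) x)^T
}.

Definition partial (R : realType) (m : nat) (a : 'I_m)
    (f : 'rV[R]_m -> R) (x : 'rV[R]_m) : R :=
  'D_(delta_mx 0 a) f x.

(* The next definitions are the classical coordinate formulas for a metric with
   coordinate matrix G.  christoffel G k a b is Gamma^k_{ab} *)
Definition christoffel (R : realType) (m : nat) (G : 'rV[R]_m -> 'M[R]_m)
    (k a b : 'I_m) (x : 'rV[R]_m) : R :=
  2^-1 * \sum_(l < m) invmx (G x) k l *
    (partial a (fun y => G y b l) x + partial b (fun y => G y a l) x
     - partial l (fun y => G y a b) x).

(* coefficient of d_l in R(d_a, d_b) d_c,
   where R(X, Y) = [nabla_X, nabla_Y] - nabla_[X, Y] *)
Definition riemann (R : realType) (m : nat) (G : 'rV[R]_m -> 'M[R]_m)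
    (l c a b : 'I_m) (x : 'rV[R]_m) : R :=
  partial a (christoffel G l b c) x - partial b (christoffel G l a c) x
  + \sum_(p < m) (christoffel G l a p x * christoffel G p b c x
                  - christoffel G l b p x * christoffel G p a c x).

(* Ric(Y, Z) = trace (X |-> R(X, Y) Z) *)
Definition ricci (R : realType) (m : nat) (G : 'rV[R]_m -> 'M[R]_m)
    (x : 'rV[R]_m) : 'M[R]_m :=
  \matrix_(b, c) \sum_(a < m) riemann G a c a b x.

(* the endomorphism A with g(A v, w) = Ric(v, w), in the row convention *)
Definition ricci_endo (R : realType) (m : nat) (G : 'rV[R]_m -> 'M[R]_m)
    (x : 'rV[R]_m) : 'M[R]_m :=
  ricci G x *m invmx (G x).

Definition ricci_eigenvalues_are (R : realType) (m : nat)
    (M : smoothManifold R m) (g : riemannianMetric M) (lam mu : R) : Prop :=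
  forall i x, chart_ran i x ->
    forall a : R, eigenvalue (ricci_endo (g i) x) a <-> a = lam \/ a = mu.

(** Restricted holonomy *)

Definition smooth_curve_on (R : realType) (m : nat) (M : smoothManifold R m)
    (O : set R) (c : R -> M) : Prop :=
  (forall t, O t -> {for t, continuous c}) /\
  forall i, smooth_on (O `&` c @^-1` chart_dom i) (chart i \o c).

(* On each closed interval of a subdivision of [0, 1], the curve extends to a
   smooth curve on an open set of times. *)
Definition piecewise_smooth (R : realType) (m : nat) (M : smoothManifold R m)
    (c : R -> M) : Prop :=
  exists (k : nat) (s : nat -> R), s 0%N = 0 /\ s k = 1 /\
    forall l, (l < k)%N -> s l < s l.+1 /\
      exists (O : set R) (e : R -> M),
        [/\ open O, `[s l, s l.+1]%classic `<=` O, smooth_curve_on O e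
          & forall t : R, t \in `[s l, s l.+1] -> c t = e t].

(* homotopy of loops based at p, from c to the constant loop *)
Definition null_homotopic (R : realType) (m : nat) (M : smoothManifold R m)
    (p : M) (c : R -> M) : Prop :=
  exists H : R * R -> M,
    {within `[0, 1]%classic `*` `[0, 1]%classic, continuous H} /\
    forall t : R, t \in `[0, 1] ->
      [/\ H (0, t) = c t, H (1, t) = p, H (t, 0) = p & H (t, 1) = p].

(* V t i is the coordinate vector in chart i of a vector tangent to M at c t.
   A parallel field along a piecewise smooth curve is a continuous one that
   satisfies V'^k + Gamma^k_{ab} c'^a V^b = 0 except at finitely many times. *)
Definition parallel_along (R : realType) (m : nat) (M : smoothManifold R m)
    (g : riemannianMetric M) (c : R -> M) (V : R -> mfd_index M -> 'rV[R]_m)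
    : Prop :=
  [/\ forall (t : R) i j, t \in `[0, 1] ->
        chart_dom i (c t) -> chart_dom j (c t) ->
        V t j = V t i *m 'J (rep id i j) (chart i (c t)),
      forall i, {within `[0, 1]%classic `&` c @^-1` chart_dom i,
                 continuous (fun t => V t i)}
    & exists E : seq R, forall (t : R) i,
        t \in `]0, 1[ -> t \notin E -> chart_dom i (c t) ->
        is_derive t 1 (fun u => V u i)
          (- \row_k \sum_(a < m) \sum_(b < m)
               christoffel (g i) k a b (chart i (c t))
               * 'D_1 (chart i \o c) t 0 a * V t i 0 b)].

(* T_p M is identified with R^m by a chart i at p; P is the parallel transport
   around some null-homotopic piecewise smooth loop based at p *)
Definition restricted_holonomy (R : realType) (m : nat)
    (M : smoothManifold R m) (g : riemannianMetric M) (p : M)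
    (i : mfd_index M) (P : 'M[R]_m) : Prop :=
  exists c : R -> M,
    [/\ c 0 = p /\ c 1 = p, piecewise_smooth c, null_homotopic p c
      & forall v : 'rV[R]_m, exists V : R -> mfd_index M -> 'rV[R]_m,
          [/\ parallel_along g c V, V 0 i = v & V 1 i = v *m P]].

(* subspaces of T_p M are represented as row spaces *)
Definition irreducible_metric (R : realType) (m : nat)
    (M : smoothManifold R m) (g : riemannianMetric M) : Prop :=
  forall (p : M) (i : mfd_index M), chart_dom i p ->
  forall W : 'M[R]_m,
    (forall P, restricted_holonomy g p i P -> stablemx W P) ->
    W = 0 \/ row_full W.

(** Kaehler structures *)

(* C^n is R^(n + n) through z = x + iy |-> (x, y), and mulI is the matrix of
   multiplication by i: (x, y) |-> (- y, x). *)
Definition mulI (R : realType) (n : nat) : 'M[R]_(n + n) :=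
  block_mx 0 1%:M (- 1%:M) 0.

(* the transition maps are holomorphic (Cauchy-Riemann equations), so that M is
   a complex manifold of dimension n; its J is mulI in every chart *)
Definition holomorphic_atlas (R : realType) (n : nat)
    (M : smoothManifold R (n + n)) : Prop :=
  forall (i j : mfd_index M) x, rep_dom id i j x ->
    mulI R n *m 'J (rep id i j) x = 'J (rep id i j) x *m mulI R n.

(* matrix of the fundamental form omega(v, w) = g(Jv, w) *)
Definition kaehler_form (R : realType) (n : nat)
    (M : smoothManifold R (n + n)) (g : riemannianMetric M)
    (i : mfd_index M) (x : 'rV[R]_(n + n)) : 'M[R]_(n + n) :=
  mulI R n *m g i x.

Definition kaehler (R : realType) (n : nat) (M : smoothManifold R (n + n))
    (g : riemannianMetric M) : Prop :=
  [/\ holomorphic_atlas M,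
      forall i x, chart_ran i x -> mulI R n *m g i x *m (mulI R n)^T = g i x
    & forall (i : mfd_index M) x, chart_ran i x ->
      forall a b c : 'I_(n + n),
        partial a (fun y => kaehler_form g i y b c) x
        + partial b (fun y => kaehler_form g i y c a) x
        + partial c (fun y => kaehler_form g i y a b) x = 0].

Definition holomorphic_isometry (R : realType) (n : nat)
    (M : smoothManifold R (n + n)) (g : riemannianMetric M) (f : M -> M)
    : Prop :=
  [/\ smooth_map f,
      exists2 h : M -> M, smooth_map h & cancel f h /\ cancel h f
    & forall (i j : mfd_index M) x, rep_dom f i j x ->
        let A := 'J (rep f i j) x in
        mulI R n *m A = A *m mulI R n /\
        A *m g j (rep f i j x) *m A^T = g i x].

Definition homogeneous (R : realType) (n : nat)
    (M : smoothManifold R (n + n)) (g : riemannianMetric M) : Prop :=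
  forall p q : M, exists2 f : M -> M, holomorphic_isometry g f & f p = q.

(* Main.v *)
(* M is the tube R^n + i Omega over a Lorentz cone, Omega = {q > 0, y_1 > 0} with
   q = y_0 y_1 - (3/2) |u|^2 and y = (y_0, y_1, u), with the Kaehler metric
   diag(H, H) given by the Hessian H of - log q - 2 log y_1.  The translations in
   the real direction and the linear automorphisms of the cone that fix the line
   of the linear form y_1 are transitive; the weight 2 of log y_1 breaks the
   symmetry of the classical domain, and the Ricci tensor is
   - (n/2) (H - 2 dy_1^2 / y_1^2), with eigenvalues - n/2 and - n/6.
   Along curves in the real direction the Christoffel symbols are constant, so
   parallel transport is a product of rotations exp (th X) with X^3 = - X, and
   parallelograms give the commutators of exp (a D) and exp (b S_j).  For a = pi
   the commutator is exp (- 2 b S_j), and a = pi / 2 then gives the conjugate of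
   exp (b S_j) by exp ((pi / 2) D).  Hence a subspace that is stable under the
   restricted holonomy is stable under S_j and A_j = exp ((pi / 2) D) S_j
   exp (- (pi / 2) D), and the algebra that these generate acts irreducibly. *)
Require Import Defs.
From HB Require Import structures.
From mathcomp Require Import all_boot all_order all_algebra all_fingroup.
From mathcomp Require Import all_classical all_reals all_analysis.
From mathcomp Require Import ring lra.
Set Implicit Arguments.
Unset Strict Implicit.
Unset Printing Implicit Defensive.
Import Order.TTheory GRing.Theory Num.Theory.
Import numFieldNormedType.Exports.
Local Open Scope classical_set_scope.
Local Open Scope ring_scope.

(** * Derivatives and rational functions *)

(** The Ricci tensor sees only q: an automorphism with A Q A^T = k Q has (det A)^2 = k^n, whatever
    factor m it puts on y_1. By transitivity det H is therefore a constant multiple of q^(-n), and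
    the Ricci tensor comes from log q alone, while the metric also contains log y_1. The two
    Hessians differ by a rank-one term, which produces exactly two eigenvalues; their ratio 1/3 is
    1/(1 + 2), where 2 is the weight of log y_1. Irreducibility is stated through parallel transport
    around actual loops, so what is available is a supply of group elements and not a Lie algebra.
    Because X^3 = - X, the matrices X and X^2 are linear combinations of 1 and the rotations by pi/2
    and pi, and the generators are recovered algebraically from a few explicit angles. The condition
    n >= 3 provides a coordinate u. For n = 2 the potential is - log y_0 - 3 log y_1, and the tube
    is a product of two half-planes. *)

Lemma continuous_mx (R : realType) (T : topologicalType) (m n : nat)
    (f : T -> 'M[R]_(m, n)) (x : T) :
  (forall i j, {for x, continuous (fun y => f y i j)}) ->
  {for x, continuous f}.
Proof.
move=> fx; apply/cvgrPdist_le => e e0.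
have : \forall y \near x, forall ij : 'I_m * 'I_n,
    `|f x ij.1 ij.2 - f y ij.1 ij.2| <= e.
  apply: filter_forall => -[i j] /=.
  exact: ((cvgrPdist_le _ _).1 (fx i j)).
apply: filterS => y fy.
rewrite /Num.Def.normr /= mx_normrE (bigmax_le _ (ltW e0))//= => ij _.
by rewrite !mxE; exact: fy.
Qed.

Lemma near_eq_continuous (T U : topologicalType) (f g : T -> U) (x : T) :
  (\forall y \near x, g y = f y) ->
  {for x, continuous g} -> {for x, continuous f}.
Proof.
move=> nE cg; have cgf : g @ x --> f x by rewrite -(nbhs_singleton nE); exact: cg.
exact: cvg_trans (near_eq_cvg nE) cgf.
Qed.

(** Openness of [U] turns equality on [U] into equality near each of its points, and this passes
    through every iterated derivative. *)
Lemma smooth_on_ext (R : realType) (V W : normedModType R) (U : set V)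
    (f g : V -> W) :
  open U -> (forall x, U x -> f x = g x) -> smooth_on U g -> smooth_on U f.
Proof.
move=> Uo fg sg s x Ux.
have eqD : forall x, U x -> foldr (fun v h => 'D_v h) f s x
    = foldr (fun v h => 'D_v h) g s x.
  elim: s {sg x Ux} => [|v s ih] x Ux /=; first exact: fg.
  apply: near_eq_derive; exact: filterS ih (open_nbhs_nbhs (conj Uo Ux)).
have nE : \forall y \near x, foldr (fun v h => 'D_v h) g s y
    = foldr (fun v h => 'D_v h) f s y.
  by apply: filterS (open_nbhs_nbhs (conj Uo Ux)) => y Uy; rewrite eqD.
have [cg dg] := sg s x Ux; split.
  exact: near_eq_continuous nE cg.
by move=> v; exact: near_eq_derivable (dg v).
Qed.

Lemma smooth_on_mx (R : realType) (V : normedModType R) (U : set V) (m n : nat)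
    (f : V -> 'M[R]_(m, n)) :
  open U -> (forall i j, smooth_on U (fun x => f x i j)) -> smooth_on U f.
Proof.
move=> Uo sf s x Ux.
have eqD : forall x, U x -> foldr (fun v h => 'D_v h) f s x
    = \matrix_(i, j) foldr (fun v h => 'D_v h) (fun y => f y i j) s x.
  elim: s {x Ux} => [|v s ih] x Ux /=.
    by apply/matrixP => i j; rewrite mxE.
  have nE : \forall y \near x, (\matrix_(i, j)
     foldr (fun v h => 'D_v h) (fun y => f y i j) s y) = foldr (fun v h => 'D_v h) f s y.
    by apply: filterS (open_nbhs_nbhs (conj Uo Ux)) => y Uy; rewrite ih.
  rewrite -(near_eq_derive _ nE) derive_mx.
    apply/matrixP => i j; rewrite !mxE; congr ('D_v _ _).
    by apply/funext => t; rewrite mxE.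
  apply/derivable_mxP => i j.
  rewrite (_ : (fun _ => _) = foldr (fun v h => 'D_v h) (fun y => f y i j) s).
    by have [_] := sf i j s x Ux; exact.
  by apply/funext => t; rewrite mxE.
have nE : \forall y \near x, (\matrix_(i, j)
     foldr (fun v h => 'D_v h) (fun y => f y i j) s y) = foldr (fun v h => 'D_v h) f s y.
  by apply: filterS (open_nbhs_nbhs (conj Uo Ux)) => y Uy; rewrite eqD.
split=> [|v].
  apply: near_eq_continuous nE _; apply: continuous_mx => i j.
  rewrite (_ : (fun _ => _) = foldr (fun v h => 'D_v h) (fun y => f y i j) s).
    by have [] := sf i j s x Ux.
  by apply/funext => t; rewrite mxE.
apply: near_eq_derivable nE _; apply/derivable_mxP => i j.
rewrite (_ : (fun _ => _) = foldr (fun v h => 'D_v h) (fun y => f y i j) s).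
  by have [_] := sf i j s x Ux; exact.
by apply/funext => t; rewrite mxE.
Qed.

(* The rational functions without poles on U form an algebra of smooth
   functions because it is stable under derivation. *)
Inductive rational_on (R : realType) (V : normedModType R) (U : set V) :
    (V -> R) -> Prop :=
| rational_affine (l dl : V -> R) :
    continuous l -> (forall x v, is_derive x v l (dl v)) -> rational_on U l
| rational_add (f g : V -> R) :
    rational_on U f -> rational_on U g -> rational_on U (fun x => f x + g x)
| rational_mul (f g : V -> R) :
    rational_on U f -> rational_on U g -> rational_on U (fun x => f x * g x)
| rational_inv (f : V -> R) : (forall x, U x -> f x != 0) ->
    rational_on U f -> rational_on U (fun x => (f x)^-1).

Section RationalOn.
Variables (R : realType) (V : normedModType R) (U : set V).

Lemma rational_cst (c : R) : rational_on U (fun=> c).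
Proof.
by apply: (@rational_affine _ _ _ _ (fun=> 0)); exact: cst_continuous.
Qed.

Lemma rational_sum (I : Type) (r : seq I) (F : I -> V -> R) :
  (forall i, rational_on U (F i)) -> rational_on U (fun x => \sum_(i <- r) F i x).
Proof.
move=> rF; elim: r => [|i r ih].
  rewrite (_ : (fun _ => _) = fun=> 0); first exact: rational_cst.
  by apply/funext => x; rewrite big_nil.
rewrite (_ : (fun _ => _) = fun x => F i x + \sum_(j <- r) F j x).
  exact: rational_add.
by apply/funext => x; rewrite big_cons.
Qed.

Lemma rational_opp (f : V -> R) : rational_on U f -> rational_on U (fun x => - f x).
Proof.
move=> rf; rewrite (_ : (fun _ => _) = fun x => (-1) * f x).
  by apply: rational_mul => //; exact: rational_cst.
by apply/funext => x; rewrite mulN1r.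
Qed.

Lemma rational_exp (f : V -> R) k : rational_on U f -> rational_on U (fun x => f x ^+ k).
Proof.
move=> rf; elim: k => [|k ih].
  by under [X in rational_on U X]eq_fun do rewrite expr0; exact: rational_cst.
by under [X in rational_on U X]eq_fun do rewrite exprS; exact: rational_mul.
Qed.

(** The derivative agrees with a rational function on [U] only, since denominators may vanish
    elsewhere. Continuity and derivability belong to the same induction because the product and
    inverse rules use them. *)
Lemma rational_on_derive (f : V -> R) : rational_on U f ->
  (forall x, U x -> {for x, continuous f} /\ forall v, derivable f x v) /\
  forall v, exists2 g, rational_on U g & forall x, U x -> 'D_v f x = g x.
Proof.
elim=> {f}.
- move=> l dl cl dle; split=> [x _|v].
    by split=> [|v]; [exact: cl|have [] := dle x v].
  exists (fun=> dl v); first exact: rational_cst.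
  by move=> x _; have [] := dle x v.
- move=> f g rf [cf df] rg [cg dg]; split=> [x Ux|v].
    have [cfx dfx] := cf _ Ux; have [cgx dgx] := cg _ Ux.
    by split=> [|v]; [exact: cvgD|exact: derivableD].
  have [f' rf' ef] := df v; have [g' rg' eg] := dg v.
  exists (fun x => f' x + g' x) => [|x Ux]; first exact: rational_add.
  have [_ dfx] := cf _ Ux; have [_ dgx] := cg _ Ux.
  by rewrite deriveD // ef // eg.
- move=> f g rf [cf df] rg [cg dg]; split=> [x Ux|v].
    have [cfx dfx] := cf _ Ux; have [cgx dgx] := cg _ Ux.
    by split=> [|v]; [exact: cvgM|exact: derivableM].
  have [f' rf' ef] := df v; have [g' rg' eg] := dg v.
  exists (fun x => f x * g' x + g x * f' x) => [|x Ux].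
    by apply: rational_add; exact: rational_mul.
  have [_ dfx] := cf _ Ux; have [_ dgx] := cg _ Ux.
  by rewrite deriveM // ef // eg.
- move=> f f0 rf [cf df]; split=> [x Ux|v].
    have [cfx dfx] := cf _ Ux.
    by split=> [|v]; [apply: cvgV => //; exact: f0|apply: derivableV => //; exact: f0].
  have [f' rf' ef] := df v.
  exists (fun x => - (f x)^-1 ^+ 2 * f' x) => [|x Ux].
    by apply: rational_mul => //; apply/rational_opp/rational_exp/rational_inv.
  have [_ dfx] := cf _ Ux.
  by rewrite deriveV ?f0 // ef // exprVn.
Qed.

Lemma rational_smooth (f : V -> R) : open U -> rational_on U f -> smooth_on U f.
Proof.
move=> Uo rf s.
have [g rg eg] : exists2 g, rational_on U g &
    forall x, U x -> foldr (fun v h => 'D_v h) f s x = g x.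
  elim: s => [|v s [g rg eg]] /=; first by exists f.
  have [_ /(_ v) [g' rg' eg']] := rational_on_derive rg.
  exists g' => // x Ux; rewrite -eg' //.
  by apply: near_eq_derive; exact: filterS eg (open_nbhs_nbhs (conj Uo Ux)).
move=> x Ux; have [/(_ x Ux) [cg dg] _] := rational_on_derive rg.
have nE : \forall y \near x, g y = foldr (fun v h => 'D_v h) f s y.
  by apply: filterS (open_nbhs_nbhs (conj Uo Ux)) => y Uy; rewrite eg.
split=> [|v]; last exact: near_eq_derivable (dg v).
exact: near_eq_continuous nE cg.
Qed.

End RationalOn.

(** * Derivatives and continuity of matrix-valued functions *)

Section MatrixDerivatives.
Variable R : realType.

Lemma is_derive_coord m n (x v : 'M[R]_(m, n)) i j :
  is_derive x v (fun y : 'M[R]_(m, n) => y i j : R) (v i j).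
Proof.
split; first by apply: diff_derivable; exact: differentiable_coord.
have /derive_mx : derivable (@id 'M[R]_(m, n)) x v by exact: derivable_id.
by rewrite derive_id => /matrixP /(_ i j); rewrite mxE => <-.
Qed.

Lemma is_derive_mxP (V : normedModType R) m n (f : V -> 'M[R]_(m, n)) x v df :
  is_derive x v f df <->
  forall i j, is_derive x v (fun y => f y i j) (df i j).
Proof.
split=> [[dfx <-] i j|H].
  rewrite derive_mx // mxE; apply: DeriveDef => //.
  exact: (derivable_mxP f x v).1.
have dfx : derivable f x v by apply/derivable_mxP => i j; have [] := H i j.
apply: DeriveDef => //; rewrite derive_mx //; apply/matrixP => i j.
by rewrite mxE; have [] := H i j.
Qed.

Lemma is_derive_bigsum (V W : normedModType R) (I : Type) (r : seq I)
   (F : I -> V -> W) (dF : I -> W) x v :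
  (forall i, is_derive x v (F i) (dF i)) ->
  is_derive x v (fun y => \sum_(i <- r) F i y) (\sum_(i <- r) dF i).
Proof.
move=> H; elim: r => [|i r ih].
  rewrite big_nil (_ : (fun _ => _) = cst 0); first exact: is_derive_cst.
  by apply/funext => y; rewrite big_nil.
rewrite big_cons (_ : (fun _ => _) = F i + fun y => \sum_(j <- r) F j y).
  exact: is_deriveD.
by apply/funext => y; rewrite big_cons.
Qed.

Lemma is_derive_const (V : normedModType R) (c : R) (x v : V) :
  is_derive x v (fun=> c) (0 : R).
Proof. exact: is_derive_cst. Qed.

Lemma is_derive_add (V : normedModType R) (f g : V -> R) x v (df dg : R) :
  is_derive x v f df -> is_derive x v g dg ->
  is_derive x v (fun y => f y + g y) (df + dg).
Proof. exact: is_deriveD. Qed.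

Lemma is_derive_opp (V : normedModType R) (f : V -> R) x v (df : R) :
  is_derive x v f df -> is_derive x v (fun y => - f y) (- df).
Proof. exact: is_deriveN. Qed.

Lemma is_derive_mul (V : normedModType R) (f g : V -> R) x v (df dg : R) :
  is_derive x v f df -> is_derive x v g dg ->
  is_derive x v (fun y => f y * g y) (df * g x + f x * dg).
Proof.
move=> Hf Hg; have := is_deriveM Hf Hg.
by rewrite addrC /GRing.scale /= [g x * df]mulrC.
Qed.

Lemma is_derive_inv (V : normedModType R) (f : V -> R) x v (df : R) :
  f x != 0 -> is_derive x v f df ->
  is_derive x v (fun y => (f y)^-1) (- df / f x ^+ 2).
Proof.
move=> f0 [dfx <-]; apply: DeriveDef; first exact: derivableV.
by rewrite deriveV // /GRing.scale /= mulNr mulrC -mulNr -exprVn.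
Qed.

Lemma is_derive_mulmx (V : normedModType R) m n p (f : V -> 'M[R]_(m, n))
    (g : V -> 'M[R]_(n, p)) x v df dg :
  is_derive x v f df -> is_derive x v g dg ->
  is_derive x v (fun y => f y *m g y) (df *m g x + f x *m dg).
Proof.
move=> /is_derive_mxP Hf /is_derive_mxP Hg; apply/is_derive_mxP => i j.
rewrite (_ : (fun _ => _) = fun y => \sum_k f y i k * g y k j); last first.
  by apply/funext => y; rewrite mxE.
rewrite !mxE -big_split /=; apply: is_derive_bigsum => k.
exact: is_derive_mul.
Qed.

Lemma continuous_bigsum_at (T : topologicalType) (I : Type) (r : seq I)
    (F : I -> T -> R) x :
  (forall i, {for x, continuous (F i)}) ->
  {for x, continuous (fun y => \sum_(i <- r) F i y)}.
Proof.
move=> cF; elim: r => [|i r ih].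
  rewrite (_ : (fun _ => _) = fun=> 0); first exact: cst_continuous.
  by apply/funext => y; rewrite big_nil.
rewrite (_ : (fun _ => _) = fun y => F i y + \sum_(j <- r) F j y).
  exact: cvgD (cF i) ih.
by apply/funext => y; rewrite big_cons.
Qed.

Lemma continuous_coord_at (T : topologicalType) m n (f : T -> 'M[R]_(m, n)) x i j :
  {for x, continuous f} -> {for x, continuous (fun y => f y i j)}.
Proof. move=> cf; exact: (continuous_comp cf (@coord_continuous _ _ _ i j _)). Qed.

Lemma continuous_mulmx_at (T : topologicalType) m n p (f : T -> 'M[R]_(m, n))
    (g : T -> 'M[R]_(n, p)) x :
  {for x, continuous f} -> {for x, continuous g} ->
  {for x, continuous (fun y => f y *m g y)}.
Proof.
move=> cf cg; apply: continuous_mx => i j.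
rewrite (_ : (fun _ => _) = fun y => \sum_k f y i k * g y k j); last first.
  by apply/funext => y; rewrite mxE.
apply: continuous_bigsum_at => k.
exact: cvgM (continuous_coord_at cf) (continuous_coord_at cg).
Qed.

End MatrixDerivatives.

(** * Hessian metrics on tubes *)

Section TubeMetric.
Variables (R : realType) (n : nat).
Implicit Types (z : 'rV[R]_(n + n)) (y : 'rV[R]_n).

Definition tube_metric (H : 'rV[R]_n -> 'M[R]_n) z : 'M[R]_(n + n) :=
  block_mx (H (rsubmx z)) 0 0 (H (rsubmx z)).

(** By linearity of [rsubmx], both sides are limits of the same difference quotient. *)
Lemma derive_rsubmx (W : normedModType R) (F : 'rV[R]_n -> W) z v :
  'D_v (fun w : 'rV[R]_(n + n) => F (rsubmx w)) z = 'D_(rsubmx v) F (rsubmx z).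
Proof.
rewrite /derive; set f := (fun h => _); set g := (fun h => _).
suff -> : f = g by [].
have addE (u w : 'rV[R]_(n + n)) : rsubmx (u + w) = rsubmx u + rsubmx w.
  by apply/rowP => i; rewrite !mxE.
have scaleE h : rsubmx (h *: v) = h *: rsubmx v by apply/rowP => i; rewrite !mxE.
by apply/funext => h; rewrite /f /g /= addE scaleE.
Qed.

Lemma rsubmx_delta_l (k : 'I_n) : rsubmx (delta_mx 0 (lshift n k) : 'rV[R]_(n + n)) = 0.
Proof. by apply/rowP => i; rewrite !mxE eq_rlshift andbF. Qed.

Lemma rsubmx_delta_r (k : 'I_n) :
  rsubmx (delta_mx 0 (rshift n k) : 'rV[R]_(n + n)) = delta_mx 0 k.
Proof. by apply/rowP => i; rewrite !mxE eq_rshift. Qed.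

Lemma partial_rsubmx_l (F : 'rV[R]_n -> R) k z :
  partial (lshift n k) (fun w => F (rsubmx w)) z = 0.
Proof. by rewrite /partial derive_rsubmx rsubmx_delta_l derive0. Qed.

Lemma partial_rsubmx_r (F : 'rV[R]_n -> R) k z :
  partial (rshift n k) (fun w => F (rsubmx w)) z = partial k F (rsubmx z).
Proof. by rewrite /partial derive_rsubmx rsubmx_delta_r. Qed.

Lemma continuous_rsubmx : continuous (@rsubmx R 1 n n).
Proof.
move=> z; apply: continuous_mx => i j.
rewrite (_ : (fun _ => _) = fun w : 'rV[R]_(n + n) => w i (rshift n j)).
  exact: coord_continuous.
by apply/funext => w; rewrite mxE.
Qed.

End TubeMetric.

(* For a metric with coordinate matrix diag(H, H), where H depends on the
   imaginary parts only and is locally a Hessian, everything is expressed by the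
   Christoffel symbols C of the Hessian metric H: by the symmetry of the first
   and second derivatives of H, the Ricci tensor is diag(- dt, - dt) with
   t_c = C^k_{kc} = d_c log(sqrt(det H)). *)
Section HessianTube.
Variables (R : realType) (n : nat) (Om : set 'rV[R]_n).
Variables (H K : 'rV[R]_n -> 'M[R]_n) (P : 'I_n -> 'I_n -> 'I_n -> 'rV[R]_n -> R).
Hypothesis Om_open : open Om.
Hypothesis HK : forall y, Om y -> H y *m K y = 1%:M.
Hypothesis H_sym : forall y i j, H y i j = H y j i.
Hypothesis dH : forall y k i j, Om y ->
  is_derive y (delta_mx 0 k) (fun y => H y i j) (P k i j y).
Hypothesis P_sym12 : forall y i j k, Om y -> P i j k y = P j i k y.
Hypothesis P_sym23 : forall y i j k, Om y -> P i j k y = P i k j y.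
Hypothesis K_derivable : forall y k i j, Om y ->
  derivable (fun y => K y i j) y (delta_mx 0 k).
Hypothesis P_derivable : forall y i j k l, Om y ->
  derivable (P i j k) y (delta_mx 0 l).
Hypothesis dP_sym : forall y k i j l, Om y ->
  partial k (P i j l) y = partial i (P k j l) y.

Implicit Types (z : 'rV[R]_(n + n)) (y : 'rV[R]_n).
Notation G := (tube_metric H).
Notation xi := (@lshift n n).
Notation yi := (@rshift n n).

(** For a Hessian metric the three first derivatives in the Christoffel formula are equal, so that a
    single one is left. *)
Definition hessian_christoffel (k i j : 'I_n) y : R :=
  2^-1 * \sum_l K y k l * P i j l y.
Notation C := hessian_christoffel.

Definition hessian_trace (c : 'I_n) y : R := \sum_k C k k c y.
Notation t := hessian_trace.

Lemma K_sym y i j : Om y -> K y i j = K y j i.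
Proof.
move=> Oy; have HK1 := HK Oy.
have HT : (H y)^T = H y by apply/matrixP => a b; rewrite mxE H_sym.
have KH : K y *m H y = 1%:M by exact: mulmx1C.
have KT : (K y)^T *m H y = 1%:M by rewrite -[in LHS]HT -trmx_mul HK1 trmx1.
have KE : K y = (K y)^T.
  by rewrite -[RHS]mulmx1 -HK1 mulmxA KT mul1mx.
by rewrite [in LHS]KE mxE.
Qed.

Lemma invmx_tube z : Om (rsubmx z) ->
  invmx (G z) = block_mx (K (rsubmx z)) 0 0 (K (rsubmx z)).
Proof.
move=> Oz; have HK1 := HK Oz.
have GK : G z *m block_mx (K (rsubmx z)) 0 0 (K (rsubmx z)) = 1%:M.
  by rewrite mulmx_block !(mulmx0, mul0mx, addr0, add0r) HK1 -scalar_mx_block.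
by have [Gu _] := mulmx1_unit GK; rewrite -[RHS](mulKmx Gu) GK mulmx1.
Qed.

Lemma partial_tube_l k a b z : partial (xi k) (fun w => G w a b) z = 0.
Proof.
exact: (partial_rsubmx_l (fun y => block_mx (H y) 0 0 (H y) a b)).
Qed.

Lemma partial_tube_r k a b z : partial (yi k) (fun w => G w a b) z =
  partial k (fun y => block_mx (H y) 0 0 (H y) a b) (rsubmx z).
Proof.
exact: (partial_rsubmx_r (fun y => block_mx (H y) 0 0 (H y) a b)).
Qed.

Lemma partial_cst k (c : R) y : partial k (fun=> c) y = 0.
Proof. exact: derive_cst. Qed.

Lemma partial_tube_rll k a b z : Om (rsubmx z) ->
  partial (yi k) (fun w => G w (xi a) (xi b)) z = P k a b (rsubmx z).
Proof.
move=> Oz; rewrite partial_tube_r; under eq_fun do rewrite block_mxEul.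
by have [_] := dH k a b Oz.
Qed.

Lemma partial_tube_rrr k a b z : Om (rsubmx z) ->
  partial (yi k) (fun w => G w (yi a) (yi b)) z = P k a b (rsubmx z).
Proof.
move=> Oz; rewrite partial_tube_r; under eq_fun do rewrite block_mxEdr.
by have [_] := dH k a b Oz.
Qed.

Lemma partial_tube_rlr k a b z :
  partial (yi k) (fun w => G w (xi a) (yi b)) z = 0.
Proof.
rewrite partial_tube_r; under eq_fun do rewrite block_mxEur mxE.
exact: partial_cst.
Qed.

Lemma partial_tube_rrl k a b z :
  partial (yi k) (fun w => G w (yi a) (xi b)) z = 0.
Proof.
rewrite partial_tube_r; under eq_fun do rewrite block_mxEdl mxE.
exact: partial_cst.
Qed.

Lemma sum_block_ul (A D : 'M[R]_n) k (F : 'I_(n + n) -> R) :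
  \sum_l block_mx A 0 0 D (xi k) l * F l = \sum_l A k l * F (xi l).
Proof.
rewrite big_split_ord /= [X in _ + X]big1 => [|l _].
  by rewrite addr0; apply: eq_bigr => l _; rewrite block_mxEul.
by rewrite block_mxEur mxE mul0r.
Qed.

Lemma sum_block_dr (A D : 'M[R]_n) k (F : 'I_(n + n) -> R) :
  \sum_l block_mx A 0 0 D (yi k) l * F l = \sum_l D k l * F (yi l).
Proof.
rewrite big_split_ord /= [X in X + _]big1 => [|l _].
  by rewrite add0r; apply: eq_bigr => l _; rewrite block_mxEdr.
by rewrite block_mxEdl mxE mul0r.
Qed.

Let partialE := (partial_tube_l, partial_tube_rlr, partial_tube_rrl).

Section Christoffel.
Variables (z : 'rV[R]_(n + n)) (k i j : 'I_n).
Hypothesis Oz : Om (rsubmx z).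
Let y := rsubmx z.

Let partialOE := (partialE, fun k i j => partial_tube_rll k i j Oz,
  fun k i j => partial_tube_rrr k i j Oz).

Let christoffel_l a b : christoffel G (xi k) a b z = 2^-1 * \sum_l K y k l *
   (partial a (fun w => G w b (xi l)) z + partial b (fun w => G w a (xi l)) z
     - partial (xi l) (fun w => G w a b) z).
Proof. by rewrite /christoffel invmx_tube // sum_block_ul. Qed.

Let christoffel_r a b : christoffel G (yi k) a b z = 2^-1 * \sum_l K y k l *
   (partial a (fun w => G w b (yi l)) z + partial b (fun w => G w a (yi l)) z
     - partial (yi l) (fun w => G w a b) z).
Proof. by rewrite /christoffel invmx_tube // sum_block_dr. Qed.

(** In these names the first letter is the type of the upper index and the other two are those of
    the lower indices ([x] real, [y] imaginary). Since [G] is block diagonal and independent of the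
    real parts, only the symbols with an even number of letters [x] survive. The sign in the case
    [yxx] comes from the subtracted derivative. *)
Lemma christoffel_xxx : christoffel G (xi k) (xi i) (xi j) z = 0.
Proof.
rewrite christoffel_l big1 ?mulr0 // => l _.
by rewrite !partialOE addr0 subrr mulr0.
Qed.

Lemma christoffel_xxy : christoffel G (xi k) (xi i) (yi j) z = C k i j y.
Proof.
rewrite christoffel_l; congr (_ * _); apply: eq_bigr => l _.
by rewrite !partialOE add0r subr0 P_sym12.
Qed.

Lemma christoffel_xyx : christoffel G (xi k) (yi i) (xi j) z = C k i j y.
Proof.
rewrite christoffel_l; congr (_ * _); apply: eq_bigr => l _.
by rewrite !partialOE addr0 subr0.
Qed.

Lemma christoffel_xyy : christoffel G (xi k) (yi i) (yi j) z = 0.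
Proof.
rewrite christoffel_l big1 ?mulr0 // => l _.
by rewrite !partialOE addr0 subrr mulr0.
Qed.

Lemma christoffel_yxx : christoffel G (yi k) (xi i) (xi j) z = - C k i j y.
Proof.
rewrite christoffel_r -mulrN -sumrN; congr (_ * _); apply: eq_bigr => l _.
by rewrite !partialOE addr0 add0r mulrN -/y (P_sym12 l) // (P_sym23 i l).
Qed.

Lemma christoffel_yxy : christoffel G (yi k) (xi i) (yi j) z = 0.
Proof.
rewrite christoffel_r big1 ?mulr0 // => l _.
by rewrite !partialOE addr0 subrr mulr0.
Qed.

Lemma christoffel_yyx : christoffel G (yi k) (yi i) (xi j) z = 0.
Proof.
rewrite christoffel_r big1 ?mulr0 // => l _.
by rewrite !partialOE addr0 subrr mulr0.
Qed.

Lemma christoffel_yyy : christoffel G (yi k) (yi i) (yi j) z = C k i j y.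
Proof.
rewrite christoffel_r; congr (_ * _); apply: eq_bigr => l _.
rewrite !partialOE -/y (P_sym12 j) // (P_sym12 l) // (P_sym23 i l) //.
by rewrite addrK.
Qed.

End Christoffel.

Lemma partial_on_tube (f : 'rV[R]_(n + n) -> R) (F : 'rV[R]_n -> R) a z :
  Om (rsubmx z) -> (forall w, Om (rsubmx w) -> f w = F (rsubmx w)) ->
  partial a f z = partial a (fun w => F (rsubmx w)) z.
Proof.
move=> Oz fF; apply: near_eq_derive.
have : \forall w \near z, Om (rsubmx w).
  by apply: (@continuous_rsubmx R n z); exact: open_nbhs_nbhs.
by apply: filterS => w; exact: fF.
Qed.

(** Multiplying by [H] lowers the upper index of [C]. Differentiating this identity relates the
    derivatives of [C] to those of [P] without a formula for the derivative of the inverse [K]. *)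
Lemma hessian_christoffelH y i j m : Om y ->
  P i j m y = 2 * \sum_k C k i j y * H y k m.
Proof.
move=> Oy; rewrite /C.
under eq_bigr do rewrite -mulrA mulr_suml.
rewrite -mulr_sumr mulrA divff ?mul1r // exchange_big /=.
under eq_bigr => l _ do under eq_bigr => k _ do rewrite mulrAC.
under eq_bigr => l _ do rewrite -mulr_suml.
have KH l : \sum_k K y k l * H y k m = (l == m)%:R.
  have /mulmx1C /matrixP /(_ l m) := HK Oy; rewrite !mxE => <-.
  by apply: eq_bigr => k _; rewrite K_sym.
under eq_bigr do rewrite KH.
rewrite (bigD1 m) //= eqxx mul1r big1 ?addr0 // => l /negPf ->.
by rewrite mul0r.
Qed.

Lemma derivable_hessian_christoffel y k i j d : Om y ->
  derivable (C k i j) y (delta_mx 0 d).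
Proof.
move=> Oy; apply: derivableZ.
have /= H1 := @is_derive_bigsum R _ _ _ (index_enum 'I_n)
   (fun l y => K y k l * P i j l y).
have /H1 [] : forall l, is_derive y (delta_mx 0 d) (fun y => K y k l * P i j l y)
   ('D_(delta_mx 0 d) (fun y => K y k l * P i j l y) y).
  move=> l; apply: derivableP.
  by apply: derivableM; [exact: K_derivable|exact: P_derivable].
by [].
Qed.

Lemma is_derive_hessian_christoffel y k i j d : Om y ->
  is_derive y (delta_mx 0 d) (C k i j) (partial d (C k i j) y).
Proof. by move=> Oy; apply: derivableP; exact: derivable_hessian_christoffel. Qed.

Lemma partial_P y d b c m : Om y -> partial d (P b c m) y =
  2 * \sum_k (partial d (C k b c) y * H y k m + C k b c y * P d k m y).
Proof.
move=> Oy.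
have := is_derive_bigsum (index_enum 'I_n) (fun k => is_derive_mul
  (is_derive_hessian_christoffel k b c d Oy) (dH d k m Oy)).
move=> /(is_deriveZ 2) [_ E]; apply: etrans E; apply: near_eq_derive.
have : \forall w \near y, Om w by exact: open_nbhs_nbhs.
by apply: filterS => w Ow; rewrite hessian_christoffelH.
Qed.

Lemma sum_PK y i l j : Om y -> \sum_m P i l m y * K y m j = 2 * C j i l y.
Proof.
move=> Oy; rewrite /C mulrA divff ?mul1r //; apply: eq_bigr => m _.
by rewrite mulrC K_sym.
Qed.

(** The derivative of [P] in direction d is symmetric in d and b, like a fourth derivative of a
    potential. Raising its last index with [K] turns this symmetry into a relation between
    derivatives of [C]. *)
Lemma hessian_codazzi y j b c d : Om y ->
  partial d (C j b c) y + 2 * (\sum_k C k b c y * C j d k y) =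
  partial b (C j d c) y + 2 * (\sum_k C k d c y * C j b k y).
Proof.
move=> Oy.
have contract b' d' : \sum_m (2^-1 * partial d' (P b' c m) y) * K y m j =
    partial d' (C j b' c) y + 2 * (\sum_k C k b' c y * C j d' k y).
  under eq_bigr do rewrite partial_P // mulrA mulVf // mul1r big_split mulrDl.
  rewrite big_split /=; congr (_ + _).
    under eq_bigr do rewrite mulr_suml.
    rewrite exchange_big /=.
    under eq_bigr do (under eq_bigr do rewrite -mulrA); rewrite -/C.
    under eq_bigr do rewrite -mulr_sumr.
    have HKE k : \sum_m H y k m * K y m j = (k == j)%:R.
      by have /matrixP /(_ k j) := HK Oy; rewrite !mxE.
    under eq_bigr do rewrite HKE.
    rewrite (bigD1 j) //= eqxx mulr1 big1 ?addr0 // => k /negPf ->.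
    by rewrite mulr0.
  under eq_bigr do rewrite mulr_suml.
  rewrite exchange_big /= mulr_sumr; apply: eq_bigr => k _.
  under eq_bigr do rewrite -mulrA.
  by rewrite -mulr_sumr sum_PK // mulrCA.
by rewrite -!contract; apply: eq_bigr => m _; rewrite dP_sym.
Qed.

(** Contraction of [hessian_codazzi] over j = d. It trades the divergence of [C] for the derivative
    of its trace, and in both diagonal blocks of the Ricci tensor it absorbs all the quadratic
    terms. *)
Lemma hessian_divergence y b c : Om y ->
  \sum_a partial a (C a b c) y + 2 * (\sum_a \sum_p C a a p y * C p b c y) =
  partial b (t c) y + 2 * (\sum_a \sum_p C a b p y * C p a c y).
Proof.
move=> Oy; have -> : partial b (t c) y = \sum_a partial b (C a a c) y.
  have := is_derive_bigsum (index_enum 'I_n)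
    (fun a => is_derive_hessian_christoffel a a c b Oy).
  by case.
rewrite !mulr_sumr -!big_split /=; apply: eq_bigr => a _.
have := hessian_codazzi a b c a Oy.
under eq_bigr do rewrite mulrC.
by move=> ->; congr (_ + _ * _); apply: eq_bigr => p _; rewrite mulrC.
Qed.

(** * The Ricci tensor of a Hessian tube, block by block *)

Section Ricci.
Variables (z : 'rV[R]_(n + n)) (b c : 'I_n).
Hypothesis Oz : Om (rsubmx z).
Let y := rsubmx z.

Let chE := (
  fun k i j => christoffel_xxx k i j Oz, fun k i j => christoffel_xxy k i j Oz,
  fun k i j => christoffel_xyx k i j Oz, fun k i j => christoffel_xyy k i j Oz,
  fun k i j => christoffel_yxx k i j Oz, fun k i j => christoffel_yxy k i j Oz,
  fun k i j => christoffel_yyx k i j Oz, fun k i j => christoffel_yyy k i j Oz).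

Let partial0 a f : (forall w, Om (rsubmx w) -> f w = 0) -> partial a f z = 0.
Proof.
move=> f0; rewrite (partial_on_tube (F := fun=> 0) a Oz f0).
exact: derive_cst.
Qed.

Let partialC a f F : (forall w, Om (rsubmx w) -> f w = F (rsubmx w)) ->
  partial (yi a) f z = partial a F y.
Proof. by move=> fF; rewrite (partial_on_tube _ Oz fF) partial_rsubmx_r. Qed.

Let partialx a f F : (forall w, Om (rsubmx w) -> f w = F (rsubmx w)) ->
  partial (xi a) f z = 0.
Proof. by move=> fF; rewrite (partial_on_tube _ Oz fF) partial_rsubmx_l. Qed.

Let partialN a (F : 'rV[R]_n -> R) : derivable F y (delta_mx 0 a) ->
  partial a (fun w => - F w) y = - partial a F y.
Proof. by move=> dF; rewrite /partial deriveN. Qed.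

Let pxC k i j a : partial (xi a) (christoffel G k i j) z = 0.
Proof.
case: (split_ordP k) => k' ->; case: (split_ordP i) => i' ->;
  case: (split_ordP j) => j' ->.
- by apply: (@partialx _ _ (fun=> 0)) => w; exact: christoffel_xxx.
- by apply: (@partialx _ _ (C k' i' j')) => w; exact: christoffel_xxy.
- by apply: (@partialx _ _ (C k' i' j')) => w; exact: christoffel_xyx.
- by apply: (@partialx _ _ (fun=> 0)) => w; exact: christoffel_xyy.
- by apply: (@partialx _ _ (fun w => - C k' i' j' w)) => w; exact: christoffel_yxx.
- by apply: (@partialx _ _ (fun=> 0)) => w; exact: christoffel_yxy.
- by apply: (@partialx _ _ (fun=> 0)) => w; exact: christoffel_yyx.
- by apply: (@partialx _ _ (C k' i' j')) => w; exact: christoffel_yyy.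
Qed.

Let p0C k i j a : (forall w, Om (rsubmx w) -> christoffel G k i j w = 0) ->
  partial a (christoffel G k i j) z = 0.
Proof. exact: partial0. Qed.

Let pyC_yxx k i j a :
  partial (yi a) (christoffel G (yi k) (xi i) (xi j)) z = - partial a (C k i j) y.
Proof.
rewrite -partialN; last exact: derivable_hessian_christoffel.
by apply: (@partialC _ _ (fun w => - C k i j w)) => w; exact: christoffel_yxx.
Qed.

Let pyC_yyy k i j a :
  partial (yi a) (christoffel G (yi k) (yi i) (yi j)) z = partial a (C k i j) y.
Proof. by apply: partialC => w; exact: christoffel_yyy. Qed.

Let pyC_xxy k i j a :
  partial (yi a) (christoffel G (xi k) (xi i) (yi j)) z = partial a (C k i j) y.
Proof. by apply: partialC => w; exact: christoffel_xxy. Qed.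

Let pyC_xyx k i j a :
  partial (yi a) (christoffel G (xi k) (yi i) (xi j)) z = partial a (C k i j) y.
Proof. by apply: partialC => w; exact: christoffel_xyx. Qed.

Let pyC_xxx k i j a : partial a (christoffel G (xi k) (xi i) (xi j)) z = 0.
Proof. by apply: p0C => w; exact: christoffel_xxx. Qed.

Let pyC_xyy k i j a : partial a (christoffel G (xi k) (yi i) (yi j)) z = 0.
Proof. by apply: p0C => w; exact: christoffel_xyy. Qed.

Let pyC_yxy k i j a : partial a (christoffel G (yi k) (xi i) (yi j)) z = 0.
Proof. by apply: p0C => w; exact: christoffel_yxy. Qed.

Let pyC_yyx k i j a : partial a (christoffel G (yi k) (yi i) (xi j)) z = 0.
Proof. by apply: p0C => w; exact: christoffel_yyx. Qed.

Let pE := (pxC, pyC_yxx, pyC_yyy, pyC_xxy, pyC_xyx, pyC_xxx, pyC_xyy, pyC_yxy,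
  pyC_yyx).

Let dt : partial b (t c) y = \sum_a partial b (C a a c) y.
Proof.
have := is_derive_bigsum (index_enum 'I_n)
  (fun a => is_derive_hessian_christoffel a a c b Oz).
by case.
Qed.

Let riemannE l c' a' b' : riemann G l c' a' b' z =
  partial a' (christoffel G l b' c') z - partial b' (christoffel G l a' c') z
  + \sum_p (christoffel G l a' (xi p) z * christoffel G (xi p) b' c' z
           - christoffel G l b' (xi p) z * christoffel G (xi p) a' c' z
           + (christoffel G l a' (yi p) z * christoffel G (yi p) b' c' z
           - christoffel G l b' (yi p) z * christoffel G (yi p) a' c' z)).
Proof. by rewrite /riemann big_split_ord /= [in RHS]big_split. Qed.

Lemma ricci_tube_xx : ricci G z (xi b) (xi c) = - partial b (t c) y.
Proof.
rewrite mxE big_split_ord /= -big_split /=.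
transitivity (\sum_a (- partial a (C a b c) y +
  (2 * (\sum_p C a b p y * C p a c y) - 2 * \sum_p C a a p y * C p b c y))).
  apply: eq_bigr => a _; rewrite !riemannE !pE addrACA -big_split /=.
  rewrite !mulr_sumr -sumrB; congr (_ + _); first by ring.
  by apply: eq_bigr => p _; rewrite !chE; ring.
rewrite big_split sumrB sumrN -!mulr_sumr /=.
by have := hessian_divergence b c Oz; rewrite -/y; lra.
Qed.

Lemma ricci_tube_yy : ricci G z (yi b) (yi c) = - partial b (t c) y.
Proof.
rewrite mxE big_split_ord /= -big_split /=.
transitivity (\sum_a (partial a (C a b c) y - 2 * partial b (C a a c) y +
  (2 * (\sum_p C a a p y * C p b c y) - 2 * \sum_p C a b p y * C p a c y))).
  apply: eq_bigr => a _; rewrite !riemannE !pE addrACA -big_split /=.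
  rewrite !mulr_sumr -sumrB; congr (_ + _); first by ring.
  by apply: eq_bigr => p _; rewrite !chE; ring.
rewrite big_split !sumrB -!mulr_sumr -dt /=.
by have := hessian_divergence b c Oz; rewrite -/y; lra.
Qed.

Lemma ricci_tube_xy : ricci G z (xi b) (yi c) = 0.
Proof.
rewrite mxE big_split_ord /= !big1 ?addr0 // => a _; rewrite riemannE !pE.
  by rewrite big1 ?addr0 ?subrr // => p _; rewrite !chE; ring.
by rewrite big1 ?addr0 ?subrr // => p _; rewrite !chE; ring.
Qed.

Lemma ricci_tube_yx : ricci G z (yi b) (xi c) = 0.
Proof.
rewrite mxE big_split_ord /= !big1 ?addr0 // => a _; rewrite riemannE !pE.
  by rewrite big1 ?addr0 ?subrr // => p _; rewrite !chE; ring.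
by rewrite big1 ?addr0 ?subrr // => p _; rewrite !chE; ring.
Qed.

End Ricci.
End HessianTube.

(** * The cone and its metric *)

(** Differentiates an expression by its syntax and leaves the derivative to unification. The
    argument [known] treats the atoms and is tried before the sum and product rules. *)
Ltac pointwise_derive known :=
  first [ eapply is_derive_const
        | known
        | eapply is_derive_add; pointwise_derive known
        | eapply is_derive_opp; pointwise_derive known
        | eapply is_derive_mul; pointwise_derive known
        ].

Section Cone.
Variables (R : realType) (N : nat).
Local Notation n := N.+3.
Implicit Types (y : 'rV[R]_n) (i j k l : 'I_n).

Definition i0 : 'I_n := ord0.
Definition i1 : 'I_n := lift ord0 ord0.
Definition sw : {perm 'I_n} := tperm i0 i1.

(* The weight -3/2 makes the matrices of the covariant derivatives in the
   directions e_j, j >= 2, at the base point satisfy C^3 = C. *)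
Definition wt i : R := if (i == i0) || (i == i1) then 2^-1 else - (3 / 2).

(** The Gram matrix of q is supported on the graph of the involution [sw]: sums against it collapse
    to one term and its inverse is explicit. The covector [dual y] is half the differential of q at
    y. *)
Definition lorentz i j : R := wt i * (j == sw i)%:R.
Definition dual y i : R := wt i * y 0 (sw i).
Definition qf y : R := \sum_i y 0 i * dual y i.
Definition cone : set 'rV[R]_n := [set y | 0 < qf y /\ 0 < y 0 i1].

Definition e1 i : R := (i == i1)%:R.

(* hess is the Hessian of - log q - 2 log y_1. *)
Definition hess y : 'M[R]_n := \matrix_(i, j)
  (4 * dual y i * dual y j * (qf y)^-1 * (qf y)^-1 - 2 * lorentz i j * (qf y)^-1
   + 2 * e1 i * e1 j * (y 0 i1)^-1 * (y 0 i1)^-1).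

Definition dhess k i j y : R :=
  4 * (lorentz i k * dual y j + lorentz j k * dual y i + lorentz i j * dual y k)
    * (qf y)^-1 * (qf y)^-1
  - 16 * dual y i * dual y j * dual y k * (qf y)^-1 * (qf y)^-1 * (qf y)^-1
  - 4 * e1 i * e1 j * e1 k * (y 0 i1)^-1 * (y 0 i1)^-1 * (y 0 i1)^-1.

(** The point where the line through y in the null direction e_0 meets q = 0. Multiplied by y_1, it
    is the image of dy_1 under the inverse Hessian of - log q. *)
Definition shifted y i : R := y 0 i - qf y * (y 0 i1)^-1 * (i == i0)%:R.

(** The first two terms are the inverse Hessian of - log q. The last one is the Sherman-Morrison
    correction for the rank-one Hessian of - 2 log y_1, with coefficient 2/3 = 2/(1 + 2). *)
Definition hess_inv y : 'M[R]_n := \matrix_(i, j)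
  (y 0 i * y 0 j - qf y * (2^-1 * (wt i)^-1 * (j == sw i)%:R)
   - (2 / 3) * shifted y i * shifted y j).

Lemma sw0 : sw i0 = i1. Proof. exact: tpermL. Qed.
Lemma sw1 : sw i1 = i0. Proof. exact: tpermR. Qed.
Lemma swK : involutive sw. Proof. exact: tpermK. Qed.
Lemma swD i : i != i0 -> i != i1 -> sw i = i.
Proof. by move=> a b; rewrite /sw tpermD // eq_sym. Qed.

Lemma wt_sw i : wt (sw i) = wt i.
Proof.
rewrite /wt; have [->|a] := eqVneq i i0; first by rewrite sw0 eqxx orbT.
have [->|b] := eqVneq i i1; first by rewrite sw1 eqxx.
by rewrite swD // (negPf a) (negPf b).
Qed.

Lemma wt0 : wt i0 = 2^-1. Proof. by rewrite /wt eqxx. Qed.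
Lemma wt1 : wt i1 = 2^-1. Proof. by rewrite /wt eqxx orbT. Qed.

Lemma wt_neq0 i : wt i != 0.
Proof. by rewrite /wt; case: ifP => _; apply/eqP => h; lra. Qed.

Lemma eq_sw i j : (i == sw j) = (j == sw i).
Proof. by rewrite -(inj_eq (can_inj swK)) swK eq_sym. Qed.

Lemma lorentz_sym i j : lorentz i j = lorentz j i.
Proof.
rewrite /lorentz eq_sw; have [->|] := eqVneq i (sw j); last by rewrite !mulr0.
by rewrite wt_sw.
Qed.

Lemma sum_delta (F : 'I_n -> R) i : \sum_k F k * (k == i)%:R = F i.
Proof.
by rewrite (bigD1 i) //= eqxx mulr1 big1 ?addr0 // => k /negPf ->; rewrite mulr0.
Qed.

Lemma is_derive_y y k i :
  is_derive y (delta_mx 0 k) (fun y => y 0 i) ((i == k)%:R : R).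
Proof. by have := is_derive_coord y (delta_mx 0 k) 0 i; rewrite mxE eqxx. Qed.

Lemma is_derive_dual y k i :
  is_derive y (delta_mx 0 k) (fun y => dual y i) (lorentz i k).
Proof.
have := is_derive_mul (is_derive_const (wt i) y (delta_mx 0 k)) (is_derive_y y k (sw i)).
by rewrite mul0r add0r eq_sym.
Qed.

Lemma is_derive_qf y k : is_derive y (delta_mx 0 k) qf (2 * dual y k).
Proof.
have := is_derive_bigsum (index_enum 'I_n)
  (fun i => is_derive_mul (is_derive_y y k i) (is_derive_dual y k i)).
rewrite big_split /=; under eq_bigr do rewrite mulrC; rewrite sum_delta.
under eq_bigr do rewrite lorentz_sym /lorentz mulrCA mulrA -/(dual _ _).
by rewrite sum_delta -/(dual y k) -mulr2n mulr_natl.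
Qed.

Lemma is_derive_qfV y k : cone y ->
  is_derive y (delta_mx 0 k) (fun y => (qf y)^-1)
   (- (2 * dual y k) * (qf y)^-1 * (qf y)^-1).
Proof.
move=> [q0 _]; have := is_derive_inv (lt0r_neq0 q0) (is_derive_qf y k).
by rewrite expr2 invfM mulrA.
Qed.

Lemma is_derive_sV y k : cone y ->
  is_derive y (delta_mx 0 k) (fun y => (y 0 i1)^-1)
   (- e1 k * (y 0 i1)^-1 * (y 0 i1)^-1).
Proof.
move=> [_ s0]; have := is_derive_inv (lt0r_neq0 s0) (is_derive_y y k i1).
by rewrite expr2 invfM mulrA eq_sym.
Qed.

Lemma rational_y U i : rational_on U (fun y => y 0 i).
Proof.
apply: (@rational_affine _ _ _ _ (fun v : 'rV[R]_n => v 0 i)); first exact: coord_continuous.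
by move=> x v; exact: is_derive_coord.
Qed.

Lemma rational_dual U i : rational_on U (fun y => dual y i).
Proof. by apply: rational_mul; [exact: rational_cst|exact: rational_y]. Qed.

Lemma rational_qf U : rational_on U qf.
Proof.
apply: rational_sum => i; apply: rational_mul; first exact: rational_y.
exact: rational_dual.
Qed.

Lemma rational_continuous (f : 'rV[R]_n -> R) : rational_on setT f -> continuous f.
Proof. by move=> /rational_on_derive [H _] x; have [] := H x I. Qed.

Lemma continuous_qf : continuous qf.
Proof. exact/rational_continuous/rational_qf. Qed.

Lemma cone_open : open cone.
Proof.
rewrite (_ : cone = (qf @^-1` [set x | 0 < x]) `&`
   ((fun y : 'rV[R]_n => y 0 i1) @^-1` [set x | 0 < x])) //.
apply: openI; apply: open_comp; try exact: open_gt.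
  by move=> y _; exact: continuous_qf.
by move=> y _; exact: coord_continuous.
Qed.

Local Ltac cone_derive Oy := pointwise_derive ltac:(first
  [ exact: is_derive_dual | exact: (is_derive_qfV _ Oy)
  | exact: (is_derive_sV _ Oy) ]).

Lemma is_derive_hess y k i j : cone y ->
  is_derive y (delta_mx 0 k) (fun y => hess y i j) (dhess k i j y).
Proof.
move=> Oy; under eq_fun do rewrite mxE.
apply: is_derive_eq; first by cone_derive Oy.
by rewrite /dhess; ring.
Qed.

(** The fourth derivatives of the potential are written out so that their symmetry in k and l can be
    read off. *)
Lemma is_derive_dhess y l k i j : cone y ->
  is_derive y (delta_mx 0 l) (dhess k i j)
   (4 * (lorentz i k * lorentz j l + lorentz j k * lorentz i l
         + lorentz i j * lorentz k l) * (qf y)^-1 * (qf y)^-1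
   - 16 * (lorentz i k * dual y j * dual y l + lorentz j k * dual y i * dual y l
     + lorentz i j * dual y k * dual y l + lorentz i l * dual y j * dual y k
     + lorentz j l * dual y i * dual y k + lorentz k l * dual y i * dual y j)
     * (qf y)^-1 * (qf y)^-1 * (qf y)^-1
   + 96 * dual y i * dual y j * dual y k * dual y l
     * (qf y)^-1 * (qf y)^-1 * (qf y)^-1 * (qf y)^-1
   + 12 * e1 i * e1 j * e1 k * e1 l
     * (y 0 i1)^-1 * (y 0 i1)^-1 * (y 0 i1)^-1 * (y 0 i1)^-1).
Proof.
move=> Oy; apply: is_derive_eq; first by cone_derive Oy.
by cbv beta; ring.
Qed.

Lemma dhess_sym12 y i j k : dhess i j k y = dhess j i k y.
Proof.
rewrite /dhess (lorentz_sym j i) (lorentz_sym k i) (lorentz_sym k j); ring.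
Qed.

Lemma dhess_sym23 y i j k : dhess i j k y = dhess i k j y.
Proof. by rewrite /dhess (lorentz_sym j k); ring. Qed.

Lemma partial_dhess y k i j l : cone y ->
  partial k (dhess i j l) y = partial i (dhess k j l) y.
Proof.
move=> Oy; have [_ E1] := is_derive_dhess k i j l Oy.
have [_ E2] := is_derive_dhess i k j l Oy.
by apply: (etrans E1); apply: etrans (esym E2); rewrite (lorentz_sym k i); ring.
Qed.

Lemma derivable_dhess y i j k l : cone y -> derivable (dhess i j k) y (delta_mx 0 l).
Proof. by move=> Oy; have [] := is_derive_dhess l i j k Oy. Qed.

Lemma derivable_hess_inv y k i j : cone y ->
  derivable (fun y => hess_inv y i j) y (delta_mx 0 k).
Proof.
move=> Oy.
(* Only existence is wanted, so the value of the derivative is left to unification. *)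
suff [d [dK _]] : exists d : R,
  is_derive y (delta_mx 0 k) (fun y => hess_inv y i j) d by exact: dK.
eexists; under eq_fun do rewrite mxE /shifted.
pointwise_derive ltac:(first
  [ exact: is_derive_y | exact: is_derive_qf | exact: (is_derive_sV _ Oy) ]).
Qed.

Lemma hess_sym y i j : hess y i j = hess y j i.
Proof. by rewrite !mxE (lorentz_sym j i); ring. Qed.

Lemma sum_dual_y y : \sum_k dual y k * y 0 k = qf y.
Proof. by apply: eq_bigr => k _; rewrite mulrC. Qed.

Lemma dual0 y : dual y i0 = 2^-1 * y 0 i1.
Proof. by rewrite /dual sw0 wt0. Qed.

Lemma sum_dual_shifted y : cone y -> \sum_k dual y k * shifted y k = qf y / 2.
Proof.
move=> [_ s0]; transitivity (\sum_k (dual y k * y 0 k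
    - (qf y * (y 0 i1)^-1 * dual y k) * (k == i0)%:R)).
  by apply: eq_bigr => k _; rewrite /shifted; ring.
rewrite sumrB sum_dual_y sum_delta dual0; field; lra.
Qed.

Lemma sum_dual_hess_inv y j : cone y ->
  \sum_k dual y k * hess_inv y k j = qf y * (2^-1 * y 0 j - 3^-1 * shifted y j).
Proof.
move=> Oy; transitivity (\sum_k ((dual y k * y 0 k) * y 0 j
   - (qf y * 2^-1 * y 0 (sw k)) * (k == sw j)%:R
   - (2 / 3) * shifted y j * (dual y k * shifted y k))).
  apply: eq_bigr => k _; rewrite mxE (eq_sw j k) /dual.
  by field; exact: wt_neq0.
rewrite !sumrB -mulr_suml -mulr_sumr sum_delta sum_dual_y sum_dual_shifted // swK.
by field.
Qed.

Lemma mul_hess_inv y : cone y -> hess y *m hess_inv y = 1%:M.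
Proof.
move=> Oy; have [q0 s0] := Oy; apply/matrixP => i j; rewrite !mxE.
(* A row of the Hessian is a multiple of [dual y] plus two Kronecker deltas; the sum collapses to
   [sum_dual_hess_inv] and two entries of the inverse. *)
transitivity (\sum_k (4 * dual y i * (qf y)^-1 * (qf y)^-1 * (dual y k * hess_inv y k j)
   - (2 * wt i * (qf y)^-1 * hess_inv y k j) * (k == sw i)%:R
   + (2 * e1 i * (y 0 i1)^-1 * (y 0 i1)^-1 * hess_inv y k j) * (k == i1)%:R)).
  by apply: eq_bigr => k _; rewrite !mxE /lorentz /e1; ring.
rewrite big_split sumrB /= -mulr_sumr !sum_delta sum_dual_hess_inv //.
rewrite !mxE swK wt1 sw1 /shifted wt_sw eq_sym (_ : (i1 == i0) = false) //.
rewrite -[sw i == i0](inj_eq (can_inj swK)) swK sw0 /e1 /dual.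
have [->|_] := eqVneq i i1; rewrite ?wt1 ?sw1 [in RHS]eq_sym; case: (j == i0); case: (j == _) => /=;
  field; by rewrite ?wt_neq0 ?(lt0r_neq0 q0) ?(lt0r_neq0 s0) ?andbT.
Qed.

Lemma hess_inv_sym y i j : hess_inv y i j = hess_inv y j i.
Proof.
rewrite !mxE (eq_sw i j); have [->|_] := eqVneq j (sw i); last by rewrite !mulr0; ring.
by rewrite wt_sw; ring.
Qed.

Lemma sum_dual_dual y : cone y ->
  \sum_k dual y k * (qf y * (2^-1 * y 0 k - 3^-1 * shifted y k)) = qf y ^+ 2 / 3.
Proof.
move=> Oy; transitivity (\sum_k (qf y * 2^-1 * (dual y k * y 0 k)
   - qf y * 3^-1 * (dual y k * shifted y k))).
  by apply: eq_bigr => k _; ring.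
by rewrite sumrB -!mulr_sumr sum_dual_y sum_dual_shifted //; field.
Qed.

(** The sum is the value of q at the shifted point, which lies on the null cone. *)
Lemma sum_shifted_sq y : cone y -> \sum_k wt k * shifted y k * shifted y (sw k) = 0.
Proof.
move=> Oy; have [_ s0] := Oy.
transitivity (\sum_k (dual y k * shifted y k
   - (wt k * shifted y k * qf y * (y 0 i1)^-1) * (k == sw i0)%:R)).
  by apply: eq_bigr => k _; rewrite {2}/shifted /dual eq_sw (eq_sym i0); ring.
rewrite sumrB sum_delta sum_dual_shifted // sw0 wt1 /shifted.
by rewrite (_ : (i1 == i0) = false) //=; field; lra.
Qed.

Lemma trace_lorentz_hess_inv y : cone y ->
  \sum_k wt k * hess_inv y k (sw k) = qf y - n%:R * (qf y / 2).
Proof.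
move=> Oy; transitivity (\sum_k (y 0 k * dual y k - qf y / 2
    - (2 / 3) * (wt k * shifted y k * shifted y (sw k)))).
  by apply: eq_bigr => k _; rewrite mxE eqxx /= /dual; field; exact: wt_neq0.
rewrite !sumrB -[X in _ - X]mulr_sumr sum_shifted_sq // sumr_const card_ord -mulr_natl.
by rewrite -/(qf y); ring.
Qed.

Lemma hess_trace y c : cone y ->
  hessian_trace hess_inv dhess c y = - (n%:R * dual y c * (qf y)^-1).
Proof.
move=> Oy; have [q0 s0] := Oy; rewrite /hessian_trace /hessian_christoffel.
pose D k := qf y * (2^-1 * y 0 k - 3^-1 * shifted y k).
have Dl k : \sum_l dual y l * hess_inv y k l = D k.
  by rewrite /D -sum_dual_hess_inv //; apply: eq_bigr => l _; rewrite hess_inv_sym.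
(* For fixed k, every term of [dhess] either is a multiple of [dual y l], which contracts to [D k],
   or carries a Kronecker delta in l. *)
have inner k : \sum_l hess_inv y k l * dhess k c l y =
    4 * (qf y)^-1 ^+ 2 * (D k * wt c * (k == sw c)%:R
       + dual y c * (wt k * hess_inv y k (sw k))
       + wt c * (dual y k * hess_inv y k (sw c)))
    - 16 * (qf y)^-1 ^+ 3 * dual y c * (dual y k * D k)
    - 4 * e1 c * (y 0 i1)^-1 ^+ 3 * hess_inv y k i1 * (k == i1)%:R.
  rewrite -Dl; transitivity (\sum_l (
     (4 * (qf y)^-1 ^+ 2 * lorentz c k - 16 * (qf y)^-1 ^+ 3 * dual y c * dual y k)
        * (dual y l * hess_inv y k l)
     + (4 * (qf y)^-1 ^+ 2 * dual y c * wt k * hess_inv y k l) * (l == sw k)%:R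
     + (4 * (qf y)^-1 ^+ 2 * dual y k * wt c * hess_inv y k l) * (l == sw c)%:R
     - (4 * e1 c * e1 k * (y 0 i1)^-1 ^+ 3 * hess_inv y k l) * (l == i1)%:R)).
    apply: eq_bigr => l _; rewrite /dhess (lorentz_sym l k) /lorentz /e1; ring.
  rewrite sumrB !big_split /= -mulr_sumr !sum_delta /lorentz /e1; ring.
under eq_bigr do rewrite inner.
rewrite -mulr_sumr !sumrB -!mulr_sumr !big_split /= -!mulr_sumr !sum_delta.
rewrite sum_dual_dual // trace_lorentz_hess_inv // sum_dual_hess_inv //.
rewrite mxE sw1 wt1 /D.
have -> : shifted y (sw c) = y 0 (sw c) - qf y * (y 0 i1)^-1 * e1 c.
  by rewrite /shifted -[i0]sw1 (inj_eq (can_inj swK)).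
rewrite /dual /e1 /shifted (_ : (i1 == i0) = false) //=.
have [->|_] := eqVneq c i1; rewrite ?wt1 /=; field;
  by rewrite ?(lt0r_neq0 q0) ?(lt0r_neq0 s0).
Qed.

Lemma partial_hess_trace y b c : cone y ->
  partial b (hessian_trace hess_inv dhess c) y =
  n%:R / 2 * (hess y b c - 2 * e1 b * e1 c * (y 0 i1)^-1 * (y 0 i1)^-1).
Proof.
move=> Oy; transitivity (partial b (fun y => - (n%:R * dual y c * (qf y)^-1)) y).
  apply: near_eq_derive.
  have : \forall w \near y, cone w by apply: open_nbhs_nbhs; split => //; exact: cone_open.
  by apply: filterS => w Ow; rewrite hess_trace.
suff [_ E] : is_derive y (delta_mx 0 b) (fun y => - (n%:R * dual y c * (qf y)^-1))
  (n%:R / 2 * (hess y b c - 2 * e1 b * e1 c * (y 0 i1)^-1 * (y 0 i1)^-1)) by [].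
apply: is_derive_eq; first by cone_derive Oy.
by rewrite mxE (lorentz_sym c b); cbv beta; field; have [q0 s0] := Oy; rewrite ?(lt0r_neq0 q0) ?(lt0r_neq0 s0).
Qed.

End Cone.

(** * Linear automorphisms of the cone *)

Section ConeSymmetry.
Variables (R : realType) (N : nat).
Local Notation n := N.+3.
Implicit Types (x y v : 'rV[R]_n) (i j k l : 'I_n) (A B : 'M[R]_n).
Local Notation i0 := (@i0 N).
Local Notation i1 := (@i1 N).
Local Notation sw := (@sw N).

Definition lorentz_mx : 'M[R]_n := \matrix_(i, j) lorentz R i j.
Local Notation Q := lorentz_mx.
Local Notation e := (delta_mx 0 i1 : 'rV[R]_n).

Lemma sum_sw_reindex (F : 'I_n -> R) : \sum_i F (sw i) = \sum_i F i.
Proof. by rewrite [RHS](reindex_inj (can_inj (@swK N))). Qed.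

Lemma row_lorentz y i : (y *m Q) 0 i = dual y i.
Proof.
rewrite mxE; transitivity (\sum_k (y 0 k * wt R i) * (k == sw i)%:R).
  by apply: eq_bigr => k _; rewrite mxE lorentz_sym /lorentz mulrA.
by rewrite sum_delta mulrC.
Qed.

Lemma bil_mx y v : (v *m Q *m y^T) 0 0 = \sum_i v 0 i * dual y i.
Proof.
rewrite mxE (eq_bigr (fun i => dual v i * y 0 i)); last first.
  by move=> i _; rewrite row_lorentz mxE.
rewrite -sum_sw_reindex; apply: eq_bigr => i _.
by rewrite /dual wt_sw swK; ring.
Qed.

Lemma qf_mx y : (y *m Q *m y^T) 0 0 = qf y.
Proof. exact: bil_mx. Qed.

Lemma lorentz_mxT : Q^T = Q.
Proof. by apply/matrixP => i j; rewrite !mxE lorentz_sym. Qed.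

Lemma bil_sym y v : \sum_i v 0 i * dual y i = \sum_i y 0 i * dual v i.
Proof.
rewrite -!bil_mx; have -> : v *m Q *m y^T = (y *m Q *m v^T)^T.
  by rewrite !trmx_mul trmxK lorentz_mxT mulmxA.
by rewrite mxE.
Qed.

Lemma lorentz_mx_unit : Q \in unitmx.
Proof.
pose Q' : 'M[R]_n := \matrix_(i, j) ((wt R i)^-1 * (j == sw i)%:R).
have /mulmx1_unit [] // : Q *m Q' = 1%:M.
apply/matrixP => i j; rewrite !mxE.
transitivity (\sum_k (wt R i * Q' k j) * (k == sw i)%:R).
  by apply: eq_bigr => k _; rewrite mxE /lorentz; ring.
rewrite sum_delta mxE wt_sw swK mulrA divff ?wt_neq0 // mul1r.
by rewrite eq_sym.
Qed.

Definition dual_mx y : 'rV[R]_n := y *m Q.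

(** In this form an automorphism of the cone multiplies each of the three matrices by a scalar. *)
Lemma hess_mxE y : hess y =
  (4 * (qf y)^-1 ^+ 2) *: ((dual_mx y)^T *m dual_mx y) - (2 * (qf y)^-1) *: Q
  + (2 * (y 0 i1)^-1 ^+ 2) *: (e^T *m e).
Proof.
apply/matrixP => i j; rewrite !mxE !big_ord1 !mxE !eqxx /=.
by rewrite -!row_lorentz /e1 !mxE; ring.
Qed.

Definition dhess_mx x y : 'M[R]_n :=
  \matrix_(j, l) \sum_i x 0 i * dhess i j l y.

Lemma dhess_mxE x y : dhess_mx x y =
  (4 * (qf y)^-1 ^+ 2) *: ((dual_mx x)^T *m dual_mx y + (dual_mx y)^T *m dual_mx x
     + (dual_mx x *m y^T) 0 0 *: Q)
  - (16 * (qf y)^-1 ^+ 3 * (dual_mx x *m y^T) 0 0) *: ((dual_mx y)^T *m dual_mx y)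
  - (4 * (y 0 i1)^-1 ^+ 3 * x 0 i1) *: (e^T *m e).
Proof.
have := bil_mx y x; rewrite -/(dual_mx x); set b := (_ *m _) 0 0 => bE.
have rowE (z : 'rV[R]_n) i : \sum_j z ord0 j * Q j i = dual z i.
  by rewrite -row_lorentz mxE.
apply/matrixP => j l; rewrite !mxE !big_ord1 !mxE !eqxx /= !rowE bE.
transitivity (\sum_i (
  (4 * (qf y)^-1 ^+ 2 * wt R j * dual y l * x 0 i) * (i == sw j)%:R
  + (4 * (qf y)^-1 ^+ 2 * wt R l * dual y j * x 0 i) * (i == sw l)%:R
  + (4 * (qf y)^-1 ^+ 2 * lorentz R j l - 16 * (qf y)^-1 ^+ 3 * dual y j * dual y l)
     * (x 0 i * dual y i)
  - (4 * e1 R j * e1 R l * (y 0 i1)^-1 ^+ 3 * x 0 i) * (i == i1)%:R)).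
  apply: eq_bigr => i _; rewrite /dhess {1 2}/lorentz /e1; ring.
rewrite !(big_split, sumrN, sumrB) /= -mulr_sumr !sum_delta.
by rewrite /dual /e1; ring.
Qed.

(** The covariant derivative of the Hessian metric in direction x, acting on the coordinate frame
    from the right. Multiplied by i, it governs transport in the tube along the real direction x. *)
Definition connection_mx x y : 'M[R]_n := 2^-1 *: (dhess_mx x y *m hess_inv y).

Lemma connection_mx_entry x y j k : connection_mx x y j k =
  \sum_i x 0 i * hessian_christoffel (@hess_inv R N) (@dhess R N) k i j y.
Proof.
rewrite !mxE mulr_sumr; under eq_bigr do rewrite mxE mulr_suml mulr_sumr.
rewrite exchange_big; apply: eq_bigr => i _ /=.
rewrite /hessian_christoffel !mulr_sumr; apply: eq_bigr => l _.
by rewrite hess_inv_sym; ring.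
Qed.

Definition cone_automorphism A (k m : R) :=
  [/\ A *m Q *m A^T = k *: Q, A *m e^T = m *: e^T, 0 < k & 0 < m].

Section Automorphism.
Variables (A : 'M[R]_n) (k m : R).
Hypothesis autA : cone_automorphism A k m.

Lemma qf_aut y : qf (y *m A) = k * qf y.
Proof.
have [AQ _ _ _] := autA; rewrite -!qf_mx.
have -> : y *m A *m Q *m (y *m A)^T = y *m (A *m Q *m A^T) *m y^T.
  by rewrite trmx_mul !mulmxA.
by rewrite AQ -scalemxAr -scalemxAl mxE.
Qed.

Lemma coord_aut y : (y *m A) 0 i1 = m * y 0 i1.
Proof.
have coordE (z : 'rV[R]_n) : z 0 i1 = (z *m e^T) 0 0.
  by rewrite trmx_delta -colE mxE.
have [_ Ae _ _] := autA; rewrite !coordE -mulmxA Ae.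
by rewrite -scalemxAr mxE.
Qed.

Lemma cone_aut y : cone y -> cone (y *m A).
Proof.
have [_ _ k0 m0] := autA.
by move=> [q0 s0]; split; rewrite ?qf_aut ?coord_aut; exact: mulr_gt0.
Qed.

Lemma unitmx_aut : A \in unitmx.
Proof.
have [AQ _ k0 _] := autA.
have : A *m (Q *m A^T *m (k^-1 *: invmx Q)) = 1%:M.
  rewrite !mulmxA AQ -scalemxAr -scalemxAl mulmxV ?lorentz_mx_unit //.
  by rewrite scalerA mulVf ?scale1r // gt_eqF.
by case/mulmx1_unit.
Qed.

Lemma dual_aut x : dual_mx (x *m A) *m A^T = k *: dual_mx x.
Proof.
have [AQ _ _ _] := autA.
by rewrite /dual_mx -!mulmxA (mulmxA A) AQ scalemxAr.
Qed.

Lemma outer_scale (a b : R) (u v : 'rV[R]_n) :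
  (a *: u)^T *m (b *: v) = (a * b) *: (u^T *m v).
Proof. by rewrite -scalemxAr [X in X *m _]linearZ /= -scalemxAl scalerA mulrC. Qed.

Lemma conj_outer (u v : 'rV[R]_n) :
  A *m (u^T *m v) *m A^T = (u *m A^T)^T *m (v *m A^T).
Proof. by rewrite trmx_mul trmxK !mulmxA. Qed.

Lemma e_aut : e *m A^T = m *: e.
Proof.
have [_ Ae _ _] := autA.
by rewrite -[LHS]trmxK trmx_mul trmxK Ae linearZ /= trmxK.
Qed.

(** Under y |-> y A the potential changes by the constant - log k - 2 log m, so its Hessian is
    preserved. On the three terms of [hess_mxE], the factors k^2, k and m^2 cancel against the
    denominators. *)
Lemma hess_aut y : cone y -> A *m hess (y *m A) *m A^T = hess y.
Proof.
move=> [q0 s0]; have [AQ Ae k0 m0] := autA.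
rewrite !hess_mxE qf_aut coord_aut.
rewrite !(mulmxDr, mulmxDl, mulmxN, mulNmx) -!(scalemxAr, scalemxAl).
rewrite !conj_outer dual_aut e_aut AQ !outer_scale !scalerA.
by congr (_ *: _ - _ *: _ + _ *: _); field; rewrite ?gt_eqF.
Qed.

Lemma dhess_aut x y : cone y ->
  A *m dhess_mx (x *m A) (y *m A) *m A^T = dhess_mx x y.
Proof.
move=> [q0 s0]; have [AQ Ae k0 m0] := autA.
rewrite !dhess_mxE qf_aut !coord_aut.
have -> : (dual_mx (x *m A) *m (y *m A)^T) 0 0 = k * (dual_mx x *m y^T) 0 0.
  by rewrite trmx_mul mulmxA dual_aut -scalemxAl mxE.
rewrite !(mulmxDr, mulmxDl, mulmxN, mulNmx) -!(scalemxAr, scalemxAl).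
rewrite !(mulmxDr, mulmxDl, mulmxN, mulNmx) -!(scalemxAr, scalemxAl).
rewrite !conj_outer !dual_aut e_aut AQ !outer_scale !scalerDr !scalerA.
move: ((dual_mx x *m y^T) 0 0) (x 0 i1) => b a.
move: (qf y) (y 0 i1) q0 s0 => q s q0 s0.
have qk : k != 0 by rewrite gt_eqF.
have qm : m != 0 by rewrite gt_eqF.
have qq : q != 0 by rewrite gt_eqF.
have ss : s != 0 by rewrite gt_eqF.
have -> : 4 * (k * q)^-1 ^+ 2 * (k * k) = 4 * q^-1 ^+ 2 by field; rewrite qk qq.
have -> : 4 * (k * q)^-1 ^+ 2 * (k * b) * k = 4 * q^-1 ^+ 2 * b.
  by field; rewrite qk qq.
have -> : 16 * (k * q)^-1 ^+ 3 * (k * b) * (k * k) = 16 * q^-1 ^+ 3 * b.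
  by field; rewrite qk qq.
have -> // : 4 * (m * s)^-1 ^+ 3 * (m * a) * (m * m) = 4 * s^-1 ^+ 3 * a.
by field; rewrite qm ss.
Qed.

Lemma hess_inv_aut y : cone y -> A^T *m hess_inv y *m A = hess_inv (y *m A).
Proof.
move=> Oy; have Au := unitmx_aut; have OyA := cone_aut Oy.
have HK := mul_hess_inv OyA; have [Hu _] := mulmx1_unit HK.
rewrite -[LHS](mulKmx Hu) -[RHS](mulKmx Hu) HK; congr (_ *m _).
rewrite -[LHS](mulKmx Au) -[RHS](mulKmx Au) mulmx1; congr (_ *m _).
by rewrite !mulmxA hess_aut // mul_hess_inv // mul1mx.
Qed.

(** Automorphisms are affine isometries of the Hessian metric, hence intertwine its connection. This
    reduces the holonomy at any point to computations at the base point. *)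
Lemma connection_aut x y : cone y ->
  A *m connection_mx (x *m A) (y *m A) = connection_mx x y *m A.
Proof.
move=> Oy; rewrite /connection_mx -hess_inv_aut // -(dhess_aut x Oy).
by rewrite -scalemxAr -scalemxAl !mulmxA.
Qed.

End Automorphism.

Lemma aut_mul A B (k l m p : R) : cone_automorphism A k m -> cone_automorphism B l p ->
  cone_automorphism (A *m B) (k * l) (m * p).
Proof.
move=> [AQ Ae k0 m0] [BQ Be l0 p0]; split; [| |exact: mulr_gt0..].
  rewrite trmx_mul !mulmxA -(mulmxA A B) -(mulmxA A) BQ -scalemxAr -scalemxAl AQ.
  by rewrite scalerA mulrC.
by rewrite -mulmxA Be -scalemxAr Ae scalerA mulrC.
Qed.

Lemma aut_inv A (k m : R) : cone_automorphism A k m ->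
  cone_automorphism (invmx A) k^-1 m^-1.
Proof.
move=> autA; have Au := unitmx_aut autA; have [AQ Ae k0 m0] := autA.
have E : invmx A *m (A *m Q *m A^T) *m (invmx A)^T = Q.
  rewrite !mulmxA mulVmx // mul1mx -mulmxA -trmx_mul mulVmx //.
  by rewrite trmx1 mulmx1.
have F : invmx A *m (A *m e^T) = e^T by rewrite mulKmx.
split; rewrite ?invr_gt0 //.
  rewrite -[in RHS]E AQ -scalemxAr -scalemxAl scalerA mulVf ?scale1r //.
  by rewrite gt_eqF.
by rewrite -[in RHS]F Ae -scalemxAr scalerA mulVf ?scale1r ?gt_eqF.
Qed.

Definition base_point : 'rV[R]_n := delta_mx 0 i0 + delta_mx 0 i1.

(* Dilations diag(k/m, sqrt k, m) followed by the unipotent map fixing e_0 that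
   moves m e_1 to the point y - (k/m) e_0 of the boundary of the cone. *)
Definition transporter y : 'M[R]_n := let k := qf y in let m := y 0 i1 in
  \matrix_(i, j) (if i == i0 then k / m * (j == i0)%:R
    else if i == i1 then y 0 j - k / m * (j == i0)%:R
    else Num.sqrt k * ((i == j)%:R + 3 * (y 0 i / m) * (j == i0)%:R)).

Lemma mulmx_eT m' (B : 'M[R]_(m', n)) (i : 'I_m') : (B *m e^T) i 0 = B i i1.
Proof. by rewrite trmx_delta -colE mxE. Qed.

Lemma i10 : (i1 == i0) = false. Proof. by []. Qed.

Lemma base_transporter y : base_point *m transporter y = y.
Proof.
rewrite mulmxDl -!rowE; apply/rowP => j; rewrite !mxE eqxx i10 eqxx; ring.
Qed.

Lemma transporter_i1 y j : y 0 i1 != 0 ->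
  transporter y j i1 = y 0 i1 * (j == i1)%:R.
Proof.
move=> m0; rewrite mxE i10 !mulr0.
case: (eqVneq j i0) => [->|nj0]; first by rewrite eq_sym i10 mulr0.
case: (eqVneq j i1) => [_|nj1]; first by rewrite subr0 mulr1.
by rewrite addr0 !mulr0.
Qed.

Lemma dual_other y i : i != i0 -> i != i1 -> dual y i = - (3 / 2) * y 0 i.
Proof. by move=> a b; rewrite /dual swD // /wt (negPf a) (negPf b). Qed.

Lemma bil_transporter y i v : y 0 i1 != 0 ->
  \sum_l transporter y i l * dual v l =
  let k := qf y in let m := y 0 i1 in
  if i == i0 then k / m * (2^-1 * v 0 i1)
  else if i == i1 then \sum_l y 0 l * dual v l - k / m * (2^-1 * v 0 i1)
  else Num.sqrt k * (- (3 / 2) * v 0 i + 3 / 2 * (y 0 i / m) * v 0 i1).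
Proof.
move=> m0 /=; case: (eqVneq i i0) => [->|ni0].
  transitivity (\sum_l (qf y / y 0 i1 * dual v l) * (l == i0)%:R).
    by apply: eq_bigr => l _; rewrite mxE eqxx; ring.
  by rewrite sum_delta dual0.
case: (eqVneq i i1) => [->|ni1].
  transitivity (\sum_l (y 0 l * dual v l -
     (qf y / y 0 i1 * dual v l) * (l == i0)%:R)).
    by apply: eq_bigr => l _; rewrite mxE i10 eqxx; ring.
  by rewrite sumrB sum_delta dual0.
transitivity (\sum_l ((Num.sqrt (qf y) * dual v l) * (l == i)%:R +
     (Num.sqrt (qf y) * 3 * (y 0 i / y 0 i1) * dual v l) * (l == i0)%:R)).
  by apply: eq_bigr => l _; rewrite mxE (negPf ni0) (negPf ni1) (eq_sym i l); ring.
by rewrite big_split /= !sum_delta dual0 dual_other //; field.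
Qed.

Lemma transporter_aut y : cone y ->
  cone_automorphism (transporter y) (qf y) (y 0 i1).
Proof.
move=> [q0 s0]; have m0 : y 0 i1 != 0 by rewrite gt_eqF.
split=> //; last first.
  apply/matrixP => i j; rewrite ord1 mulmx_eT transporter_i1 //.
  by rewrite !mxE eqxx.
set T := transporter y.
(* The entries are the values of the polar form of q on pairs of rows of the transporter. *)
have gram i j : (T *m Q *m T^T) i j = \sum_l T i l * dual (row j T) l.
  transitivity ((row i T *m Q *m (row j T)^T) 0 0).
    rewrite -row_mul [LHS]mxE [RHS]mxE; apply: eq_bigr => l _.
    by rewrite [row i _ _ _]mxE [T^T _ _]mxE [(row j T)^T _ _]mxE [row j T _ _]mxE.
  by rewrite bil_mx; apply: eq_bigr => l _; rewrite mxE.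
have bily j : \sum_l y 0 l * dual (row j T) l = qf y / 2 * ((j == i0) || (j == i1))%:R.
  rewrite -bil_sym; under eq_bigr do rewrite [row _ _ _ _]mxE.
  rewrite bil_transporter //; case: (eqVneq j i0) => [_|nj0] /=; first by field.
  case: (eqVneq j i1) => [_|nj1] /=; first by rewrite -/(qf y); field.
  by rewrite mulr0; field.
have sq : Num.sqrt (qf y) * Num.sqrt (qf y) = qf y.
  by rewrite -expr2 sqr_sqrtr // ltW.
have rowT j l : (row j T) 0 l = T j l by rewrite mxE.
apply/matrixP => i j; rewrite gram bil_transporter // bily !rowT.
rewrite transporter_i1 // [RHS]mxE [Q i j]mxE /lorentz /=.
case: (eqVneq i i0) => [->|ni0].
  by rewrite sw0 wt0; field.
case: (eqVneq i i1) => [->|ni1].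
  rewrite sw1 wt1; case: (eqVneq j i0) => [->|nj0] /=.
    by field.
  by case: (eqVneq j i1) => [_|_] /=; field.
rewrite swD // /wt (negPf ni0) (negPf ni1) /= [T j i]mxE.
case: (eqVneq j i0) => [->|nj0]; first by rewrite ?(eq_sym i0 i) (negPf ni0) /=; field.
case: (eqVneq j i1) => [->|nj1].
  by rewrite (eq_sym i1) (negPf ni1) (negPf ni0) /=; field.
rewrite (negPf ni0) -[in RHS]sq /=; ring.
Qed.

Lemma transitive_aut x y : cone x -> cone y ->
  exists A (k m : R), cone_automorphism A k m /\ x *m A = y.
Proof.
move=> Ox Oy; have Ax := transporter_aut Ox; have Ay := transporter_aut Oy.
eexists _, _, _; split; first exact: aut_mul (aut_inv Ax) Ay.
rewrite -{1}(base_transporter x) -mulmxA mulKVmx ?base_transporter //.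
exact: unitmx_aut Ax.
Qed.

Lemma base_cone : cone base_point.
Proof.
have b0 : base_point 0 i0 = 1 by rewrite !mxE !eqxx (eq_sym i0) i10 addr0.
have b1 : base_point 0 i1 = 1 by rewrite !mxE !eqxx i10 add0r.
split; rewrite ?b1 // /qf (bigD1 i0) //= (bigD1 i1) //= big1 => [|i /andP[a b]].
  by rewrite /dual sw0 sw1 wt0 wt1 b0 b1; lra.
by rewrite !mxE (negPf a) (negPf b) !andbF addr0 mul0r.
Qed.

(** Subtract from v the multiple c y with the same coordinate y_1. On the hyperplane y_1 = 0 the
    form q is negative semidefinite with kernel spanned by e_0, so [HE] is a sum of three
    nonnegative terms. If the last two vanish, then v is a multiple of e_0, and the first term is
    positive. *)
Lemma hess_pos y v : cone y -> v != 0 -> 0 < (v *m hess y *m v^T) 0 0.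
Proof.
move=> [q0 s0] v0.
have m0 : y 0 i1 != 0 by rewrite gt_eqF.
have qn0 : qf y != 0 by rewrite gt_eqF.
pose X := \sum_i v 0 i * dual y i; pose c := v 0 i1 / y 0 i1.
pose v' := v - c *: y.
have qv' : qf v' = qf v - 2 * c * X + c ^+ 2 * qf y.
  transitivity (\sum_i (v 0 i * dual v i - c * (v 0 i * dual y i)
     - c * (y 0 i * dual v i) + c ^+ 2 * (y 0 i * dual y i))).
    by apply: eq_bigr => i _; rewrite /dual !mxE; ring.
  by rewrite big_split !sumrB -!mulr_sumr /= -(bil_sym y v) -/X -/(qf y) -/(qf v); ring.
have v'1 : v' 0 i1 = 0 by rewrite !mxE /c; field.
have qv'E : qf v' = - (3 / 2) * \sum_(i | (i != i0) && (i != i1)) v' 0 i ^+ 2.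
  rewrite /qf (bigD1 i0) //= (bigD1 i1) //= v'1 mul0r add0r dual0 v'1 !mulr0 add0r.
  by rewrite mulr_sumr; apply: eq_bigr => i /andP[a b]; rewrite dual_other //; ring.
have sum0 : 0 <= \sum_(i | (i != i0) && (i != i1)) v' 0 i ^+ 2.
  by apply: sumr_ge0 => i _; exact: sqr_ge0.
have HE : (v *m hess y *m v^T) 0 0 =
   (2 * X / qf y - c) ^+ 2 + 3 * c ^+ 2 - 2 * qf v' / qf y.
  have X1 : v *m (dual_mx y)^T = X%:M.
    by apply/rowP => i; rewrite !ord1 mxE mxE eqxx mulr1n; apply: eq_bigr => l _;
       rewrite mxE row_lorentz.
  have X2 : dual_mx y *m v^T = X%:M.
    by rewrite -[LHS]trmxK trmx_mul trmxK X1 tr_scalar_mx.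
  have s1 : v *m e^T = (v 0 i1)%:M.
    by apply/rowP => i; rewrite !ord1 mulmx_eT !mxE eqxx mulr1n.
  have s2 : e *m v^T = (v 0 i1)%:M.
    by rewrite -[LHS]trmxK trmx_mul trmxK s1 tr_scalar_mx.
  rewrite hess_mxE !(mulmxDr, mulmxDl, mulmxN, mulNmx) -!(scalemxAr, scalemxAl).
  have outerE (u : 'rV[R]_n) : v *m (u^T *m u) *m v^T = v *m u^T *m (u *m v^T).
    by rewrite !mulmxA.
  rewrite !outerE X1 X2 s1 s2 -!scalar_mxM -/Q.
  have entry (a b d p q : R) (M : 'M[R]_1) :
     (a *: p%:M - b *: M + d *: q%:M) 0 0 = a * p - b * M 0 0 + d * q.
    by rewrite !mxE eqxx !mulr1n.
  rewrite entry qf_mx qv' /c; field; by rewrite m0 qn0.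
rewrite HE qv'E; set S := \sum_(i | _) _ in sum0 *.
have -> : 2 * (- (3 / 2) * S) / qf y = - (3 * S / qf y) by field.
have SE : 0 <= 3 * S / qf y by rewrite divr_ge0 ?mulr_ge0 // ltW.
have [c0|c0] := eqVneq c 0; last first.
  have c2 : 0 < c ^+ 2 by rewrite exprn_even_gt0.
  have X2 : 0 <= (2 * X / qf y - c) ^+ 2 by exact: sqr_ge0.
  by lra.
have vv' : v' = v by rewrite /v' c0 scale0r subr0.
have [S0|S0] := eqVneq S 0; last first.
  have Sp : 0 < 3 * S / qf y by rewrite divr_gt0 // mulr_gt0 // lt0r S0.
  have X2 : 0 <= (2 * X / qf y - c) ^+ 2 by exact: sqr_ge0.
  by rewrite c0 expr0n /=; move: X2; rewrite c0; lra.
have vi i : i != i0 -> v 0 i = 0.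
  move=> ni0; have [->|ni1] := eqVneq i i1; first by rewrite -vv'.
  have Pi : (i != i0) && (i != i1) by rewrite ni0.
  have /eqP := psumr_eq0P (fun i _ => sqr_ge0 (v' 0 i)) S0 Pi.
  by rewrite vv' sqrf_eq0 => /eqP.
have vi0 : v 0 i0 != 0.
  apply: contra_neq v0 => vi0; apply/rowP => i; rewrite mxE.
  by have [->//|ni0] := eqVneq i i0; exact: vi.
have XE : X = v 0 i0 * (2^-1 * y 0 i1).
  rewrite /X (bigD1 i0) //= big1 => [|i ni0]; first by rewrite addr0 dual0.
  by rewrite vi // mul0r.
have : 0 < (2 * X / qf y) ^+ 2.
  rewrite exprn_even_gt0 //= XE !mulf_neq0 ?invr_eq0 //; try by apply/eqP => h; lra.
by rewrite S0 c0 subr0 !expr0n /= !mulr0 mul0r oppr0 subr0 addr0.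
Qed.

End ConeSymmetry.

(** * Holonomy at the base point *)

Section ComplexMatrices.
Variables (R : realType) (n : nat).

(* The real matrix, acting on row vectors, of the complex matrix A + i B. *)
Definition complex_mx (A B : 'M[R]_n) : 'M[R]_(n + n) := block_mx A B (- B) A.

Lemma complex_mxM A B A' B' : complex_mx A B *m complex_mx A' B' =
  complex_mx (A *m A' - B *m B') (A *m B' + B *m A').
Proof.
rewrite /complex_mx mulmx_block; congr block_mx; rewrite ?mulmxN ?mulNmx //.
  by rewrite opprD addrC.
by rewrite addrC.
Qed.

Lemma complex_mxD A B A' B' :
  complex_mx A B + complex_mx A' B' = complex_mx (A + A') (B + B').
Proof. by rewrite /complex_mx add_block_mx -opprD. Qed.

Lemma complex_mxN A B : - complex_mx A B = complex_mx (- A) (- B).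
Proof. by rewrite /complex_mx opp_block_mx. Qed.

Lemma complex_mxZ a A B : a *: complex_mx A B = complex_mx (a *: A) (a *: B).
Proof. by rewrite /complex_mx scale_block_mx scalerN. Qed.

Lemma complex_mx1 : 1%:M = complex_mx 1%:M 0.
Proof. by rewrite /complex_mx oppr0 -scalar_mx_block. Qed.

Lemma row_complex_mx (x y : 'rV[R]_n) A B :
  row_mx x y *m complex_mx A B = row_mx (x *m A - y *m B) (x *m B + y *m A).
Proof. by rewrite /complex_mx mul_row_block mulmxN. Qed.

End ComplexMatrices.

Section Rotation.
Variables (R : realType) (n : nat).
Implicit Types X : 'M[R]_n.

(* exp (th X) when X^3 = - X (Rodrigues) *)
Definition rotation X (th : R) : 'M[R]_n :=
  1%:M + sin th *: X + (1 - cos th) *: (X *m X).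

Lemma rotation0 X : rotation X 0 = 1%:M.
Proof. by rewrite /rotation sin0 cos0 subrr !scale0r !addr0. Qed.

Lemma rotation_pihalf X : rotation X (pi / 2) = 1%:M + X + X *m X.
Proof. by rewrite /rotation sin_pihalf cos_pihalf subr0 !scale1r. Qed.

Lemma rotation_Npihalf X : rotation X (- (pi / 2)) = 1%:M - X + X *m X.
Proof.
by rewrite /rotation sinN cosN sin_pihalf cos_pihalf subr0 scale1r scaleN1r.
Qed.

Lemma rotation_pi X : rotation X pi = 1%:M + 2 *: (X *m X).
Proof. by rewrite /rotation sinpi cospi opprK scale0r addr0. Qed.

Lemma rotation_Npi X : rotation X (- pi) = rotation X pi.
Proof. by rewrite /rotation sinN cosN sinpi oppr0. Qed.

Section Cube.
Variable X : 'M[R]_n.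
Hypothesis X3 : X *m X *m X = - X.

Lemma rotationD a b : rotation X a *m rotation X b = rotation X (a + b).
Proof.
rewrite /rotation sinD cosD !(mulmxDl, mulmxDr) mul1mx !mulmx1.
rewrite -!(scalemxAl, scalemxAr) !mul1mx !scalerA !mulmxA X3 mulNmx.
by apply/matrixP => i j; rewrite !mxE; ring.
Qed.

Lemma rotation_mulX a : rotation X a *m X = cos a *: X + sin a *: (X *m X).
Proof.
rewrite /rotation !mulmxDl mul1mx -!scalemxAl X3.
by apply/matrixP => i j; rewrite !mxE; ring.
Qed.

Lemma rotationNK a : rotation X (- a) *m rotation X a = 1%:M.
Proof. by rewrite rotationD addNr rotation0. Qed.

End Cube.

Lemma rotation_conj (A B X : 'M[R]_n) a : A *m B = 1%:M ->
  A *m rotation X a *m B = rotation (A *m X *m B) a.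
Proof.
move=> AB; have BA := mulmx1C AB.
rewrite /rotation !(mulmxDr, mulmxDl) mulmx1 AB -!scalemxAr -!scalemxAl.
by rewrite !mulmxA -(mulmxA _ B A) BA mulmx1.
Qed.

Lemma rotation_opp X a : rotation (- X) a = rotation X (- a).
Proof. by rewrite /rotation sinN cosN mulNmx mulmxN opprK scalerN scaleNr. Qed.

End Rotation.

(** * Connection matrices at the base point and the algebra they generate *)

Section BaseAlgebra.
Variables (R : realType) (N : nat).
Local Notation n := N.+3.
Local Notation i0 := (@i0 N).
Local Notation i1 := (@i1 N).
Local Notation E := (@delta_mx R n n).
Local Notation Phi := (@complex_mx R n).

Definition cD : 'M[R]_n := E i1 i1 - E i0 i0.
Definition cS (j : 'I_n) : 'M[R]_n :=
  - 2^-1 *: E i0 j - 2^-1 *: E i1 j - (3 / 2) *: E j i0 - 2^-1 *: E j i1.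

Definition off_plane (j : 'I_n) := (j != i0) && (j != i1).

(** The Hessian metric is homogeneous of degree - 2, so the radial direction e_0 + e_1 has
    connection matrix - 1 and gives only central rotations. The difference e_0 - e_1 is the useful
    direction of the plane. *)
Definition xD : 'rV[R]_n := delta_mx 0 i0 - delta_mx 0 i1.
Definition xS (j : 'I_n) : 'rV[R]_n := delta_mx 0 j.
Local Notation y0 := (@base_point R N).

Let dual_base i : dual y0 i = 2^-1 * ((i == i0) || (i == i1))%:R.
Proof.
rewrite /dual !mxE /wt; have [->|n0] := eqVneq i i0; first by rewrite sw0 /=; ring.
have [->|n1] := eqVneq i i1; first by rewrite sw1 /=; ring.
by rewrite swD // (negPf n0) (negPf n1) /=; ring.
Qed.

Let qf_base : qf y0 = 1.
Proof.
rewrite /qf (bigD1 i0) //= (bigD1 i1) //= big1 => [|i /andP[a b]].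
  by rewrite !dual_base !mxE eqxx /=; field.
by rewrite dual_base (negPf a) (negPf b) !mulr0.
Qed.

Let y0_1 : y0 0 i1 = 1.
Proof. by rewrite !mxE /=; ring. Qed.

Let hess_inv_base l k :
  hess_inv y0 l k = (if k == i0 then 1 else 3^-1) * (l == k)%:R.
Proof.
rewrite mxE /shifted qf_base y0_1 !mxE eqxx /wt /=.
have [->|n0] := eqVneq l i0.
  rewrite sw0 (eq_sym i0); have [kE|m0] := eqVneq k i0; first by rewrite ?kE /=; field.
  by have [kE|m1] := eqVneq k i1; rewrite ?kE /=; field.
have [->|n1] := eqVneq l i1.
  rewrite sw1 (eq_sym i1); have [kE|m0] := eqVneq k i0; first by rewrite ?kE /=; field.
  by have [kE|m1] := eqVneq k i1; rewrite ?kE /=; field.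
rewrite swD // (eq_sym k l); have [<-|m0] := eqVneq l k.
  by rewrite ?(negPf n0) /=; field.
by rewrite /=; ring.
Qed.

Let connection_base x b k : connection_mx x y0 b k =
  2^-1 * (\sum_i x 0 i * dhess i b k y0) * (if k == i0 then 1 else 3^-1).
Proof.
rewrite !mxE; under eq_bigr do rewrite hess_inv_base mulrA.
by rewrite sum_delta mxE mulrA.
Qed.

Lemma connection_D : connection_mx xD y0 = cD.
Proof.
apply/matrixP => b k; rewrite connection_base.
have -> : \sum_i xD 0 i * dhess i b k y0 = dhess i0 b k y0 - dhess i1 b k y0.
  transitivity (\sum_i (dhess i b k y0 * (i == i0)%:R - dhess i b k y0 * (i == i1)%:R)).
    by apply: eq_bigr => i _; rewrite !mxE eqxx /=; ring.
  by rewrite sumrB !sum_delta.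
rewrite /dhess /lorentz !dual_base qf_base y0_1 /wt /e1 !mxE /=.
have [bE|b0] := eqVneq b i0; last have [bE|b1] := eqVneq b i1;
  rewrite ?bE ?sw0 ?sw1 ?(swD b0 b1);
  (have [kE|k0] := eqVneq k i0; last have [kE|k1] := eqVneq k i1;
  rewrite ?kE /= ?sw0 ?sw1 ?(swD k0 k1) /=);
  rewrite ?(eq_sym i0) ?(eq_sym i1) ?(negPf b0) ?(negPf b1) ?(negPf k0) ?(negPf k1) /=;
  by field.
Qed.

Lemma connection_S j : off_plane j -> connection_mx (xS j) y0 = cS j.
Proof.
move=> /andP[j0 j1]; apply/matrixP => b k; rewrite connection_base.
have -> : \sum_i xS j 0 i * dhess i b k y0 = dhess j b k y0.
  transitivity (\sum_i (dhess i b k y0 * (i == j)%:R)).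
    by apply: eq_bigr => i _; rewrite !mxE eqxx /=; ring.
  by rewrite sum_delta.
have L b' : lorentz R b' j = - (3 / 2) * (b' == j)%:R.
  by rewrite lorentz_sym /lorentz swD // /wt (negPf j0) (negPf j1).
have dj : dual y0 j = 0 by rewrite dual_base (negPf j0) (negPf j1) mulr0.
have ej : e1 R j = 0 by rewrite /e1 (negPf j1).
have -> : dhess j b k y0 = - 3 * ((b == j)%:R * ((k == i0) || (k == i1))%:R
    + (k == j)%:R * ((b == i0) || (b == i1))%:R).
  by rewrite /dhess !L dj ej qf_base y0_1 !dual_base; field.
rewrite !mxE; move: j0 j1; rewrite !(eq_sym j).
have [bE|b0] := eqVneq b i0; last have [bE|b1] := eqVneq b i1;
  (have [kE|k0] := eqVneq k i0; last have [kE|k1] := eqVneq k i1);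
  rewrite ?bE ?kE => /negPf j0 /negPf j1; rewrite ?j0 ?j1 /=;
  rewrite ?(eq_sym i0) ?(eq_sym i1) ?(negPf b0) ?(negPf b1) ?(negPf k0) ?(negPf k1) /=;
  rewrite ?andbT ?andbF ?(eq_sym i0 i1) ?i10 ?andbF /=; by field.
Qed.

Local Notation e_ k := (delta_mx 0 k : 'rV[R]_n).

(* One nonzero row vector of W is moved to (e_0, 0), then to all basis vectors. *)
Lemma row_full_matrix_units (W : 'M[R]_(n + n)) :
  (forall k, stablemx W (Phi (E i0 k) 0)) ->
  (forall k, stablemx W (Phi (E k i0) 0)) ->
  stablemx W (Phi 0 (E i0 i0)) -> W = 0 \/ row_full W.
Proof.
move=> S1 S2 S3; have [->|W0] := eqVneq W 0; [by left|right].
have subM (v : 'rV[R]_(n + n)) X : stablemx W X -> (v <= W)%MS -> (v *m X <= W)%MS.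
  by move=> SX vW; apply: submx_trans SX; exact: submxMr.
have [w wW w0] : exists2 w : 'rV[R]_(n + n), (w <= W)%MS & w != 0.
  have [r rW] : exists r, row r W != 0.
    apply/existsP; apply: contraNT W0; rewrite negb_exists => /forallP H.
    by apply/eqP/row_matrixP => r; rewrite row0; apply/eqP; move: (H r); rewrite negbK.
  by exists (row r W) => //; exact: row_sub.
pose x : 'rV[R]_n := lsubmx w; pose y : 'rV[R]_n := rsubmx w.
have wE : w = row_mx x y by rewrite hsubmxK.
have [k xy0] : exists k, 0 < x 0 k ^+ 2 + y 0 k ^+ 2.
  apply: contrapT => H; suff w00 : w = 0 by rewrite w00 eqxx in w0.
  rewrite wE; have xy k : x 0 k = 0 /\ y 0 k = 0.
    have h : x 0 k ^+ 2 + y 0 k ^+ 2 <= 0.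
      by rewrite leNgt; apply/negP => h; apply: H; exists k.
    have x2 := sqr_ge0 (x 0 k); have y2 := sqr_ge0 (y 0 k).
    by split; apply/eqP; rewrite -sqrf_eq0; apply/eqP; lra.
  have -> : x = 0 by apply/rowP => k; have [-> _] := xy k; rewrite mxE.
  have -> : y = 0 by apply/rowP => k; have [_ ->] := xy k; rewrite mxE.
  by rewrite row_mx0.
have rowE (v : 'rV[R]_n) a b : v *m E a b = v 0 a *: e_ b.
  apply/rowP => c; rewrite !mxE eqxx /= (bigD1 a) //= mxE eqxx /= big1 ?addr0 //.
  by move=> d /negPf da; rewrite mxE da mulr0.
have e0W : (row_mx (e_ i0) 0 <= W)%MS.
  have H1 := subM _ _ (S2 k) wW; rewrite wE row_complex_mx !mulmx0 !rowE in H1.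
  rewrite subr0 add0r in H1.
  (* The vector at hand is (x_k + i y_k) e_0. Multiplication by the conjugate x_k - i y_k makes the
     coefficient real and positive. *)
  have S4 : stablemx W (Phi (x 0 k *: E i0 i0) (- y 0 k *: E i0 i0)).
    have -> : Phi (x 0 k *: E i0 i0) (- y 0 k *: E i0 i0) =
      (x 0 k)%:M *m Phi (E i0 i0) 0 + (- y 0 k)%:M *m Phi 0 (E i0 i0).
      by rewrite !mul_scalar_mx !complex_mxZ complex_mxD !scaler0 addr0 add0r.
    by apply: stablemxD; apply: stablemxM => //; exact: stablemxC.
  have := subM _ _ S4 H1; rewrite row_complex_mx -!scalemxAr !rowE !mxE !eqxx /=.
  rewrite !mulr1 !scalerA !mulNr !scaleNr opprK -scalerDl.
  rewrite [X in row_mx _ X](_ : _ = 0); last by rewrite mulrC addNr.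
  move: xy0; rewrite !mxE !expr2; set c := _ + _ => c0 cW.
  rewrite -[e_ i0]scale1r -(mulVf (lt0r_neq0 c0)) -scalerA -(scaler0 _ c^-1).
  by rewrite -scale_row_mx; exact: scalemx_sub.
have eW l : (row_mx (e_ l) 0 <= W)%MS.
  have := subM _ _ (S1 l) e0W; rewrite row_complex_mx !mulmx0 !mul0mx !rowE subr0 addr0.
  by rewrite mxE eqxx scale1r.
have ie0W : (row_mx 0 (e_ i0) <= W)%MS.
  have := subM _ _ S3 e0W; rewrite row_complex_mx !mulmx0 !mul0mx !rowE subr0 addr0.
  by rewrite mxE eqxx scale1r.
have ieW l : (row_mx 0 (e_ l) <= W)%MS.
  have := subM _ _ (S1 l) ie0W; rewrite row_complex_mx !mulmx0 !mul0mx !rowE subr0 add0r.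
  by rewrite mxE eqxx scale1r.
rewrite -sub1mx; apply/row_subP => r; rewrite row1.
case: (split_ordP r) => l ->.
  suff -> : delta_mx 0 (lshift n l) = row_mx (e_ l) 0 by [].
  apply/rowP => c; case: (split_ordP c) => d ->.
    by rewrite row_mxEl !mxE eq_lshift.
  by rewrite row_mxEr !mxE eq_rlshift andbF.
suff -> : delta_mx 0 (rshift n l) = row_mx 0 (e_ l) by [].
apply/rowP => c; case: (split_ordP c) => d ->.
  by rewrite row_mxEl !mxE eq_lrshift andbF.
by rewrite row_mxEr !mxE eq_rshift.
Qed.

Section Direction.
Variable j : 'I_n.
Hypothesis hj : off_plane j.

Let j0 : (j == i0) = false. Proof. by case/andP: hj => /negPf. Qed.
Let j1 : (j == i1) = false. Proof. by case/andP: hj => _ /negPf. Qed.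
Let j0' : (i0 == j) = false. Proof. by rewrite eq_sym j0. Qed.
Let j1' : (i1 == j) = false. Proof. by rewrite eq_sym j1. Qed.
Let h01 : (i0 == i1) = false. Proof. by []. Qed.
Let h10 : (i1 == i0) = false. Proof. by []. Qed.

Local Ltac delta_mul :=
  rewrite ?(mulmxDl, mulmxDr, mulNmx, mulmxN, mulmx1, mul1mx);
  rewrite -?(scalemxAl, scalemxAr) ?mul_delta_mx_cond
    ?(j0, j1, j0', j1', h01, h10, eqxx) ?(mulr1n, mulr0n, mul0mx, mulmx0, scaler0, addr0, add0r, subr0, oppr0).
Local Ltac delta_ring := apply/matrixP => ? ?; rewrite !mxE; ring.

Definition cP : 'M[R]_n := E i0 i0 + E i1 i1.
(** The real matrix of the conjugate A_j of S_j under the rotation by pi/2 generated by D; see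
    [rho_conj_S]. *)
Definition cA : 'M[R]_n :=
  - 2^-1 *: E i0 j + 2^-1 *: E i1 j + (3 / 2) *: E j i0 - 2^-1 *: E j i1.
(** The commutator of [cA] and [cS j]. It is diagonal, and the squares 9/4, 1/4, 1 of its nonzero
    entries are distinct, so a polynomial in its square isolates one matrix unit. *)
Definition cH : 'M[R]_n := (3 / 2) *: E i0 i0 - 2^-1 *: E i1 i1 - E j j.

Lemma cD2 : cD *m cD = cP.
Proof. by rewrite /cD /cP; delta_mul; delta_ring. Qed.

Lemma cP_D : cP *m cD = cD.
Proof. by rewrite /cD /cP; delta_mul; delta_ring. Qed.

Lemma cS2 : cS j *m cS j = (3 / 4) *: E i0 i0 + 4^-1 *: E i0 i1 + (3 / 4) *: E i1 i0
  + 4^-1 *: E i1 i1 + E j j.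
Proof. by rewrite /cS; delta_mul; apply/matrixP => ? ?; rewrite !mxE; field. Qed.

Lemma cS3 : cS j *m cS j *m cS j = cS j.
Proof.
by rewrite cS2 /cS; delta_mul; apply/matrixP => ? ?; rewrite !mxE; field.
Qed.

(** The matrix [cS j] exchanges the plane of e_0, e_1 with the line of e_j, so it is off-diagonal
    for the projection [cP]. Hence the reflection 1 - 2 P reverses it. *)
Lemma cPSP : cP *m cS j = cS j - cS j *m cP.
Proof. by rewrite /cP /cS; delta_mul; apply/matrixP => ? ?; rewrite !mxE; field. Qed.

Lemma cDSD : cD *m cS j *m cD = 0.
Proof. by rewrite /cD /cS; do 2 delta_mul; apply/matrixP => ? ?; rewrite !mxE; field. Qed.

Lemma cPSP0 : (1%:M - cP) *m cS j *m (1%:M - cP) = 0.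
Proof. by rewrite /cP /cS; do 2 delta_mul; apply/matrixP => ? ?; rewrite !mxE; field. Qed.

Lemma cA_E : (1%:M - cP) *m cS j *m cD - cD *m cS j *m (1%:M - cP) = cA.
Proof. by rewrite /cP /cS /cD /cA; do 2 delta_mul; apply/matrixP => ? ?; rewrite !mxE; field. Qed.

Lemma cH_E : cA *m cS j - cS j *m cA = cH.
Proof. by rewrite /cA /cS /cH; delta_mul; apply/matrixP => ? ?; rewrite !mxE; field. Qed.

End Direction.

End BaseAlgebra.

Section BaseIrreducible.
Variables (R : realType) (N : nat).
Local Notation n := N.+3.
Local Notation i0 := (@i0 N).
Local Notation i1 := (@i1 N).
Local Notation E := (@delta_mx R n n).
Local Notation Phi := (@complex_mx R n).
Local Notation cD := (@cD R N).
Local Notation cP := (@cP R N).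
Local Notation cS := (@cS R N).

Lemma complex_imag3 (C : 'M[R]_n) : C *m C *m C = C ->
  Phi 0 C *m Phi 0 C *m Phi 0 C = - Phi 0 C.
Proof.
move=> C3; rewrite !complex_mxM complex_mxN !(mul0mx, mulmx0, sub0r, addr0, add0r, subr0, oppr0).
by rewrite mulNmx C3.
Qed.

Let D3 : Phi 0 cD *m Phi 0 cD *m Phi 0 cD = - Phi 0 cD.
Proof. by apply: complex_imag3; rewrite cD2 cP_D. Qed.

Section Direction.
Variable j : 'I_n.
Hypothesis hj : off_plane j.
Local Notation S := (Phi 0 (cS j)).

Let S3 : S *m S *m S = - S.
Proof. by apply: complex_imag3; exact: cS3. Qed.

(** The transport at the base point around the parallelogram with real sides a [xD] and b [xS j]. *)
Definition loop_rotation a b : 'M[R]_(n + n) :=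
  rotation (Phi 0 cD) a *m rotation S b *m rotation (Phi 0 cD) (- a)
    *m rotation S (- b).

Let rotD_pi : rotation (Phi 0 cD) pi = Phi (1%:M - 2 *: cP) 0.
Proof.
rewrite rotation_pi complex_mxM !(mul0mx, mulmx0, sub0r, addr0) cD2.
by rewrite complex_mx1 complex_mxZ complex_mxD scalerN scaler0 addr0.
Qed.

Let rotD_pihalf : rotation (Phi 0 cD) (pi / 2) = Phi (1%:M - cP) cD.
Proof.
rewrite rotation_pihalf complex_mxM !(mul0mx, mulmx0, sub0r, addr0) cD2.
by rewrite complex_mx1 !complex_mxD !(addr0, add0r).
Qed.

Let rotD_Npihalf : rotation (Phi 0 cD) (- (pi / 2)) = Phi (1%:M - cP) (- cD).
Proof.
rewrite rotation_Npihalf complex_mxM !(mul0mx, mulmx0, sub0r, addr0) cD2.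
by rewrite complex_mx1 complex_mxN !complex_mxD !(addr0, add0r, oppr0).
Qed.

Lemma cP2 : cP *m cP = cP.
Proof. by rewrite -{2}cD2 mulmxA cP_D cD2. Qed.

(* At angle pi the rotation generated by D is a reflection that reverses S. *)
Lemma loop_rotation_pi b : loop_rotation pi b = rotation S (- b - b).
Proof.
rewrite /loop_rotation rotation_Npi.
have DD : rotation (Phi 0 cD) pi *m rotation (Phi 0 cD) pi = 1%:M.
  by rewrite -{1}rotation_Npi rotationNK.
rewrite [X in X *m _ = _](rotation_conj _ b DD).
have -> : rotation (Phi 0 cD) pi *m S *m rotation (Phi 0 cD) pi = - S.
  rewrite rotD_pi !complex_mxM !(mul0mx, mulmx0, sub0r, subr0, addr0, add0r, oppr0).
  rewrite complex_mxN oppr0; congr (Phi _ _).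
  have -> : (1%:M - 2 *: cP) *m cS j = 2 *: (cS j *m cP) - cS j.
    rewrite mulmxBl mul1mx -scalemxAl cPSP //.
    by apply/matrixP => p q; rewrite !mxE; ring.
  have E2 : (2 *: (cS j *m cP) - cS j) *m cP = cS j *m cP.
    rewrite mulmxBl -scalemxAl -(mulmxA (cS j)) cP2.
    by apply/matrixP => p q; rewrite !mxE; ring.
  rewrite mulmxBr mulmx1 -scalemxAr E2.
  by apply/matrixP => p q; rewrite !mxE; ring.
by rewrite rotation_opp rotationD.
Qed.

(** In the expansion of (1 - P + i D) (i S) (1 - P - i D), the imaginary part consists of (1 - P) S
    (1 - P) and D S D. Both vanish because S exchanges the plane with its complement, and the
    conjugate is real. *)
Lemma rho_conj_S :
  rotation (Phi 0 cD) (pi / 2) *m S *m rotation (Phi 0 cD) (- (pi / 2)) =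
  Phi (cA R j) 0.
Proof.
rewrite rotD_pihalf rotD_Npihalf !complex_mxM.
rewrite !(mul0mx, mulmx0, sub0r, subr0, addr0, add0r, oppr0, mulNmx, mulmxN, opprK).
rewrite cPSP0 // cDSD // addr0; congr (Phi _ _).
by rewrite -cA_E // addrC.
Qed.

Section Stable.
Variable W : 'M[R]_(n + n).
Hypothesis stableW : forall a b, stablemx W (loop_rotation a b).

Let stab1 : stablemx W (1%:M : 'M[R]_(n + n)).
Proof. exact: stablemxC. Qed.

Let stabD (X Y : 'M[R]_(n + n)) : stablemx W (X + Y) -> stablemx W Y -> stablemx W X.
Proof.
by move=> XY Y1; rewrite -(addrK Y X); apply: stablemxD; rewrite ?stablemxN.
Qed.

Let stabZ a (X : 'M[R]_(n + n)) : stablemx W X -> stablemx W (a *: X).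
Proof. by move=> SX; rewrite -mul_scalar_mx; apply: stablemxM => //; exact: stablemxC. Qed.

Let stabZV a (X : 'M[R]_(n + n)) : a != 0 -> stablemx W (a *: X) -> stablemx W X.
Proof. by move=> a0 /(stabZ a^-1); rewrite scalerA mulVf // scale1r. Qed.

Let stabB (X Y : 'M[R]_(n + n)) : stablemx W X -> stablemx W Y -> stablemx W (X - Y).
Proof. by move=> SX SY; apply: stablemxD; rewrite ?stablemxN. Qed.

(** The rotations are 1 + 2 X^2 and 1 + X + X^2: the first isolates X^2, then the second isolates
    X. *)
Let stab_rot X : stablemx W (rotation X pi) -> stablemx W (rotation X (pi / 2)) ->
  stablemx W X.
Proof.
rewrite rotation_pi rotation_pihalf [1%:M + 2 *: _]addrC => H1 H2.
have X2 : stablemx W (X *m X) by apply: (@stabZV 2) => //; exact: stabD H1 stab1.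
by apply: stabD stab1; rewrite addrC; exact: stabD H2 X2.
Qed.

Lemma stable_S : stablemx W S.
Proof.
apply: stab_rot.
  (* At a = pi the commutator rotates by - 2 b, so b is minus half the wanted angle. *)
  have := stableW pi (- (pi / 2)); rewrite loop_rotation_pi.
  by rewrite opprK (_ : pi / 2 + pi / 2 = pi) //; field.
have := stableW pi (- (pi / 4)); rewrite loop_rotation_pi opprK.
by rewrite (_ : pi / 4 + pi / 4 = pi / 2) //; field.
Qed.

Lemma stable_A : stablemx W (Phi (cA R j) 0).
Proof.
have rr : rotation (Phi 0 cD) (pi / 2) *m rotation (Phi 0 cD) (- (pi / 2)) = 1%:M.
  by rewrite (rotationD D3) subrr rotation0.
have key b : stablemx W (rotation (Phi (cA R j) 0) b).
  rewrite -rho_conj_S -(rotation_conj _ b rr).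
  have -> : rotation (Phi 0 cD) (pi / 2) *m rotation S b *m
      rotation (Phi 0 cD) (- (pi / 2)) = loop_rotation (pi / 2) b *m rotation S b.
    by rewrite /loop_rotation -[RHS]mulmxA [X in _ = _ *m X]rotationNK // [RHS]mulmx1.
  apply: stablemxM => //.
  apply: stablemxD; last by apply/stabZ/stablemxM; exact: stable_S.
  by apply: stablemxD => //; apply: stabZ; exact: stable_S.
by apply: stab_rot; exact: key.
Qed.

Lemma stable_H : stablemx W (Phi 0 (cH R j)).
Proof.
have -> : Phi 0 (cH R j) = Phi (cA R j) 0 *m S - S *m Phi (cA R j) 0.
  rewrite !complex_mxM complex_mxN complex_mxD.
  by rewrite !(mul0mx, mulmx0, sub0r, subr0, addr0, add0r, oppr0) cH_E.
by apply: stabB; apply: stablemxM; by [exact: stable_A|exact: stable_S].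
Qed.

Let real_closed (X Y : 'M[R]_n) : stablemx W (Phi X 0) -> stablemx W (Phi Y 0) ->
  stablemx W (Phi (X *m Y) 0).
Proof.
move=> SX SY; have := stablemxM SX SY; rewrite complex_mxM.
by rewrite !(mul0mx, mulmx0, subr0, addr0).
Qed.

Let realZ a (X : 'M[R]_n) : a != 0 -> stablemx W (Phi (a *: X) 0) ->
  stablemx W (Phi X 0).
Proof.
by move=> a0; rewrite -(scaler0 _ a) -complex_mxZ scaler0; exact: stabZV.
Qed.

Let realB (X Y : 'M[R]_n) : stablemx W (Phi X 0) -> stablemx W (Phi Y 0) ->
  stablemx W (Phi (X - Y) 0).
Proof.
by move=> SX SY; rewrite -[X in Phi _ X](subr0 0) -complex_mxD -complex_mxN; exact: stabB.
Qed.

(** The square h of [cH] is real up to sign and has diagonal entries 9/4, 1/4, 1 at i0, i1, j and 0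
    elsewhere. The polynomial h (h - 1/4) (h - 1) kills all of them but the first, where its value
    is 9/4 * 2 * 5/4 = 45/8. *)
Lemma stable_E00 : stablemx W (Phi (E i0 i0) 0).
Proof.
case/andP: (hj) => /negPf j0 /negPf j1.
pose dg x y z : 'M[R]_n := x *: E i0 i0 + y *: E i1 i1 + z *: E j j.
have dgM x y z x' y' z' :
    dg x y z *m dg x' y' z' = dg (x * x') (y * y') (z * z').
  rewrite /dg !(mulmxDl, mulmxDr) -?(scalemxAl, scalemxAr) !mul_delta_mx_cond.
  rewrite !eqxx !(eq_sym _ j) !j0 !j1 (eq_sym i0) i10 !mulr0n !mulr1n.
  by rewrite !scaler0 !addr0 !add0r !scalerA.
have dgB x y z x' y' z' : dg x y z - dg x' y' z' = dg (x - x') (y - y') (z - z').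
  by apply/matrixP => p q; rewrite !mxE; ring.
have dgZ a x y z : a *: dg x y z = dg (a * x) (a * y) (a * z).
  by rewrite /dg !scalerDr !scalerA.
pose h2 := cH R j *m cH R j.
have h2E : h2 = dg (9 / 4) 4^-1 1.
  have -> : h2 = dg (3 / 2) (- 2^-1) (- 1) *m dg (3 / 2) (- 2^-1) (- 1).
    by rewrite /dg /h2 /cH !scaleNr scale1r.
  by rewrite dgM; congr dg; field.
have Sh2 : stablemx W (Phi h2 0).
  have := stablemxM stable_H stable_H; rewrite complex_mxM.
  rewrite !(mul0mx, mulmx0, sub0r, addr0) -/h2 => H.
  by rewrite -stablemxN complex_mxN oppr0.
have S1 a : stablemx W (Phi a%:M 0).
  by have := stabZ a stab1; rewrite complex_mx1 complex_mxZ scaler0 scale_scalar_mx mulr1.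
have := real_closed (real_closed Sh2 (realB Sh2 (S1 4^-1))) (realB Sh2 (S1 1)).
have -> : h2 *m (h2 - 4^-1%:M) *m (h2 - 1%:M) = (45 / 8) *: E i0 i0.
  rewrite !mulmxBr mulmx1 mul_mx_scalar h2E dgM dgZ dgB dgM dgB.
  have -> : (45 / 8) *: E i0 i0 = dg (45 / 8) 0 0 by rewrite /dg !scale0r !addr0.
  by congr dg; field.
by apply: realZ; rewrite mulf_neq0 ?invr_eq0 ?pnatr_eq0.
Qed.

Let j0 : (j == i0) = false. Proof. by case/andP: hj => /negPf. Qed.
Let j1 : (j == i1) = false. Proof. by case/andP: hj => _ /negPf. Qed.

Local Ltac delta_simp :=
  rewrite ?(mulmxDl, mulmxDr, mulNmx, mulmxN) -?(scalemxAl, scalemxAr);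
  rewrite ?mul_delta_mx_cond ?eqxx ?(eq_sym _ j) ?j0 ?j1 ?(eq_sym i0 i1) ?i10;
  rewrite ?(mulr0n, mulr1n, scaler0, addr0, add0r, subr0, oppr0).

Lemma stable_E0j : stablemx W (Phi (E i0 j) 0).
Proof.
have := real_closed stable_E00 stable_A; rewrite /cA; delta_simp.
by apply: realZ; rewrite oppr_eq0 invr_eq0 pnatr_eq0.
Qed.

Lemma stable_Ej0 : stablemx W (Phi (E j i0) 0).
Proof.
have := real_closed stable_A stable_E00; rewrite /cA; delta_simp.
by apply: realZ; rewrite mulf_neq0 ?invr_eq0 ?pnatr_eq0.
Qed.

(** Row j of [cA] is 3/2 e_0 - 1/2 e_1, so subtracting the product of E i0 j and [cA] from 3/2 E i0
    i0 leaves half of E i0 i1. *)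
Lemma stable_E01 : stablemx W (Phi (E i0 i1) 0).
Proof.
have realC a X : stablemx W (Phi X 0) -> stablemx W (Phi (a *: X) 0).
  by move=> /(stabZ a); rewrite complex_mxZ scaler0.
have := realB (realC (3 / 2) _ stable_E00) (real_closed stable_E0j stable_A).
rewrite /cA; delta_simp; rewrite opprB addrC subrK.
by apply: realZ; rewrite invr_eq0 pnatr_eq0.
Qed.

Lemma stable_E10 : stablemx W (Phi (E i1 i0) 0).
Proof.
have realC a X : stablemx W (Phi X 0) -> stablemx W (Phi (a *: X) 0).
  by move=> /(stabZ a); rewrite complex_mxZ scaler0.
have := realB (real_closed stable_A stable_Ej0) (realC (- 2^-1) _ stable_E00).
rewrite /cA; delta_simp; rewrite addrAC subrr add0r.
by apply: realZ; rewrite invr_eq0 pnatr_eq0.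
Qed.

Lemma stable_iE00 : stablemx W (Phi 0 (E i0 i0)).
Proof.
have := stablemxM stable_H stable_E00; rewrite complex_mxM.
rewrite !(mul0mx, mulmx0, subr0, add0r) /cH; delta_simp.
rewrite -(scaler0 _ (3 / 2)) -complex_mxZ scaler0.
by apply: stabZV; rewrite mulf_neq0 ?invr_eq0 ?pnatr_eq0.
Qed.

End Stable.
End Direction.

Lemma base_irreducible (W : 'M[R]_(n + n)) :
  (forall j, off_plane j -> forall a b, stablemx W (loop_rotation j a b)) ->
  W = 0 \/ row_full W.
Proof.
(* Index 2 exists because n >= 3. It serves the matrix units with both indices in the plane; any
   other index k serves as its own direction. *)
move=> SW; have off2 : off_plane (inord 2 : 'I_n).
  by rewrite /off_plane -!val_eqE /= inordK.
have S2 := SW _ off2; apply: row_full_matrix_units; last exact: stable_iE00 off2 _ S2.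
  move=> k; have [->|k0] := eqVneq k i0; first exact: stable_E00 off2 _ S2.
  have [->|k1] := eqVneq k i1; first exact: stable_E01 off2 _ S2.
  have offk : off_plane k by rewrite /off_plane k0.
  exact: stable_E0j offk _ (SW k offk).
move=> k; have [->|k0] := eqVneq k i0; first exact: stable_E00 off2 _ S2.
have [->|k1] := eqVneq k i1; first exact: stable_E10 off2 _ S2.
have offk : off_plane k by rewrite /off_plane k0.
exact: stable_Ej0 offk _ (SW k offk).
Qed.

End BaseIrreducible.

(** * The tube domain *)

Section RowVectorTopology.
Variables (R : realType) (m : nat).

Lemma rV_second_countable : @second_countable 'rV[R]_m.
Proof.
pose box (ab : 'rV[rat]_m * 'rV[rat]_m) : set 'rV[R]_m :=
  [set v | forall i, (ratr (ab.1 0 i) : R) < v 0 i < ratr (ab.2 0 i)].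
have cQ : countable [set: 'rV[rat]_m * 'rV[rat]_m] by exact: countableP.
have cH := card_image_le box setT.
exists (range box); first exact: (sub_countable cH cQ).
split.
  move=> _ [ab _ <-]; rewrite openE => v bv.
  suff : \forall w \near v, forall i, (ratr (ab.1 0 i) : R) < (w : 'rV[R]_m) 0 i < ratr (ab.2 0 i).
    by [].
  apply: (@filter_forall _ _ _ _ (nbhs_filter v)) => i.
  have itv_v : nbhs (v 0 i) `](ratr (ab.1 0 i)), (ratr (ab.2 0 i))[%classic.
    apply: open_nbhs_nbhs; split; first exact: interval_open.
    by rewrite /= in_itv /=; exact: bv.
  have := @coord_continuous R 1 m 0 i v _ itv_v; apply: (@filterS _ _ (nbhs_filter v)) => w /=.
  by rewrite in_itv.
move=> v V /nbhs_ballP [e /= e0 eV].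
have a_ i : exists q : rat, v 0 i - e < ratr q < v 0 i.
  by have [q] := @rat_in_itvoo R (v 0 i - e) (v 0 i) ltac:(lra);
    rewrite in_itv /=; exists q.
have b_ i : exists q : rat, v 0 i < ratr q < v 0 i + e.
  by have [q] := @rat_in_itvoo R (v 0 i) (v 0 i + e) ltac:(lra);
    rewrite in_itv /=; exists q.
have [a aP] := choice a_; have [b bP] := choice b_.
exists (box (\row_i a i, \row_i b i)).
  split; first by exists (\row_i a i, \row_i b i).
  by move=> i /=; rewrite !mxE; case/andP: (aP i) => _ ->; case/andP: (bP i).
move=> w /= wb; apply: eV; split => // i j; rewrite ord1 -ball_normE /=.
have := wb j; rewrite !mxE => /andP[w1 w2].
have /andP[a1 _] := aP j; have /andP[_ b1] := bP j.
by rewrite ltr_norml; apply/andP; split; lra.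
Qed.

Lemma rV_connected : connected [set: 'rV[R]_m].
Proof.
rewrite (_ : [set: _] = \bigcup_(v in [set: 'rV[R]_m])
  ((fun t : R => t *: v) @` `[0, 1]%classic)); last first.
  apply/esym/seteqP; split => // v _; exists v => //; exists 1; rewrite ?scale1r //=.
  by rewrite in_itv /= ler01 lexx.
apply: bigcup_connected.
  exists 0 => v _; exists 0; rewrite ?scale0r //=.
  by rewrite in_itv /= ler01 lexx.
move=> v _; apply: connected_continuous_connected; first exact: segment_connected.
apply: continuous_subspaceT => t; exact: scalel_continuous.
Qed.

Lemma rV_not_compact : ~ compact [set: 'rV[R]_m.+1].
Proof.
move=> cpt; have : compact ((fun v : 'rV[R]_m.+1 => v 0 0) @` setT).
  by apply: continuous_compact => //; apply: continuous_subspaceT; exact: coord_continuous.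
have -> : (fun v : 'rV[R]_m.+1 => v 0 0) @` setT = setT.
  by apply/seteqP; split => // x _; exists (const_mx x); rewrite ?mxE.
move=> /compact_bounded [M [_ HM]].
have M1 : M < `|M| + 1 by rewrite (le_lt_trans (ler_norm M)) // ltrDl.
have /= := HM _ M1 (`|M| + 2) I.
by rewrite ger0_norm ?addr_ge0 //; lra.
Qed.

End RowVectorTopology.

Section TubeDomain.
Variables (R : realType) (N : nat).
Local Notation n := N.+3.
Implicit Types (y e : 'rV[R]_n) (z w : 'rV[R]_(n + n)) (i j : 'I_n).
Local Notation i0 := (@i0 N).
Local Notation i1 := (@i1 N).

Definition off_sum y : R := 3 / 2 * \sum_(i | (i != i0) && (i != i1)) y 0 i ^+ 2.

Lemma qfE y : qf y = y 0 i0 * y 0 i1 - off_sum y.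
Proof.
rewrite /qf (bigD1 i0) //= (bigD1 i1) //= {1 2}/dual sw0 sw1 wt0 wt1 /off_sum.
rewrite (eq_bigr (fun i => - (3 / 2) * y 0 i ^+ 2)) => [|i /andP[a b]].
  by rewrite -mulr_sumr; field.
by rewrite dual_other //; ring.
Qed.

(* log q and log y_1 are global coordinates that identify the cone with R^n; the
   manifold is R^(n + n) with the tube as the image of its only chart. *)
Definition cone_chart e : 'rV[R]_n := \row_i
  (if i == i0 then (expR (e 0 i0) + off_sum e) / expR (e 0 i1)
   else if i == i1 then expR (e 0 i1) else e 0 i).

Definition cone_coord y : 'rV[R]_n := \row_i
  (if i == i0 then ln (qf y) else if i == i1 then ln (y 0 i1) else y 0 i).

Let off_sum_ext y e : (forall i, i != i0 -> i != i1 -> y 0 i = e 0 i) ->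
  off_sum y = off_sum e.
Proof.
move=> ye; congr (_ * _); apply: eq_bigr => i /andP[a b]; by rewrite ye.
Qed.

Let cone_chart0 e : cone_chart e 0 i0 = (expR (e 0 i0) + off_sum e) / expR (e 0 i1).
Proof. by rewrite mxE eqxx. Qed.

Let cone_chart1 e : cone_chart e 0 i1 = expR (e 0 i1).
Proof. by rewrite mxE i10 eqxx. Qed.

Let off_sum_chart e : off_sum (cone_chart e) = off_sum e.
Proof. by apply: off_sum_ext => i /negPf a /negPf b; rewrite mxE a b. Qed.

Lemma qf_chart e : qf (cone_chart e) = expR (e 0 i0).
Proof.
rewrite qfE cone_chart0 cone_chart1 off_sum_chart divfK ?addrK //.
by rewrite gt_eqF // expR_gt0.
Qed.

Lemma cone_chart_cone e : cone (cone_chart e).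
Proof. by split; rewrite ?qf_chart ?cone_chart1 expR_gt0. Qed.

Lemma cone_chartK : cancel cone_chart cone_coord.
Proof.
move=> e; apply/rowP => i; rewrite mxE qf_chart cone_chart1 !expRK mxE.
by case: eqVneq => [->//|_]; case: eqVneq => [->|].
Qed.

Lemma cone_coordK y : cone y -> cone_chart (cone_coord y) = y.
Proof.
move=> [q0 s0]; apply/rowP => i; rewrite mxE !mxE !eqxx /= !lnK ?posrE //.
have -> : off_sum (cone_coord y) = off_sum y.
  by apply: off_sum_ext => k /negPf a /negPf b; rewrite mxE a b.
case: eqVneq => [->|_]; last by case: eqVneq => [->|].
by rewrite qfE subrK mulfK // gt_eqF.
Qed.

Definition tube_chart z : 'rV[R]_(n + n) := row_mx (lsubmx z) (cone_chart (rsubmx z)).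
Definition tube_coord z : 'rV[R]_(n + n) := row_mx (lsubmx z) (cone_coord (rsubmx z)).
Definition tube : set 'rV[R]_(n + n) := [set z | cone (rsubmx z)].

Lemma tubeE z : tube z = cone (rsubmx z).
Proof. by []. Qed.

Lemma tube_open : open tube.
Proof.
apply: open_comp; last exact: cone_open.
by move=> z _; exact: continuous_rsubmx.
Qed.

Lemma tube_chart_tube z : tube (tube_chart z).
Proof. by rewrite /tube /= row_mxKr; exact: cone_chart_cone. Qed.

Lemma tube_chartK : cancel tube_chart tube_coord.
Proof.
by move=> z; rewrite /tube_coord row_mxKl row_mxKr cone_chartK hsubmxK.
Qed.

Lemma tube_coordK z : tube z -> tube_chart (tube_coord z) = z.
Proof.
by move=> Tz; rewrite /tube_chart row_mxKl row_mxKr cone_coordK // hsubmxK.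
Qed.

Lemma tube_chart_ran : tube_chart @` setT = tube.
Proof.
apply/seteqP; split => [_ [z _ <-]|z Tz]; first exact: tube_chart_tube.
by exists (tube_coord z) => //; exact: tube_coordK.
Qed.

Lemma continuous_off_sum : continuous off_sum.
Proof.
apply: rational_continuous; apply: rational_mul; first exact: rational_cst.
rewrite (_ : (fun _ => _) = fun y => \sum_i ((i != i0) && (i != i1))%:R * y 0 i ^+ 2).
  apply: rational_sum => i; apply: rational_mul; first exact: rational_cst.
  by apply: rational_exp; exact: rational_y.
by apply/funext => y; rewrite big_mkcond; apply: eq_bigr => i _;
  case: ifP => _; rewrite ?mul1r ?mul0r.
Qed.

Lemma continuous_cone_chart e : {for e, continuous cone_chart}.
Proof.
apply: continuous_mx => a i; rewrite ord1.
have cexp k : {for e, continuous (fun e : 'rV[R]_n => expR (e 0 k))}.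
  exact: (continuous_comp (@coord_continuous _ _ _ 0 k e) (@continuous_expR R _)).
have [iE|i_0] := eqVneq i i0.
  rewrite (_ : (fun _ => _) = fun e => (expR (e 0 i0) + off_sum e) * (expR (e 0 i1))^-1).
    have c1 : {for e, continuous (fun e => expR (e 0 i0) + off_sum e)}.
      exact: (cvgD (cexp i0) (@continuous_off_sum e)).
    have c2 : {for e, continuous (fun e => (expR (e 0 i1))^-1)}.
      by apply: (cvgV _ (cexp i1)); rewrite gt_eqF // expR_gt0.
    exact: cvgM c1 c2.
  by apply/funext => y; rewrite mxE iE eqxx.
have [iE|i_1] := eqVneq i i1.
  rewrite (_ : (fun _ => _) = fun e => expR (e 0 i1)); first exact: cexp.
  by apply/funext => y; rewrite mxE (negPf i_0) iE eqxx.
rewrite (_ : (fun _ => _) = fun e : 'rV[R]_n => e 0 i); first exact: coord_continuous.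
by apply/funext => y; rewrite mxE (negPf i_0) (negPf i_1).
Qed.

Lemma continuous_cone_coord y : cone y -> {for y, continuous cone_coord}.
Proof.
move=> [q0 s0]; apply: continuous_mx => a i; rewrite ord1.
have [iE|i_0] := eqVneq i i0.
  rewrite (_ : (fun _ => _) = fun y => ln (qf y)).
    exact: (continuous_comp (@continuous_qf R N y) (continuous_ln q0)).
  by apply/funext => x; rewrite mxE iE eqxx.
have [iE|i_1] := eqVneq i i1.
  rewrite (_ : (fun _ => _) = fun y : 'rV[R]_n => ln (y 0 i1)).
    exact: (continuous_comp (@coord_continuous _ _ _ 0 i1 y) (continuous_ln s0)).
  by apply/funext => x; rewrite mxE (negPf i_0) iE eqxx.
rewrite (_ : (fun _ => _) = fun e : 'rV[R]_n => e 0 i); first exact: coord_continuous.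
by apply/funext => x; rewrite mxE (negPf i_0) (negPf i_1).
Qed.

Lemma continuous_row_mx_sub (f : 'rV[R]_n -> 'rV[R]_n) z :
  {for rsubmx z, continuous f} ->
  {for z, continuous (fun z : 'rV[R]_(n + n) => row_mx (lsubmx z) (f (rsubmx z)))}.
Proof.
move=> cf; apply: continuous_mx => a i; rewrite ord1.
case: (split_ordP i) => k ->.
  rewrite (_ : (fun _ => _) = fun z : 'rV[R]_(n + n) => z 0 (lshift n k)).
    exact: coord_continuous.
  by apply/funext => w; rewrite row_mxEl mxE.
rewrite (_ : (fun _ => _) = fun z : 'rV[R]_(n + n) => f (rsubmx z) 0 k).
  apply: continuous_coord_at.
  have c1 : {for z, continuous (@rsubmx R 1 n n)} by exact: continuous_rsubmx.
  exact: (continuous_comp c1 cf).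
by apply/funext => w; rewrite row_mxEr.
Qed.

Lemma continuous_tube_chart z : {for z, continuous tube_chart}.
Proof. by apply: continuous_row_mx_sub; exact: continuous_cone_chart. Qed.

Lemma continuous_tube_coord z : tube z -> {for z, continuous tube_coord}.
Proof. by move=> Tz; apply: continuous_row_mx_sub; exact: continuous_cone_coord. Qed.

Lemma smooth_on_affine (m : nat) (U : set 'rV[R]_m) (f : 'rV[R]_m -> 'rV[R]_m)
    (b : 'rV[R]_m) (A : 'M[R]_m) : open U ->
  (forall x, U x -> f x = b + x *m A) -> smooth_on U f.
Proof.
move=> Uo fE; apply: (smooth_on_ext Uo fE); apply: smooth_on_mx => // a k.
apply: rational_smooth => //.
rewrite (_ : (fun _ => _) = fun x : 'rV[R]_m => b a k + \sum_l x a l * A l k).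
  apply: rational_add; first exact: rational_cst.
  apply: rational_sum => l; apply: rational_mul; last exact: rational_cst.
  apply: (@rational_affine _ _ _ _ (fun v : 'rV[R]_m => v a l)).
    exact: coord_continuous.
  by move=> x v; exact: is_derive_coord.
by apply/funext => z; rewrite !mxE.
Qed.

Let tube_ran_open (u : unit) : open (tube_chart @` setT).
Proof. by rewrite tube_chart_ran; exact: tube_open. Qed.

Let tube_coord_continuous (u : unit) x :
  (tube_chart @` setT) x -> {for x, continuous tube_coord}.
Proof. by rewrite tube_chart_ran; exact: continuous_tube_coord. Qed.

Let tube_chart_smooth (u v : unit) :
  smooth_on [set x | (tube_chart @` setT) x /\ setT (tube_coord x)]
    (tube_chart \o tube_coord).
Proof.
have -> : [set x | (tube_chart @` setT) x /\ setT (tube_coord x)] = tube.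
  by rewrite tube_chart_ran; apply/seteqP; split => [x []|x].
apply: (@smooth_on_affine _ _ _ 0 1%:M); first exact: tube_open.
by move=> z Tz; rewrite /= tube_coordK // add0r mulmx1.
Qed.

Definition tube_manifold : smoothManifold R (n + n) :=
  @SmoothManifold R (n + n) 'rV[R]_(n + n) unit (fun=> setT) (fun=> tube_chart)
    (fun=> tube_coord) (@norm_hausdorff _ _) (@rV_second_countable R _)
    (ex_intro _ 0 I) (@rV_connected R _) (fun p => ex_intro _ tt I)
    (fun=> openT) tube_ran_open (fun _ z _ => tube_chartK z)
    (fun _ z _ => @continuous_tube_chart z) tube_coord_continuous
    tube_chart_smooth.

End TubeDomain.

Lemma jacobian_affine (R : realType) (m : nat) (f : 'rV[R]_m -> 'rV[R]_m)
    (b : 'rV[R]_m) (A : 'M[R]_m) (U : set 'rV[R]_m) x :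
  open U -> U x -> (forall z, U z -> f z = b + z *m A) -> 'J f x = A.
Proof.
move=> Uo Ux fE.
pose df : {linear 'rV[R]_m -> 'rV[R]_m} := mulmxr A.
suff [dfE _] : 'd f x = df :> ('rV[R]_m -> 'rV[R]_m) /\ True.
  apply/matrixP => i j; rewrite /jacobian mxE dfE /=.
  by rewrite -rowE mxE.
split => //; apply: diff_unique.
  move=> z; apply: continuous_mulmx_at; first by [].
  exact: cst_continuous.
apply/eqaddoP => _/posnumP[e].
have nU : \forall h \near (0 : 'rV[R]_m), U (h + x).
  have : \forall z \near x, U z by exact: open_nbhs_nbhs.
  by rewrite (near_shift 0 x); apply: filterS => h /=; rewrite subr0.
apply: filterS nU => h Uh.
rewrite /= !fctE /= !fE // mulmxDl.
rewrite (_ : _ - _ = 0) ?normr0 ?mulr_ge0 //.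
by apply/eqP; rewrite subr_eq0 -addrA [x *m A + _]addrC.
Qed.

Lemma is_derive_rsubmx (R : realType) (n : nat) (F : 'rV[R]_n -> R)
    (z v : 'rV[R]_(n + n)) (d : R) :
  is_derive (rsubmx z) (rsubmx v) F d ->
  is_derive z v (fun w : 'rV[R]_(n + n) => F (rsubmx w)) d.
Proof.
move=> [dF <-]; apply: DeriveDef; last exact: derive_rsubmx.
have addE (u w : 'rV[R]_(n + n)) : rsubmx (u + w) = rsubmx u + rsubmx w.
  by apply/rowP => i; rewrite !mxE.
have scaleE h : rsubmx (h *: v) = h *: rsubmx v by apply/rowP => i; rewrite !mxE.
rewrite /derivable; move: dF; rewrite /derivable.
set f := (fun h => _); set g := (fun h => _); suff -> : f = g by [].
by apply/funext => h; rewrite /f /g /= addE scaleE.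
Qed.

Lemma rational_rsubmx (R : realType) (n : nat) (U : set 'rV[R]_n) (f : 'rV[R]_n -> R) :
  rational_on U f ->
  rational_on [set z | U (rsubmx z)] (fun z : 'rV[R]_(n + n) => f (rsubmx z)).
Proof.
elim=> {f}.
- move=> l dl cl dle; apply: (@rational_affine _ _ _ _ (fun v => dl (rsubmx v))).
    move=> z; have c1 : {for z, continuous (@rsubmx R 1 n n)}.
      exact: continuous_rsubmx.
    exact: (continuous_comp c1 (cl _)).
  by move=> z v; apply: is_derive_rsubmx.
- by move=> f g _ rf _ rg; exact: rational_add.
- by move=> f g _ rf _ rg; exact: rational_mul.
- by move=> f f0 _ rf; apply: rational_inv => // z; exact: f0.
Qed.

(** * Kaehler structure, homogeneity and Ricci eigenvalues of the tube *)

Section TubeKaehler.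
Variables (R : realType) (N : nat).
Local Notation n := N.+3.
Local Notation i0 := (@i0 N).
Local Notation i1 := (@i1 N).
Local Notation G := (tube_metric (@hess R N)).
Local Notation M := (tube_manifold R N).
Local Notation tube := (@tube R N).
Implicit Types (z w : 'rV[R]_(n + n)) (y : 'rV[R]_n).

Lemma chart_ran_tube (i : mfd_index M) : chart_ran i = tube.
Proof. exact: tube_chart_ran. Qed.

Lemma rep_id (i j : mfd_index M) z : tube z -> rep id i j z = z.
Proof. exact: tube_coordK. Qed.

Lemma rep_dom_tube (f : M -> M) (i j : mfd_index M) : rep_dom f i j = tube.
Proof.
rewrite /rep_dom chart_ran_tube; apply/seteqP; split => [z []|z Tz] //.
Qed.

Lemma jacobian_id (i j : mfd_index M) z : tube z -> 'J (rep id i j) z = 1%:M.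
Proof.
move=> Tz; apply: (jacobian_affine (b := 0) (tube_open (R := R) (N := N)) Tz).
by move=> w Tw; rewrite rep_id // add0r mulmx1.
Qed.

Lemma rational_hess i j : rational_on (@cone R N) (fun y => hess y i j).
Proof.
under [X in rational_on _ X]eq_fun do rewrite mxE.
have rq : rational_on (@cone R N) (fun y => (qf y)^-1).
  apply: rational_inv; last exact: rational_qf.
  by move=> y [q0 _]; rewrite gt_eqF.
have rs : rational_on (@cone R N) (fun y : 'rV[R]_n => (y 0 i1)^-1).
  apply: rational_inv; last exact: rational_y.
  by move=> y [_ s0]; rewrite gt_eqF.
apply: rational_add; last by do 2 (apply: rational_mul => //); exact: rational_cst.
apply: rational_add.
  do 2 (apply: rational_mul => //); apply: rational_mul; last exact: rational_dual.
  by apply: rational_mul; [exact: rational_cst|exact: rational_dual].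
by apply: rational_opp; apply: rational_mul => //; exact: rational_cst.
Qed.

Lemma rational_tube_metric a b : rational_on tube (fun z => G z a b).
Proof.
case: (split_ordP a) => i ->; case: (split_ordP b) => j ->.
- under [X in rational_on _ X]eq_fun do rewrite block_mxEul.
  exact: rational_rsubmx (rational_hess i j).
- under [X in rational_on _ X]eq_fun do rewrite block_mxEur mxE.
  exact: rational_cst.
- under [X in rational_on _ X]eq_fun do rewrite block_mxEdl mxE.
  exact: rational_cst.
- under [X in rational_on _ X]eq_fun do rewrite block_mxEdr.
  exact: rational_rsubmx (rational_hess i j).
Qed.

Lemma tube_metric_smooth (i : mfd_index M) : smooth_on (chart_ran i) G.
Proof.
rewrite chart_ran_tube; apply: smooth_on_mx; first exact: tube_open.
move=> a b; apply: rational_smooth; first exact: tube_open.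
exact: rational_tube_metric.
Qed.

Lemma tube_metric_sym (i : mfd_index M) z : chart_ran i z -> (G z)^T = G z.
Proof.
move=> _; rewrite /tube_metric tr_block_mx !trmx0.
by congr block_mx; apply/matrixP => a b; rewrite mxE hess_sym.
Qed.

Lemma tube_metric_pos (i : mfd_index M) z : chart_ran i z ->
  forall v : 'rV[R]_(n + n), v != 0 -> 0 < (v *m G z *m v^T) 0 0.
Proof.
rewrite chart_ran_tube => Tz v v0.
have hp (u : 'rV[R]_n) : 0 <= (u *m hess (rsubmx z) *m u^T) 0 0.
  by have [->|u0] := eqVneq u 0; [rewrite !mul0mx mxE|apply/ltW/hess_pos].
have -> : (v *m G z *m v^T) 0 0 = (lsubmx v *m hess (rsubmx z) *m (lsubmx v)^T) 0 0
   + (rsubmx v *m hess (rsubmx z) *m (rsubmx v)^T) 0 0.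
  rewrite -{1 2}(hsubmxK v) /tube_metric mul_row_block !mulmx0 addr0 add0r.
  by rewrite tr_row_mx mul_row_col mxE.
have [l0|l0] := eqVneq (lsubmx v) 0; last first.
  by apply: ltr_pwDl; [exact: hess_pos|exact: hp].
apply: ltr_wpDl; first exact: hp.
apply: hess_pos => //; apply: contra_neq v0 => r0.
by rewrite -(hsubmxK v) l0 r0 row_mx0.
Qed.

Lemma tube_metric_compat (i j : mfd_index M) z : rep_dom id i j z ->
  G z = 'J (rep id i j) z *m G (rep id i j z) *m ('J (rep id i j) z)^T.
Proof.
rewrite rep_dom_tube => Tz.
by rewrite jacobian_id // rep_id // trmx1 mul1mx mulmx1.
Qed.

Definition tube_riemannian : riemannianMetric M :=
  @RiemannianMetric R (n + n) M (fun=> G) tube_metric_smooth tube_metric_sym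
    tube_metric_pos tube_metric_compat.

Lemma kaehler_form_tube z :
  mulI R n *m G z = block_mx 0 (hess (rsubmx z)) (- hess (rsubmx z)) 0.
Proof.
rewrite /mulI /tube_metric mulmx_block.
by rewrite !(mul0mx, mulmx0, mul1mx, mulNmx, addr0, add0r, oppr0).
Qed.

(** Closedness of the fundamental form is the total symmetry of the third derivatives of the
    potential: the surviving terms cancel in pairs. *)
Lemma tube_kaehler : kaehler tube_riemannian.
Proof.
split.
- by move=> i j z; rewrite rep_dom_tube => Tz; rewrite jacobian_id // mul1mx mulmx1.
- move=> i z _; rewrite /= kaehler_form_tube /mulI tr_block_mx !trmx0 linearN /= trmx1.
  rewrite mulmx_block !(mul0mx, mulmx0, mulmx1, mulNmx, mulmxN, addr0, add0r, oppr0).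
  by rewrite opprK.
move=> i z; rewrite chart_ran_tube => Tz a b c.
pose F b c y := block_mx 0 (hess y) (- hess y) 0 b c.
have kF b' c' : (fun w => kaehler_form tube_riemannian i w b' c') =
    fun w => F b' c' (rsubmx w).
  by apply/funext => w; rewrite /kaehler_form /= kaehler_form_tube.
rewrite !kF.
have p0 k b' c' : partial (lshift n k) (fun w => F b' c' (rsubmx w)) z = 0.
  exact: partial_rsubmx_l.
have pr k b' c' : partial (rshift n k) (fun w => F b' c' (rsubmx w)) z =
    partial k (F b' c') (rsubmx z).
  exact: partial_rsubmx_r.
have Fll k i' j' : partial k (F (lshift n i') (lshift n j')) (rsubmx z) = 0.
  rewrite (_ : F _ _ = fun=> 0); first exact: partial_cst.
  by apply/funext => y; rewrite /F block_mxEul mxE.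
have Frr k i' j' : partial k (F (rshift n i') (rshift n j')) (rsubmx z) = 0.
  rewrite (_ : F _ _ = fun=> 0); first exact: partial_cst.
  by apply/funext => y; rewrite /F block_mxEdr mxE.
have Flr k i' j' : partial k (F (lshift n i') (rshift n j')) (rsubmx z) =
    dhess k i' j' (rsubmx z).
  rewrite (_ : F _ _ = fun y => hess y i' j').
    by have [_] := is_derive_hess k i' j' Tz.
  by apply/funext => y; rewrite /F block_mxEur.
have Frl k i' j' : partial k (F (rshift n i') (lshift n j')) (rsubmx z) =
    - dhess k i' j' (rsubmx z).
  rewrite (_ : F _ _ = fun y => - hess y i' j').
    by have [_] := is_derive_opp (is_derive_hess k i' j' Tz).
  by apply/funext => y; rewrite /F block_mxEdl mxE.
case: (split_ordP a) => a' ->; case: (split_ordP b) => b' ->;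
  case: (split_ordP c) => c' ->; rewrite !(p0, pr, Fll, Frr, Flr, Frl);
  rewrite ?(addr0, add0r) //.
- by rewrite (dhess_sym12 _ b') (dhess_sym23 _ c' b') addNr.
- by rewrite (dhess_sym12 _ c') (dhess_sym23 _ a' c') subrr.
by rewrite (dhess_sym23 _ b' c') (dhess_sym12 _ b') addNr.
Qed.

Section AffineIsometry.
Variables (A : 'M[R]_n) (k m : R) (b : 'rV[R]_n).
Hypothesis autA : cone_automorphism A k m.

(** The complex affine map z |-> b + z A with b and A real. *)
Definition tube_affine z : 'rV[R]_(n + n) := row_mx b 0 + z *m block_mx A 0 0 A.

Lemma tube_affineE z : tube_affine z = row_mx (b + lsubmx z *m A) (rsubmx z *m A).
Proof.
rewrite /tube_affine -{1}(hsubmxK z) mul_row_block !mulmx0 addr0 add0r add_row_mx.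
by rewrite add0r.
Qed.

Lemma tube_affine_tube z : tube z -> tube (tube_affine z).
Proof.
by move=> Tz; rewrite tubeE /= tube_affineE row_mxKr; exact: (cone_aut autA).
Qed.

Lemma continuous_tube_affine z : {for z, continuous tube_affine}.
Proof.
have c2 : {for z, continuous (fun w : 'rV[R]_(n + n) => w *m block_mx A 0 0 A)}.
  by apply: continuous_mulmx_at; [exact: cvg_id|exact: cst_continuous].
exact: (cvgD (cvg_cst _) c2).
Qed.

Definition tube_isometry : M -> M := @tube_coord R N \o tube_affine \o @tube_chart R N.

Lemma rep_tube_isometry (i j : mfd_index M) z : tube z ->
  rep tube_isometry i j z = tube_affine z.
Proof.
move=> Tz; rewrite /rep /= /tube_isometry /= (tube_coordK Tz).
exact/tube_coordK/tube_affine_tube.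
Qed.

Lemma tube_isometry_smooth : smooth_map tube_isometry.
Proof.
split=> [z|i j].
  have c1 : {for z, continuous (@tube_chart R N)} by exact: continuous_tube_chart.
  have c2 : {for tube_chart z, continuous tube_affine} by exact: continuous_tube_affine.
  have cc := continuous_comp c1 c2.
  apply: (continuous_comp cc); apply: continuous_tube_coord.
  exact/tube_affine_tube/tube_chart_tube.
rewrite rep_dom_tube; apply: (smooth_on_affine (tube_open (R := R) (N := N))).
by move=> z Tz; rewrite rep_tube_isometry.
Qed.

Lemma jacobian_tube_isometry (i j : mfd_index M) z : tube z ->
  'J (rep tube_isometry i j) z = block_mx A 0 0 A.
Proof.
move=> Tz; apply: (jacobian_affine (tube_open (R := R) (N := N)) Tz).
by move=> w Tw; rewrite rep_tube_isometry.
Qed.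

Lemma tube_isometry_metric z : tube z ->
  block_mx A 0 0 A *m G (tube_affine z) *m (block_mx A 0 0 A)^T = G z.
Proof.
move=> Tz; rewrite tr_block_mx !trmx0 /tube_metric !mulmx_block.
rewrite !(mul0mx, mulmx0, addr0, add0r) tube_affineE row_mxKr.
by rewrite (hess_aut autA).
Qed.

End AffineIsometry.

Lemma tube_affineK (A : 'M[R]_n) b z : A \in unitmx ->
  tube_affine (invmx A) (- (b *m invmx A)) (tube_affine A b z) = z.
Proof.
move=> Au; rewrite !tube_affineE row_mxKl row_mxKr mulmxDl !mulmxK //.
by rewrite addrA addNr add0r hsubmxK.
Qed.

Lemma tube_isometryK (A : 'M[R]_n) b k m : cone_automorphism A k m ->
  cancel (tube_isometry A b) (tube_isometry (invmx A) (- (b *m invmx A))).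
Proof.
move=> autA z; rewrite /tube_isometry /= tube_coordK.
  by rewrite tube_affineK ?(unitmx_aut autA) // tube_chartK.
exact/(tube_affine_tube _ autA)/tube_chart_tube.
Qed.

Lemma tube_isometry_isometry (A : 'M[R]_n) b k m : cone_automorphism A k m ->
  holomorphic_isometry tube_riemannian (tube_isometry A b).
Proof.
move=> autA; have Au := unitmx_aut autA; have autB := aut_inv autA.
split; first exact: tube_isometry_smooth autA.
  exists (tube_isometry (invmx A) (- (b *m invmx A))).
    exact: tube_isometry_smooth autB.
  split; first exact: tube_isometryK autA.
  have := tube_isometryK (- (b *m invmx A)) autB.
  by rewrite invmxK mulNmx mulmxKV // opprK.
move=> i j z; rewrite rep_dom_tube => Tz; cbv zeta.
rewrite (jacobian_tube_isometry _ autA) // (rep_tube_isometry _ autA) //; split.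
  by rewrite /mulI !mulmx_block
    !(mul0mx, mulmx0, mul1mx, mulmx1, mulNmx, mulmxN, addr0, add0r, oppr0).
exact: tube_isometry_metric autA _ Tz.
Qed.

Lemma tube_homogeneous : homogeneous tube_riemannian.
Proof.
move=> p q; pose P := tube_chart p; pose Q := tube_chart q.
have [A [k [m [autA PAQ]]]] := transitive_aut
  (tube_chart_tube p : cone (rsubmx P)) (tube_chart_tube q : cone (rsubmx Q)).
(* [A] matches the imaginary parts, and the translation then corrects the real part. *)
exists (tube_isometry A (lsubmx Q - lsubmx P *m A)).
  exact: tube_isometry_isometry autA.
rewrite /tube_isometry /= tube_affineE -/P subrK PAQ hsubmxK.
exact: tube_chartK.
Qed.

Local Notation e := (delta_mx 0 i1 : 'rV[R]_n).

Definition cone_ricci y : 'M[R]_n :=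
  - (n%:R / 2) *: (hess y - (2 * (y 0 i1)^-1 ^+ 2) *: (e^T *m e)).

Lemma tube_ricci z : tube z -> ricci G z = tube_metric cone_ricci z.
Proof.
move=> Tz.
have ricci_diag b c : - partial b (hessian_trace (@hess_inv R N) (@dhess R N) c) (rsubmx z) =
    cone_ricci (rsubmx z) b c.
  rewrite partial_hess_trace // !mxE big_ord1 !mxE !eqxx /e1; ring.
have sy12 y i j k : cone y -> dhess i j k y = dhess j i k y.
  by move=> _; exact: dhess_sym12.
have sy23 y i j k : cone y -> dhess i j k y = dhess i k j y.
  by move=> _; exact: dhess_sym23.
have Oo := @cone_open R N; have HK := @mul_hess_inv R N.
have dH := @is_derive_hess R N.
have dK := @derivable_hess_inv R N; have dP := @derivable_dhess R N.
have ddP := @partial_dhess R N; have Hs := @hess_sym R N.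
apply/matrixP => a b; case: (split_ordP a) => i ->; case: (split_ordP b) => j ->.
- by rewrite block_mxEul -ricci_diag; exact: ricci_tube_xx.
- by rewrite block_mxEur [RHS]mxE; exact: (ricci_tube_xy Oo HK dH sy12 sy23).
- by rewrite block_mxEdl [RHS]mxE; exact: (ricci_tube_yx Oo HK dH sy12 sy23).
- by rewrite block_mxEdr -ricci_diag; exact: ricci_tube_yy.
Qed.

Definition shifted_row y : 'rV[R]_n := \row_j shifted y j.

(** For - log q alone this row is y_1 times the shifted point; the rank-one correction of [hess_inv]
    removes two thirds of it. *)
Lemma e_hess_inv y : cone y -> e *m hess_inv y = (y 0 i1 / 3) *: shifted_row y.
Proof.
move=> [q0 s0]; apply/rowP => j; rewrite -rowE !mxE wt1 sw1 /shifted i10 /=.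
by field; rewrite gt_eqF.
Qed.

Definition cone_ricci_endo y : 'M[R]_n :=
  - (n%:R / 2) *: (1%:M - (2 / 3 * (y 0 i1)^-1) *: (e^T *m shifted_row y)).

Lemma tube_ricci_endo z : tube z -> ricci_endo G z = tube_metric cone_ricci_endo z.
Proof.
move=> Tz; rewrite /ricci_endo tube_ricci //.
rewrite (invmx_tube (@mul_hess_inv R N)) // /tube_metric mulmx_block.
rewrite !(mul0mx, mulmx0, addr0, add0r).
suff -> : cone_ricci (rsubmx z) *m hess_inv (rsubmx z) = cone_ricci_endo (rsubmx z) by [].
rewrite /cone_ricci /cone_ricci_endo -scalemxAl mulmxBl mul_hess_inv //.
have eH : e^T *m e *m hess_inv (rsubmx z) =
    (rsubmx z 0 i1 / 3) *: (e^T *m shifted_row (rsubmx z)).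
  by rewrite scalemxAr -e_hess_inv // mulmxA.
rewrite -scalemxAl [X in _ - _ *: X]eH scalerA.
have [_ s0] := Tz; rewrite [X in _ - X *: _](_ : _ = 2 / 3 * (rsubmx z 0 i1)^-1) //.
by field; rewrite gt_eqF.
Qed.

Lemma row_ricci_endo y (v : 'rV[R]_n) : v *m cone_ricci_endo y =
  - (n%:R / 2) *: (v - (2 / 3 * (y 0 i1)^-1 * v 0 i1) *: shifted_row y).
Proof.
rewrite /cone_ricci_endo -scalemxAr mulmxBr mulmx1 -scalemxAr mulmxA.
have -> : v *m e^T = (v 0 i1)%:M.
  by apply/rowP => i; rewrite !ord1 mulmx_eT mxE eqxx mulr1n.
by rewrite mul_scalar_mx scalerA.
Qed.

Lemma shifted_row1 y : shifted_row y 0 i1 = y 0 i1.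
Proof. by rewrite mxE /shifted i10 mulr0 subr0. Qed.

(** On each block the endomorphism is - n/2 times the identity minus a rank-one matrix. Vectors with
    u_1 = 0, such as e_0, have eigenvalue - n/2; the range of the rank-one part is spanned by the
    shifted point, with eigenvalue - n/6. *)
Lemma tube_ricci_eigenvalues :
  ricci_eigenvalues_are tube_riemannian (- (n%:R / 2)) (- (n%:R / 6)).
Proof.
move=> i z; rewrite chart_ran_tube => Tz a; rewrite /= tube_ricci_endo //.
set y := rsubmx z; have s0 : y 0 i1 != 0 by case: Tz => _ s0; rewrite gt_eqF.
have act (v : 'rV[R]_(n + n)) : v *m tube_metric cone_ricci_endo z =
    row_mx (lsubmx v *m cone_ricci_endo y) (rsubmx v *m cone_ricci_endo y).
  by rewrite -{1}(hsubmxK v) mul_row_block !mulmx0 addr0 add0r.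
have ev (u : 'rV[R]_n) : u != 0 -> u *m cone_ricci_endo y = a *: u ->
    a = - (n%:R / 2) \/ a = - (n%:R / 6).
  move=> u0; rewrite row_ricci_endo => E.
  have [u1|u1] := eqVneq (u 0 i1) 0.
    left; move: E; rewrite u1 mulr0 scale0r subr0 => /eqP; rewrite -subr_eq0 -scalerBl.
    by rewrite scaler_eq0 (negPf u0) orbF subr_eq0 => /eqP.
  (* The shifted point has coordinate y_1 at [i1], so this coordinate of the equation multiplies u_1
     by 1 - 2/3. *)
  right; move/rowP/(_ i1): E; rewrite mxE [RHS]mxE [X in _ * X]mxE [X in _ + X]mxE.
  rewrite [X in _ - X]mxE shifted_row1 => E.
  by apply: (mulIf u1); rewrite -E; field.
split=> [/eigenvalueP [v E v0]|].
  rewrite act -{3}(hsubmxK v) scale_row_mx in E; have [El Er] := eq_row_mx E.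
  have [l0|l0] := eqVneq (lsubmx v) 0; last exact: ev l0 El.
  apply: (ev (rsubmx v)) => //; apply: contra_neq v0 => r0.
  by rewrite -(hsubmxK v) l0 r0 row_mx0.
have ev' (u : 'rV[R]_n) b : u != 0 -> u *m cone_ricci_endo y = b *: u ->
    eigenvalue (tube_metric cone_ricci_endo z) b.
  move=> u0 E; apply/eigenvalueP; exists (row_mx u 0).
    by rewrite act row_mxKl row_mxKr E mul0mx scale_row_mx scaler0.
  by apply: contra_neq u0 => u0; rewrite -[u](row_mxKl u (0 : 'rV[R]_n)) u0 linear0.
case=> ->.
  have d01 : (delta_mx 0 i0 : 'rV[R]_n) 0 i1 = 0 by rewrite mxE i10 andbF.
  apply: (ev' (delta_mx 0 i0)); last by rewrite row_ricci_endo d01 mulr0 scale0r subr0.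
  by apply/eqP => /rowP /(_ i0) /eqP; rewrite !mxE !eqxx oner_eq0.
apply: (ev' (shifted_row y)).
  apply/eqP => E; have := shifted_row1 y; rewrite E [LHS]mxE => /esym/eqP.
  by rewrite (negPf s0).
rewrite row_ricci_endo shifted_row1 -[X in _ *: (X - _)]scale1r -scalerBl scalerA.
by congr (_ *: _); field.
Qed.

End TubeKaehler.

(** * Transport along polygonal loops *)

Section Clamp.
Variable R : realType.

Definition clamp (s : R) : R := Num.min (Num.max s 0) 1.

Lemma clamp_le0 s : s <= 0 -> clamp s = 0.
Proof. by move=> s0; rewrite /clamp max_r // min_l. Qed.

Lemma clamp_ge1 s : 1 <= s -> clamp s = 1.
Proof.
by move=> s1; rewrite /clamp max_l ?min_r // (le_trans ler01).
Qed.

Lemma clamp_id s : 0 <= s <= 1 -> clamp s = s.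
Proof. by move=> /andP[s0 s1]; rewrite /clamp max_l ?min_l. Qed.

Lemma continuous_clamp : continuous clamp.
Proof.
move=> s; have c1 : {for s, continuous (fun s : R => Num.max s 0)}.
  exact: (continuous_max (@cvg_id _ (nbhs s)) (cvg_cst _)).
exact: (continuous_min c1 (cvg_cst _)).
Qed.

End Clamp.

(* A process that runs step 0, ..., step (K - 1) one after the other during the
   time intervals [l / K, (l + 1) / K]. *)
Section Progress.
Variables (R : realType) (S : Type) (step : nat -> R -> S -> S) (s0 : S) (K : nat).
Hypothesis step0 : forall m s, step m 0 s = s.

Fixpoint progress (m : nat) (t : R) : S :=
  if m is m'.+1 then step m' (clamp (K%:R * t - m'%:R)) (progress m' t) else s0.

Fixpoint stage (m : nat) : S :=
  if m is m'.+1 then step m' 1 (stage m') else s0.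

Lemma progress_before m t : (forall k, (k < m)%N -> k%:R + 1 <= K%:R * t) ->
  progress m t = stage m.
Proof.
elim: m => //= m ih H; rewrite ih => [|k km]; last by apply: H; exact: ltnW.
by rewrite clamp_ge1 // lerBrDl H.
Qed.

Lemma progress_after l m t : (l <= m)%N -> K%:R * t <= l%:R ->
  progress m t = progress l t.
Proof.
elim: m => [|m ih] /=; first by rewrite leqn0 => /eqP ->.
rewrite leq_eqVlt => /orP[/eqP -> //|lm] H; rewrite clamp_le0 ?step0 ?ih //.
by rewrite subr_le0 (le_trans H) // ler_nat.
Qed.

(** Earlier steps are clamped at 1, hence complete, and later ones at 0, where they are the
    identity. Both endpoints are allowed because consecutive pieces agree there. *)
Lemma progress_piece l t : (l < K)%N -> l%:R <= K%:R * t <= l.+1%:R ->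
  progress K t = step l (K%:R * t - l%:R) (stage l).
Proof.
move=> lK /andP[lt tl]; rewrite (progress_after lK tl) /= progress_before.
  by rewrite clamp_id // subr_ge0 lt lerBlDl natr1.
move=> k kl; apply: le_trans lt; by rewrite natr1 ler_nat.
Qed.

Lemma progress_at0 : progress K 0 = s0.
Proof. by rewrite (@progress_after 0) // mulr0. Qed.

Lemma progress_at1 : progress K 1 = stage K.
Proof.
by apply: progress_before => k kK; rewrite mulr1 natr1 ler_nat.
Qed.

End Progress.

Lemma between_naturals (R : realType) (K : nat) (t : R) : (0 < K)%N ->
  0 < t < 1 -> (forall l, (l <= K)%N -> t != l%:R / K%:R) ->
  exists2 l, (l < K)%N & l%:R < K%:R * t < l.+1%:R.
Proof.
move=> K0 /andP[t0 t1] tN; have KR : 0 < K%:R :> R by rewrite ltr0n.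
have Kt0 : 0 <= K%:R * t by rewrite mulr_ge0 ?ltW.
have /andP[l1 l2] := truncn_itv Kt0; set l := Num.truncn _ in l1 l2.
have lK : (l < K)%N.
  by rewrite -(ltr_nat R) (le_lt_trans l1) // gtr_pMr.
exists l => //; rewrite l2 andbT lt_neqAle l1 andbT.
apply/eqP => E; have /eqP := tN l (ltnW lK); apply.
by rewrite E mulrC mulKf // gt_eqF.
Qed.

Lemma continuous_rotation (R : realType) (m : nat) (X : 'M[R]_m) (th : R) :
  {for th, continuous (rotation X)}.
Proof.
apply: continuous_mx => i j.
rewrite (_ : (fun _ => _) = fun th => (i == j)%:R + sin th * X i j
  + (1 - cos th) * (X *m X) i j); last first.
  by apply/funext => s; rewrite /rotation [LHS]mxE [X in X + _]mxE [X in X + _ + _]mxE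
    [X in _ + X + _]mxE [X in _ + X]mxE.
have cs : {for th, continuous (fun s : R => sin s * X i j)}.
  exact: (cvgM (@continuous_sin R th) (cvg_cst _)).
have cc : {for th, continuous (fun s : R => 1 - cos s)}.
  exact: (cvgB (cvg_cst _) (@continuous_cos R th)).
have c2 : {for th, continuous (fun s : R => (1 - cos s) * (X *m X) i j)}.
  exact: (cvgM cc (cvg_cst _)).
have c1 : {for th, continuous (fun s : R => (i == j)%:R + sin s * X i j)}.
  exact: (cvgD (cvg_cst _) cs).
exact: (cvgD c1 c2).
Qed.

Lemma is_derive_rotation (R : realType) (m : nat) (X : 'M[R]_m) (a b t : R) :
  X *m X *m X = - X ->
  is_derive t 1 (fun t => rotation X (a * t + b)) (a *: (rotation X (a * t + b) *m X)).
Proof.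
move=> X3; apply/is_derive_mxP => i j; rewrite rotation_mulX //.
rewrite (_ : (fun _ => _) = fun t => (i == j)%:R + sin (a * t + b) * X i j
  + (1 - cos (a * t + b)) * (X *m X) i j); last first.
  by apply/funext => s; rewrite /rotation [LHS]mxE [X in X + _]mxE [X in X + _ + _]mxE
    [X in _ + X + _]mxE [X in _ + X]mxE.
have dl : is_derive t 1 (fun t : R => a * t + b) a.
  have := is_derive_add (is_derive_mul (is_derive_const a t 1) (is_derive_id t 1))
    (is_derive_const b t 1).
  by rewrite mul0r add0r mulr1 addr0.
have ds : is_derive t 1 (fun t => sin (a * t + b)) (cos (a * t + b) * a).
  exact: is_derive1_comp (is_derive_sin _) dl.
have dc : is_derive t 1 (fun t => cos (a * t + b)) (- sin (a * t + b) * a).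
  exact: is_derive1_comp (is_derive_cos _) dl.
have c1 := is_derive_const ((i == j)%:R : R) t 1.
have c2 := is_derive_mul ds (is_derive_const (X i j) t 1).
have c3 := is_derive_mul (is_derive_add (is_derive_const 1 t 1) (is_derive_opp dc))
  (is_derive_const ((X *m X) i j) t 1).
apply: is_derive_eq (is_derive_add (is_derive_add c1 c2) c3) _.
by rewrite !mxE; ring.
Qed.

Section ChristoffelContraction.
Variables (R : realType) (N : nat).
Local Notation n := N.+3.
Local Notation G := (tube_metric (@hess R N)).

Lemma connection_mxZ a (x y : 'rV[R]_n) :
  connection_mx (a *: x) y = a *: connection_mx x y.
Proof.
apply/matrixP => j k; rewrite [RHS]mxE !connection_mx_entry mulr_sumr.
by apply: eq_bigr => i _; rewrite mxE mulrA.
Qed.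

(** For a real velocity x the transport equation reads V' = V (i C), where C is the connection
    matrix in direction x. It depends on the imaginary part of z only, so its coefficients are
    constant along a segment in the real direction. *)
Lemma christoffel_contraction (z : 'rV[R]_(n + n)) (x : 'rV[R]_n)
    (v : 'rV[R]_(n + n)) : tube z ->
  - (\row_k \sum_a \sum_b christoffel G k a b z * row_mx x 0 0 a * v 0 b) =
  v *m complex_mx 0 (connection_mx x (rsubmx z)).
Proof.
move=> Tz.
have sy12 (y : 'rV[R]_n) i j k : cone y -> dhess i j k y = dhess j i k y :> R.
  by move=> _; exact: dhess_sym12.
have sy23 (y : 'rV[R]_n) i j k : cone y -> dhess i j k y = dhess i k j y :> R.
  by move=> _; exact: dhess_sym23.
have HK := @mul_hess_inv R N; have dH := @is_derive_hess R N.
rewrite -[in RHS](hsubmxK v) row_complex_mx !mulmx0 sub0r addr0.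
apply/rowP => k; rewrite [LHS]mxE [X in - X]mxE big_split_ord /=.
rewrite [X in _ + X]big1 => [|a _]; last first.
  by rewrite big1 // => b _; rewrite row_mxEr mxE mulr0 mul0r.
under eq_bigr do under eq_bigr do rewrite row_mxEl.
rewrite addr0; case: (split_ordP k) => k' ->.
  rewrite row_mxEl [RHS]mxE; congr (- _); rewrite [RHS]mxE.
  under eq_bigr do rewrite big_split_ord /=.
  under eq_bigr => a _ do under eq_bigr => b _ do
    rewrite (christoffel_xxx HK) // mul0r mul0r.
  under eq_bigr => a _ do under [X in _ + X]eq_bigr => b _ do
    rewrite (christoffel_xxy HK dH sy12) //.
  under eq_bigr do rewrite big1_eq add0r.
  rewrite exchange_big /=; apply: eq_bigr => b _.
  rewrite connection_mx_entry mxE mulr_sumr; apply: eq_bigr => a _; ring.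
rewrite row_mxEr [RHS]mxE.
under eq_bigr do rewrite big_split_ord /=.
under eq_bigr => a _ do under [X in _ + X]eq_bigr => b _ do
  rewrite (christoffel_yxy HK) // mul0r mul0r.
under eq_bigr => a _ do under eq_bigr => b _ do
  rewrite (christoffel_yxx HK dH sy12 sy23) //.
under eq_bigr do rewrite big1_eq addr0.
rewrite exchange_big /= -sumrN; apply: eq_bigr => b _.
rewrite connection_mx_entry mxE mulr_sumr -sumrN; apply: eq_bigr => a _; ring.
Qed.

End ChristoffelContraction.

Section PolygonalLoop.
Variables (R : realType) (N : nat).
Local Notation n := N.+3.
Local Notation M := (tube_manifold R N).
Local Notation tube := (@tube R N).
Variables (z0 : 'rV[R]_(n + n)) (K : nat) (c : nat -> R) (zeta : nat -> 'rV[R]_n).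
Hypothesis Tz0 : tube z0.
Hypothesis K0 : (0 < K)%N.
Let y := rsubmx z0.
Let Z l : 'M[R]_(n + n) := complex_mx 0 (connection_mx (zeta l) y).
Hypothesis Z3 : forall l, Z l *m Z l *m Z l = - Z l.

(** As s runs from 0 to 1, the real part moves by c_l s along zeta_l while [turn_step] turns the
    transport by the angle c_l s. Vectors are rows, so the transports along successive sides
    multiply on the right. *)
Definition move_step l (s : R) (x : 'rV[R]_n) := x + (c l * s) *: zeta l.
Definition turn_step l (s : R) (P : 'M[R]_(n + n)) := P *m rotation (Z l) (c l * s).

Hypothesis closed_path : stage move_step (lsubmx z0) K = lsubmx z0.

Let move0 m x : move_step m 0 x = x.
Proof. by rewrite /move_step mulr0 scale0r addr0. Qed.

Let turn0 m P : turn_step m 0 P = P.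
Proof. by rewrite /turn_step mulr0 rotation0 mulmx1. Qed.

Definition curve (t : R) : 'rV[R]_(n + n) :=
  row_mx (progress move_step (lsubmx z0) K K t) y.
Definition transport (t : R) : 'M[R]_(n + n) := progress turn_step 1%:M K K t.
Definition loop (t : R) : M := tube_coord (curve t).

Let continuous_clamped m (t : R) :
  {for t, continuous (fun t : R => c m * clamp (K%:R * t - m%:R))}.
Proof.
have c1 : {for t, continuous (fun t : R => K%:R * t - m%:R)}.
  have c0 : {for t, continuous (fun t : R => K%:R * t)}.
    exact: (cvgM (cvg_cst _) (@cvg_id _ (nbhs t))).
  exact: (cvgB c0 (cvg_cst _)).
have c2 := continuous_comp c1 (@continuous_clamp R _).
exact: (cvgM (cvg_cst _) c2).
Qed.

Let continuous_move m (t : R) :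
  {for t, continuous (progress move_step (lsubmx z0) K m)}.
Proof.
elim: m => [|m ih] /=; first exact: cst_continuous.
apply: continuous_mx => i j.
rewrite (_ : (fun _ => _) = fun t : R => progress move_step (lsubmx z0) K m t i j +
  c m * clamp (K%:R * t - m%:R) * zeta m i j); last first.
  by apply/funext => s; rewrite !mxE.
have c1 : {for t, continuous (fun t : R => progress move_step (lsubmx z0) K m t i j)}.
  exact: continuous_coord_at.
have c2 : {for t, continuous (fun t : R => c m * clamp (K%:R * t - m%:R) * zeta m i j)}.
  have c3 : {for t, continuous (fun t : R => c m * clamp (K%:R * t - m%:R))}.
    exact: continuous_clamped.
  exact: (cvgM c3 (cvg_cst _)).
exact: (cvgD c1 c2).
Qed.

Lemma continuous_transport (t : R) : {for t, continuous transport}.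
Proof.
suff cm m : {for t, continuous (progress turn_step 1%:M K m)} by exact: cm.
elim: m => [|m ih] /=; first exact: cst_continuous.
have c3 : {for t, continuous (fun t : R => c m * clamp (K%:R * t - m%:R))}.
  exact: continuous_clamped.
apply: continuous_mulmx_at => //.
exact: (continuous_comp c3 (@continuous_rotation _ _ _ _)).
Qed.

Let continuous_row (f : R -> 'rV[R]_n) (t : R) : {for t, continuous f} ->
  {for t, continuous (fun t : R => row_mx (f t) y)}.
Proof.
move=> cf; apply: continuous_mx => i j; rewrite ord1; case: (split_ordP j) => k ->.
  rewrite (_ : (fun _ => _) = fun t : R => f t 0 k); first exact: continuous_coord_at.
  by apply/funext => s; rewrite row_mxEl.
rewrite (_ : (fun _ => _) = fun=> y 0 k); first exact: cst_continuous.
by apply/funext => s; rewrite row_mxEr.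
Qed.

Let row_tube (x : 'rV[R]_n) : tube (row_mx x y).
Proof. by rewrite tubeE /= row_mxKr. Qed.

Lemma continuous_loop (t : R) : {for t, continuous loop}.
Proof.
have c1 : {for t, continuous curve}.
  apply: continuous_row; exact: continuous_move.
have c2 : {for curve t, continuous (@tube_coord R N)}.
  apply: continuous_tube_coord; exact: row_tube.
exact: (continuous_comp c1 c2).
Qed.

Lemma chart_loop (t : R) : tube_chart (loop t) = curve t.
Proof. by apply: tube_coordK; exact: row_tube. Qed.

Let piece l (t : R) : 'rV[R]_(n + n) :=
  row_mx (move_step l (K%:R * t - l%:R) (stage move_step (lsubmx z0) l)) y.

Let curve_piece l t : (l < K)%N -> l%:R <= K%:R * t <= l.+1%:R -> curve t = piece l t.
Proof. by move=> lK tl; rewrite /curve (progress_piece _ move0 lK tl). Qed.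

Let transport_piece l t : (l < K)%N -> l%:R <= K%:R * t <= l.+1%:R ->
  transport t = turn_step l (K%:R * t - l%:R) (stage turn_step 1%:M l).
Proof. by move=> lK tl; rewrite /transport (progress_piece _ turn0 lK tl). Qed.

Let pieceE l : piece l = fun t => row_mx (stage move_step (lsubmx z0) l
  - (c l * l%:R) *: zeta l) y + t *: row_mx ((c l * K%:R) *: zeta l) 0.
Proof.
apply/funext => t; rewrite /piece /move_step scale_row_mx scaler0 add_row_mx addr0.
congr row_mx; rewrite -addrA; congr (_ + _); rewrite scalerA addrC -scalerBl.
by congr (_ *: _); ring.
Qed.

Let is_derive_line (u v : 'rV[R]_(n + n)) (t : R) :
  is_derive t 1 (fun t : R => u + t *: v) v.
Proof.
apply/is_derive_mxP => i j.
rewrite (_ : (fun _ => _) = fun t : R => u i j + t * v i j); last first.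
  by apply/funext => s; rewrite !mxE.
have := is_derive_add (is_derive_const (u i j) t 1)
  (is_derive_mul (is_derive_id t 1) (is_derive_const (v i j) t 1)).
by rewrite mul1r mulr0 addr0 add0r.
Qed.

Lemma loop_piecewise_smooth : piecewise_smooth loop.
Proof.
have KR : 0 < K%:R :> R by rewrite ltr0n.
exists K, (fun l => l%:R / K%:R); split; first by rewrite mul0r.
split; first by rewrite divff // pnatr_eq0 -lt0n.
move=> l lK; split; first by rewrite ltr_pM2r ?invr_gt0 // ltr_nat.
(* The formula of one side describes a straight line for all times, so it extends the side smoothly
   to the whole real line. *)
exists setT, (fun t => tube_coord (piece l t)); split => //.
- exact: openT.
- split=> [t _|i].
    have cp : {for t, continuous (piece l)}.
      rewrite pieceE; set u := row_mx _ _; set v := row_mx _ _.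
      by have [/derivable1_diffP/differentiable_continuous] := is_derive_line u v t.
    have ct : {for piece l t, continuous (@tube_coord R N)}.
      apply: continuous_tube_coord; exact: row_tube.
    exact: (continuous_comp cp ct).
  rewrite setTI preimage_setT.
  apply: (@smooth_on_ext _ _ _ _ _ (piece l)); first exact: openT.
    by move=> s _ /=; rewrite tube_coordK //; exact: row_tube.
  rewrite pieceE; set u := row_mx _ _; set v := row_mx _ _.
  apply: smooth_on_mx => [|i' j]; first exact: openT.
  apply: rational_smooth; first exact: openT.
  rewrite (_ : (fun _ => _) = fun t : R => u i' j + t * v i' j); last first.
    by apply/funext => s; rewrite !mxE.
  apply: rational_add; first exact: rational_cst.
  apply: rational_mul; last exact: rational_cst.
  apply: (@rational_affine _ _ _ (fun t : R => t) (fun w : R => w)) => s; exact: cvg_id.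
move=> t; rewrite in_itv /= => /andP[t1 t2].
rewrite /loop (curve_piece lK) //.
by move: t1 t2; rewrite ler_pdivrMr // ler_pdivlMr // ![t * _]mulrC => -> ->.
Qed.

Lemma loop0 : loop 0 = tube_coord z0.
Proof. by rewrite /loop /curve (progress_at0 _ K move0) hsubmxK. Qed.

Lemma loop1 : loop 1 = tube_coord z0.
Proof. by rewrite /loop /curve progress_at1 closed_path hsubmxK. Qed.

Lemma loop_null_homotopic : null_homotopic (tube_coord z0 : M) loop.
Proof.
(* The carrier of the manifold is a vector space, so the loop contracts linearly to its base
   point. *)
pose H (x : R * R) : M := (1 - x.1) *: (loop x.2 : 'rV[R]_(n + n))
   + x.1 *: (tube_coord z0 : 'rV[R]_(n + n)).
exists H; split; last first.
  move=> t _; rewrite /H /=; split; first by rewrite subr0 scale1r scale0r addr0.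
  - by rewrite subrr scale0r scale1r add0r.
  - by rewrite loop0 -scalerDl subrK scale1r.
  by rewrite loop1 -scalerDl subrK scale1r.
apply: continuous_subspaceT => x.
suff : {for x, continuous (H : R * R -> 'rV[R]_(n + n))} by [].
apply: continuous_mx => i j.
rewrite (_ : (fun _ => _) = fun x : R * R => (1 - x.1) * (loop x.2 : 'rV[R]_(n + n)) i j
   + x.1 * (tube_coord z0 : 'rV[R]_(n + n)) i j); last first.
  by apply/funext => w; rewrite !mxE.
have c1 : {for x, continuous (@fst R R)} by exact: cvg_fst.
have c2 : {for x, continuous (@snd R R)} by exact: cvg_snd.
have c3 : {for x, continuous (fun x : R * R => (loop x.2 : 'rV[R]_(n + n)) i j)}.
  have c0 : {for x.2, continuous (loop : R -> 'rV[R]_(n + n))} by exact: continuous_loop.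
  have c1' : {for x, continuous (fun x : R * R => loop x.2 : 'rV[R]_(n + n))}.
    exact: (continuous_comp c2 c0).
  exact: (continuous_coord_at c1').
have c4 : {for x, continuous (fun x : R * R => 1 - x.1)}.
  exact: (cvgB (cvg_cst _) c1).
exact: (cvgD (cvgM c4 c3) (cvgM c1 (cvg_cst _))).
Qed.

Lemma loop_parallel (v : 'rV[R]_(n + n)) :
  parallel_along (tube_riemannian R N) loop (fun t _ => v *m transport t).
Proof.
split.
- move=> t i j _ _ _; rewrite jacobian_id ?mulmx1 //= chart_loop; exact: row_tube.
- move=> i; apply: continuous_subspaceT => t.
  apply: continuous_mulmx_at; [exact: cst_continuous|exact: continuous_transport].
have KR : 0 < K%:R :> R by rewrite ltr0n.
(* The exceptional times are the corners of the polygon; any other time lies inside one side, near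
   which curve and transport have closed formulas. *)
exists [seq l%:R / K%:R | l <- iota 0 K.+1] => t i t01 tE _; move: t01; rewrite in_itv /= => t01.
have [l lK /andP[l1 l2]] : exists2 l, (l < K)%N & l%:R < K%:R * t < l.+1%:R.
  apply: between_naturals => // l lK; apply: contraNneq tE => ->.
  by apply: (map_f (fun l : nat => l%:R / K%:R)); rewrite mem_iota.
have nt : \forall s \near t, l%:R <= K%:R * s <= l.+1%:R.
  have ck : {for t, continuous (fun s : R => K%:R * s)}.
    exact: (cvgM (cvg_cst _) (@cvg_id _ (nbhs t))).
  have lKt : K%:R * t \in `]l%:R, l.+1%:R[ by rewrite in_itv /= l1.
  have nK : \forall s \near t, K%:R * s \in `]l%:R, l.+1%:R[ := ck _ (near_in_itvoo lKt).
  by apply: filterS nK => s /=; rewrite in_itv /= => /andP[/ltW -> /ltW ->].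
have lt : l%:R <= K%:R * t <= l.+1%:R by rewrite !ltW.
have dcurve : is_derive t 1 (@tube_chart R N \o loop) (row_mx ((c l * K%:R) *: zeta l) 0).
  have : is_derive t 1 (piece l) (row_mx ((c l * K%:R) *: zeta l) 0).
    by rewrite pieceE; exact: is_derive_line.
  apply: near_eq_is_derive; apply: filterS nt => s ls.
  by rewrite /= chart_loop (curve_piece lK ls).
have [_ Ec] := dcurve; rewrite /= Ec chart_loop christoffel_contraction; last exact: row_tube.
rewrite /curve row_mxKr.
have dtr : is_derive t 1 transport ((c l * K%:R) *: (transport t *m Z l)).
  rewrite (transport_piece lK lt) /turn_step.
  have dr := is_derive_rotation (c l * K%:R) (- (c l * l%:R)) t (Z3 l).
  have := is_derive_mulmx (is_derive_cst (stage turn_step 1%:M l) t 1) dr.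
  rewrite mul0mx add0r -scalemxAr mulmxA.
  have -> : c l * K%:R * t - c l * l%:R = c l * (K%:R * t - l%:R) by ring.
  apply: near_eq_is_derive; apply: filterS nt => s ls.
  rewrite (transport_piece lK ls) /turn_step; congr (_ *m rotation _ _); ring.
have := is_derive_mulmx (is_derive_cst v t 1) dtr.
rewrite mul0mx add0r connection_mxZ.
have -> : complex_mx 0 ((c l * K%:R) *: connection_mx (zeta l) y) = (c l * K%:R) *: Z l.
  by rewrite complex_mxZ scaler0.
by rewrite -!scalemxAr mulmxA.
Qed.

Lemma polygonal_holonomy (i : mfd_index M) :
  restricted_holonomy (tube_riemannian R N) (tube_coord z0) i (stage turn_step 1%:M K).
Proof.
exists loop; split.
- by rewrite loop0 loop1.
- exact: loop_piecewise_smooth.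
- exact: loop_null_homotopic.
move=> v; exists (fun t _ => v *m transport t); split; first exact: loop_parallel.
  by rewrite /transport (progress_at0 _ K turn0) mulmx1.
by rewrite /transport progress_at1.
Qed.

End PolygonalLoop.

(** * Irreducibility of the tube *)

Section Irreducible.
Variables (R : realType) (N : nat).
Local Notation n := N.+3.
Local Notation M := (tube_manifold R N).
Local Notation Phi := (@complex_mx R n).
Local Notation y0 := (@base_point R N).

(* The loop is a parallelogram in the fibre x + i y, y fixed: the transports along
   its sides are those at the base point, conjugated by A. *)
Lemma loop_rotation_holonomy (z : 'rV[R]_(n + n)) (i : mfd_index M) (A : 'M[R]_n) (k m : R)
    j (a b : R) : cone_automorphism A k m -> rsubmx z = y0 *m A -> off_plane j ->
  restricted_holonomy (tube_riemannian R N) (tube_coord z) i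
    (Phi (invmx A) 0 *m loop_rotation j a b *m Phi A 0).
Proof.
move=> autA zA hj; have Au := unitmx_aut autA.
have AV : Phi (invmx A) 0 *m Phi A 0 = 1%:M.
  by rewrite complex_mxM !(mul0mx, mulmx0) subr0 addr0 mulVmx // -complex_mx1.
have VA : Phi A 0 *m Phi (invmx A) 0 = 1%:M.
  by rewrite complex_mxM !(mul0mx, mulmx0) subr0 addr0 mulmxV // -complex_mx1.
have Tz : tube z by rewrite /tube /= zA; exact: (cone_aut autA (@base_cone R N)).
have conj x : connection_mx (x *m A) (rsubmx z) =
    invmx A *m connection_mx x y0 *m A.
  by rewrite -mulmxA -(connection_aut autA x (@base_cone R N)) mulKmx // zA.
pose c := nth 0 [:: a; b; - a; - b].
(* Beyond the four sides [nth] returns the zero vector, whose connection matrix is 0; this settles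
   the cubic identity for every index. *)
pose zeta := nth 0 [:: xD R N *m A; xS R j *m A; xD R N *m A; xS R j *m A].
have ZC x : Phi 0 (connection_mx (x *m A) (rsubmx z)) =
    Phi (invmx A) 0 *m Phi 0 (connection_mx x y0) *m Phi A 0.
  by rewrite conj !complex_mxM !(mul0mx, mulmx0, subrr, oppr0, subr0, addr0, add0r).
have Z3 l : Phi 0 (connection_mx (zeta l) (rsubmx z)) *m
    Phi 0 (connection_mx (zeta l) (rsubmx z)) *m
    Phi 0 (connection_mx (zeta l) (rsubmx z)) =
    - Phi 0 (connection_mx (zeta l) (rsubmx z)).
  apply: complex_imag3.
  have conj3 (X : 'M[R]_n) : X *m X *m X = X ->
      (invmx A *m X *m A) *m (invmx A *m X *m A) *m (invmx A *m X *m A) =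
      invmx A *m X *m A.
    by move=> X3; rewrite -[in RHS]X3 !mulmxA !(mulmxK Au).
  have zeta_cases : [\/ zeta l = xD R N *m A, zeta l = xS R j *m A | zeta l = 0].
    rewrite /zeta; case: l => [|[|[|[|l]]]] /=; try by [constructor 1|constructor 2].
    by constructor 3; rewrite nth_nil.
  case: zeta_cases => ->.
  - by rewrite conj connection_D; apply: conj3; rewrite cD2 cP_D.
  - by rewrite conj connection_S //; apply: conj3; exact: cS3.
  by rewrite -(scale0r (zeta 0)) connection_mxZ scale0r !mul0mx.
have closed : stage (move_step c zeta) (lsubmx z) 4 = lsubmx z.
  rewrite /stage /move_step /c /zeta /= !mulr1 !scaleNr.
  by rewrite addrAC !addrK.
have conj4 (r1 r2 r3 r4 V P : 'M[R]_(n + n)) : P *m V = 1%:M ->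
    V *m (r1 *m r2 *m r3 *m r4) *m P =
    (V *m r1 *m P) *m (V *m r2 *m P) *m (V *m r3 *m P) *m (V *m r4 *m P).
  move=> PV; have PVK X : X *m P *m V = X by rewrite -mulmxA PV mulmx1.
  by rewrite !mulmxA !PVK.
have -> : Phi (invmx A) 0 *m loop_rotation j a b *m Phi A 0 =
    rotation (Phi 0 (connection_mx (xD R N *m A) (rsubmx z))) a
    *m rotation (Phi 0 (connection_mx (xS R j *m A) (rsubmx z))) b
    *m rotation (Phi 0 (connection_mx (xD R N *m A) (rsubmx z))) (- a)
    *m rotation (Phi 0 (connection_mx (xS R j *m A) (rsubmx z))) (- b).
  rewrite !ZC connection_D (connection_S R hj) /loop_rotation conj4 //.
  by congr (_ *m _ *m _ *m _); exact: rotation_conj.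
have := polygonal_holonomy Tz (isT : (0 < 4)%N) Z3 closed i.
by rewrite /stage /turn_step /= !mulr1 mul1mx.
Qed.

Lemma tube_irreducible : irreducible_metric (tube_riemannian R N).
Proof.
move=> p i _ W; rewrite -(tube_chartK p); set z := tube_chart p => stW.
have [A [k [m [autA yA]]]] := transitive_aut (@base_cone R N)
  (tube_chart_tube p : cone (rsubmx z)).
have Au := unitmx_aut autA.
have AV : Phi (invmx A) 0 *m Phi A 0 = 1%:M.
  by rewrite complex_mxM !(mul0mx, mulmx0) subr0 addr0 mulVmx // -complex_mx1.
(* The differential of the automorphism is right multiplication by [Phi A 0]; its inverse carries
   [W] back to the base point, where it is stable under the unconjugated commutators. *)
have [|W0|Wf] := @base_irreducible R N (W *m Phi (invmx A) 0).
- move=> j hj a b; have /(submxMr (Phi (invmx A) 0)) :=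
    stW _ (loop_rotation_holonomy i a b autA (esym yA) hj).
  by move: (loop_rotation j a b) => L; rewrite -!mulmxA (mulmx1C AV) mulmx1.
- by left; rewrite -[W]mulmx1 -AV mulmxA W0 mul0mx.
right; have [_ Vu] := mulmx1_unit (mulmx1C AV).
by rewrite /row_full -(mxrankMfree W (B := Phi (invmx A) 0)) // row_free_unit.
Qed.

End Irreducible.

Theorem mainTheorem3 (R : realType) (n : nat) (hn : (3 <= n)%N) :
  exists (M : smoothManifold R (n + n)) (g : riemannianMetric M),
    kaehler g /\ homogeneous g /\ irreducible_metric g /\
    ~ compact [set: M] /\
    exists lam mu : R, lam < 0 /\ mu < 0 /\ lam <> mu /\
      ricci_eigenvalues_are g lam mu.
Proof.
case: n hn => [//|[//|[//|N]]] _.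
exists (tube_manifold R N), (tube_riemannian R N).
split; first exact: tube_kaehler.
split; first exact: tube_homogeneous.
split; first exact: tube_irreducible.
split; first exact: rV_not_compact.
have n0 : 0 < N.+3%:R :> R by rewrite ltr0n.
exists (- (N.+3%:R / 2)), (- (N.+3%:R / 6)).
split; first by lra.
split; first by lra.
split; last exact: tube_ricci_eigenvalues.
by move=> E; lra.
Qed.
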